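(* Let $X=(X_{k,l})_{k,l\ge0}$ be a family of sets. (1) Let $P$ be a ProP and $\phi:\mathbf{Gr}_{\mathrm{ind}}(X)\to P$ a morphism of $\mathfrak S\times\mathfrak S^{op}$-modules. There exists a unique ProP morphism $\Phi:\mathbf{Gr}(X)\to P$ with $\Phi|_{\mathbf{Gr}_{\mathrm{ind}}(X)}=\phi$; that is, $\mathbf{Gr}(X)$ is the free ProP generated by $\mathbf{Gr}_{\mathrm{ind}}(X)$. Furthermore $\mathbf{Gr}^{\uparrow}(X)$ is the free ProP generated by $\mathbf{Gr}^{\uparrow}_{\mathrm{ind}}(X)$, which is isomorphic to the trivial $\mathfrak S\times\mathfrak S^{op}$-module generated by $X$. (2) Let $P$ be a ProP and $\phi:\mathbf{PGr}_{\mathrm{ind}}(X)\to P$ a morphism of $\mathfrak S\times\mathfrak S^{op}$-modules. There exists a unique ProP morphism $\Phi:\mathbf{PGr}(X)\to P$ with $\Phi|_{\mathbf{PGr}_{\mathrm{ind}}(X)}=\phi$; that is, $\mathbf{PGr}(X)$ is the free ProP generated by $\mathbf{PGr}_{\mathrm{ind}}(X)$. Furthermore $\mathbf{PGr}^{\uparrow}(X)$ is the free ProP generated by $\mathbf{PGr}^{\uparrow}_{\mathrm{ind}}(X)$, which is isomorphic to the free $\mathfrak S\times\mathfrak S^{op}$-module generated by $X$.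
   Context: $[n]=\{1,\dots,n\}$. Graphs. A graph is a tuple $G=(V(G),E(G),I(G),O(G),IO(G),L(G),s,t,\alpha,\beta)$ where $V(G)$ (vertices), $E(G)$ (internal edges), $I(G)$ (input edges), $O(G)$ (output edges), $IO(G)$ (input-output edges), $L(G)$ (loops) are finite sets, $s:E(G)\sqcup O(G)\to V(G)$, $t:E(G)\sqcup I(G)\to V(G)$, $\alpha:I(G)\sqcup IO(G)\to[i(G)]$ a bijection with $i(G)=|I(G)|+|IO(G)|$, $\beta:O(G)\sqcup IO(G)\to[o(G)]$ a bijection with $o(G)=|O(G)|+|IO(G)|$. For $v\in V(G)$: $I(v)=\{e\in I(G)\sqcup E(G):t(e)=v\}$, $O(v)=\{e\in O(G)\sqcup E(G):s(e)=v\}$, $i(v)=|I(v)|$, $o(v)=|O(v)|$. Operations: $\sigma\cdot G$ replaces $\beta$ by $\sigma\circ\beta$, $G\cdot\tau$ replaces $\alpha$ by $\tau^{-1}\circ\alpha$; $G*G'$ is the disjoint union with input/output indices of $G'$ shifted by $i(G)$, resp. $o(G)$; for $o(G)=i(G')$, $G'\circ G$ glues, for each $r\in[o(G)]$, the output (or input-output) edge of $G$ with index $r$ to the input (or input-output) edge of $G'$ with index $r$ (an output edge $f$ glued to an input edge $e$ becomes an internal edge from $s(f)$ to $t'(e)$; gluings involving input-output edges produce input, output or input-output edges), vertices and loops taken as disjoint unions, input indices from $G$, output indices from $G'$. Units: the empty graph, and the graph with one input-output edge. Decorated graphs. An $X$-decorated graph is a pair $(G,d_G)$ with $d_G:V(G)\to\bigsqcup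 X_{k,l}$ such that $d_G(v)\in X_{i(v),o(v)}$; isomorphisms are graph isomorphisms preserving decorations. $\mathbf{Gr}(X)(k,l)$ is the vector space spanned by isoclasses of $X$-decorated graphs with $i(G)=k$, $o(G)=l$, with the operations above (decorations carried along); it is a ProP. A planar graph is a graph with total orders on each $I(v)$ and $O(v)$ (preserved by isomorphisms and by the operations); $\mathbf{PGr}(X)$ is defined likewise with $X$-decorated planar graphs. $\mathbf{Gr}^{\uparrow}(X)$, $\mathbf{PGr}^{\uparrow}(X)$ are the sub-ProPs spanned by (planar) decorated graphs without cycles (sequences $(e_1,\dots,e_k)$, $k\ge1$, of internal edges with $t(e_i)=s(e_{i+1})$, $t(e_k)=s(e_1)$) and without loops. A graph is indecomposable if (1) $V(G)\ne\emptyset$; (2) $IO(G)=\emptyset$; (3) $L(G)=\emptyset$ or $G$ is a single loop; (4) $G=G'\circ G''$ implies $V(G')=\emptyset$ or $V(G'')=\emptyset$; (5) $G=\sigma\cdot(G'*G'')\cdot\tau$ implies $V(G')=\emptyset$ or $V(G'')=\emptyset$; a decorated (planar) graph is indecomposable if its underlying graph is. $\mathbf{Gr}_{\mathrm{ind}}(X)$, $\mathbf{Gr}^{\uparrow}_{\mathrm{ind}}(X)$, $\mathbf{PGr}_{\mathrm{ind}}(X)$, $\mathbf{PGr}^{\uparrow}_{\mathrm{ind}}(X)$ are the spans of the indecomposable elements, which are $\mathfrak S\times\mathfrak S^{op}$-modules (families of $\mathfrak S_l\times\mathfrak S_k^{op}$-modules). ProP. A ProP is a family $P=(P(k,l))$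 of vector spaces with commuting left $\mathfrak S_l$- and right $\mathfrak S_k$-actions, an associative horizontal concatenation $*:P(k,l)\otimes P(k',l')\to P(k+k',l+l')$ with unit $I_0$, an associative vertical concatenation $\circ:P(l,m)\otimes P(k,l)\to P(k,m)$ with unit $I_1$ ($p\circ I_k=I_l\circ p=p$, $I_n=I_1^{*n}$), such that $(p*p')\circ(q*q')=(p\circ q)*(p'\circ q')$, $\sigma\cdot(p\circ q)=(\sigma\cdot p)\circ q$, $(p\circ q)\cdot\nu=p\circ(q\cdot\nu)$, $(p\cdot\tau)\circ q=p\circ(\tau\cdot q)$, $(\sigma\cdot p)*(\sigma'\cdot p')=(\sigma\otimes\sigma')\cdot(p*p')$, $(p\cdot\tau)*(p'\cdot\tau')=(p*p')\cdot(\tau\otimes\tau')$, $c_{l,l'}\cdot(p*p')=(p'*p)\cdot c_{k,k'}$ for $p\in P(k,l)$, $p'\in P(k',l')$; here $\alpha\otimes\beta$ is $\alpha$ on $[m]$ and $i\mapsto\beta(i-m)+m$ for $i>m$, $c_{m,n}(i)=i+n$ for $i\le m$, $i-m$ for $i>m$. ProP morphisms are compatible with actions, concatenations and units. ''Free ProP $Q$ generated by a submodule $M$'': every module morphism from $M$ to a ProP extends uniquely to a ProP morphism from $Q$.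
   Formalization: In the definition of indecomposable graph, condition (1) ''V(G) is non-empty'' is read as ''V(G) is non-empty or G is a single loop''; otherwise the single loop would not be generated by the indecomposable graphs and uniqueness of Φ on Gr(X) and PGr(X) would fail. *)

(* Defs.v *)
From HB Require Import structures.
From mathcomp Require Import all_boot all_order all_fingroup all_algebra.
From mathcomp Require Import generic_quotient finmap boolp.
From mathcomp.multinomials Require Import monalg.

Set Implicit Arguments.
Unset Strict Implicit.
Unset Printing Implicit Defensive.

Import GRing.Theory.
Local Open Scope ring_scope.

Definition span (K : fieldType) (V : lmodType K) (A : V -> Prop) : {pred V} :=
  fun x => `[< exists n (a : 'I_n -> K) (v : 'I_n -> V),
               (forall i, A (v i)) /\ x = \sum_i a i *: v i >].

Section Span.
Variables (K : fieldType) (V : lmodType K) (A : V -> Prop).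

Lemma span_gen x : A x -> x \in span A.
Proof.
move=> Ax; apply/asboolP; exists 1%N, (fun=> 1), (fun=> x); split=> //.
by rewrite big_ord1 scale1r.
Qed.

Lemma span_ind (Q : V -> Prop) :
    Q 0 -> (forall x y, Q x -> Q y -> Q (x + y)) ->
    (forall a x, A x -> Q (a *: x)) -> forall x, x \in span A -> Q x.
Proof.
move=> Q0 QD QZ x /asboolP[n [a [v [Av ->]]]].
by elim/big_ind: _ => // i _; apply: QZ.
Qed.

Fact span_submod_closed : submod_closed (span A).
Proof.
split; first by apply/asboolP; exists 0%N, (fun=> 0), (fun=> 0); split=> [[]|] //;
  rewrite big_ord0.
move=> c x y /asboolP[n [a [v [Av ->]]]] /asboolP[m [b [w [Aw ->]]]].
apply/asboolP; exists (n + m)%N.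
exists (fun i => match split i with inl j => c * a j | inr j => b j end).
exists (fun i => match split i with inl j => v j | inr j => w j end).
split=> [i|]; first by case: (split i).
rewrite big_split_ord scaler_sumr; congr (_ + _); apply: eq_bigr => i _.
  by rewrite (unsplitK (inl i)) scalerA.
by rewrite (unsplitK (inr i)).
Qed.

HB.instance Definition _ :=
  GRing.isSubmodClosed.Build K V (span A) span_submod_closed.

Definition spanned := {x : V | x \in span A}.
HB.instance Definition _ := SubChoice.on spanned.
HB.instance Definition _ := [SubChoice_isSubLmodule of spanned by <:].

Definition Spanned x (Ax : x \in span A) : spanned := exist _ x Ax.

End Span.

Definition lext (K : fieldType) (T : choiceType) (W : lmodType K) (f : T -> W)
    (x : {malg K[T]}) : W :=
  \sum_(c <- msupp x) x@_c *: f c.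

Definition lext2 (K : fieldType) (S T : choiceType) (W : lmodType K)
    (f : S -> T -> W) (x : {malg K[S]}) (y : {malg K[T]}) : W :=
  lext (fun c => lext (f c) y) x.

Section LinearExtension.
Variables (K : fieldType) (S T : choiceType) (W : lmodType K).

Lemma lextEw (f : T -> W) (d : {fset T}) x : (msupp x `<=` d)%fset ->
  lext f x = \sum_(c <- d) x@_c *: f c.
Proof.
move=> sxd; rewrite /lext (big_fset_incl _ sxd) // => c _.
by move/mcoeff_outdom->; rewrite scale0r.
Qed.

Lemma lext_is_linear (f : T -> W) : linear (lext f).
Proof.
move=> a x y; pose d := (msupp (a *: x + y) `|` (msupp x `|` msupp y))%fset.
rewrite !(@lextEw _ d); first last.
- by apply/fsubsetP=> c; rewrite !inE => ->.
- by apply/fsubsetP=> c; rewrite !inE => ->; rewrite ?orbT.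
- by apply/fsubsetP=> c; rewrite !inE => ->; rewrite ?orbT.
rewrite scaler_sumr -big_split; apply: eq_bigr => c _ /=.
by rewrite mcoeffD mcoeffZ scalerDl scalerA.
Qed.

HB.instance Definition _ (f : T -> W) :=
  GRing.isLinear.Build K {malg K[T]} W _ (lext f) (lext_is_linear f).

Lemma lextU (f : T -> W) c : lext f << c >> = f c.
Proof. by rewrite /lext msuppU oner_eq0 big_seq_fset1 mcoeffUU scale1r. Qed.
End LinearExtension.

Section BilinearExtension.
Variables (K : fieldType) (S T : choiceType) (W : lmodType K).

Lemma lext2U (f : S -> T -> W) c e : lext2 f << c >> << e >> = f c e.
Proof. by rewrite /lext2 !lextU. Qed.

Lemma lext2_linl (f : S -> T -> W) y : linear (fun x => lext2 f x y).
Proof. by move=> a x x'; rewrite /lext2 linearP. Qed.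

Lemma lext2_linr (f : S -> T -> W) x : linear (lext2 f x).
Proof.
move=> a y y'; rewrite /lext2 /lext scaler_sumr -big_split; apply: eq_bigr => c _ /=.
by rewrite [X in _ *: X]lext_is_linear scalerDr !scalerA mulrC.
Qed.
End BilinearExtension.

(* The composite s o t: in MathComp, (t * s)%g maps i to s (t i). *)
Definition permc n (s t : 'S_n) : 'S_n := (t * s)%g.

Definition sum_map A A' B B' (f : A -> A') (g : B -> B') (x : A + B) : A' + B' :=
  match x with inl a => inl (f a) | inr b => inr (g b) end.

Section BlockPermutations.
Variables m n : nat.

Definition tens_fun (s : 'S_m) (t : 'S_n) (i : 'I_(m + n)) : 'I_(m + n) :=
  unsplit (sum_map s t (split i)).

Fact tens_fun_inj s t : injective (tens_fun s t).
Proof.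
move=> i j /(can_inj unsplitK) e; apply: (can_inj (@splitK m n)); move: e.
by case: (split i) (split j) => a [] b //= [/perm_inj->].
Qed.

Definition perm_tens (s : 'S_m) (t : 'S_n) : 'S_(m + n) :=
  perm (@tens_fun_inj s t).

Definition swap_fun (i : 'I_(m + n)) : 'I_(m + n) :=
  cast_ord (addnC n m)
    match split i with inl a => rshift n a | inr b => lshift m b end.

Fact swap_fun_inj : injective swap_fun.
Proof.
move=> i j /cast_ord_inj e; apply: (can_inj (@splitK m n)); move: e.
case: (split i) (split j) => a [] b /eqP.
- by rewrite eq_rshift => /eqP->.
- by rewrite eq_rlshift.
- by rewrite eq_lrshift.
- by rewrite eq_lshift => /eqP->.
Qed.

Definition perm_swap : 'S_(m + n) := perm swap_fun_inj.
End BlockPermutations.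

(* Operations only; the axioms of an S x S^op-module are [is_smod] and those *)
(* of a ProP are [is_prop]. Bilinear maps replace maps on tensor products.   *)
Record smod (K : fieldType) := SMod {
  smod_car :> nat -> nat -> lmodType K;
  lact : forall k l, 'S_l -> smod_car k l -> smod_car k l;
  ract : forall k l, smod_car k l -> 'S_k -> smod_car k l }.

Record is_smod (K : fieldType) (M : smod K) : Prop := IsSMod {
  lact_linear : forall k l (s : 'S_l), linear (@lact K M k l s);
  ract_linear : forall k l (t : 'S_k),
    linear (fun x : M k l => ract x t);
  lact1 : forall k l (x : M k l), lact 1%g x = x;
  ract1 : forall k l (x : M k l), ract x 1%g = x;
  lactM : forall k l (s s' : 'S_l) (x : M k l),
    lact (permc s s') x = lact s (lact s' x);
  ractM : forall k l (t t' : 'S_k) (x : M k l),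
    ract x (permc t t') = ract (ract x t) t';
  lract : forall k l (s : 'S_l) (t : 'S_k) (x : M k l),
    lact s (ract x t) = ract (lact s x) t }.

(* Transport along equalities such as (k + k') + k'' = k + (k' + k''), which *)
(* hold only propositionally.                                                *)
Definition smod_cast (K : fieldType) (M : smod K) k l k' l'
    (ek : k = k') (el : l = l') (x : M k l) : M k' l' :=
  ecast i (M i l') ek (ecast j (M k j) el x).

Record smod_morph (K : fieldType) (M N : smod K)
    (f : forall k l, M k l -> N k l) : Prop := SModMorph {
  smod_morph_linear : forall k l, linear (f k l);
  smod_morphL : forall k l (s : 'S_l) (x : M k l),
    f k l (lact s x) = lact s (f k l x);
  smod_morphR : forall k l (t : 'S_k) (x : M k l),
    f k l (ract x t) = ract (f k l x) t }.

Definition smod_iso (K : fieldType) (M N : smod K) : Prop :=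
  exists f : forall k l, M k l -> N k l,
    smod_morph f /\ forall k l, bijective (f k l).

Record prop_data (K : fieldType) := PropData {
  prop_smod :> smod K;
  hcat : forall k l k' l', prop_smod k l -> prop_smod k' l' ->
    prop_smod (k + k')%N (l + l')%N;
  vcat : forall k l m, prop_smod l m -> prop_smod k l -> prop_smod k m;
  unit0 : prop_smod 0%N 0%N;
  unit1 : prop_smod 1%N 1%N }.

Fixpoint unitn (K : fieldType) (P : prop_data K) (n : nat) : P n n :=
  if n is n'.+1 then hcat (unit1 P) (unitn P n') else unit0 P.

Record is_prop (K : fieldType) (P : prop_data K) : Prop := IsProp {
  prop_is_smod : is_smod P;
  hcat_linearl : forall k l k' l' (q : P k' l'),
    linear (fun p : P k l => hcat p q);
  hcat_linearr : forall k l k' l' (p : P k l),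
    linear (fun q : P k' l' => hcat p q);
  vcat_linearl : forall k l m (q : P k l),
    linear (fun p : P l m => vcat p q);
  vcat_linearr : forall k l m (p : P l m),
    linear (fun q : P k l => vcat p q);
  hcatA : forall k l k' l' k'' l'' (p : P k l) (q : P k' l') (r : P k'' l''),
    smod_cast (addnA k k' k'') (addnA l l' l'') (hcat p (hcat q r)) =
    hcat (hcat p q) r;
  hcat0p : forall k l (p : P k l), hcat (unit0 P) p = p;
  hcatp0 : forall k l (p : P k l),
    smod_cast (addn0 k) (addn0 l) (hcat p (unit0 P)) = p;
  vcatA : forall k l m n (p : P m n) (q : P l m) (r : P k l),
    vcat p (vcat q r) = vcat (vcat p q) r;
  vcat1p : forall k l (p : P k l), vcat (unitn P l) p = p;
  vcatp1 : forall k l (p : P k l), vcat p (unitn P k) = p;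
  hvcat : forall k l m k' l' m'
      (p : P l m) (p' : P l' m') (q : P k l) (q' : P k' l'),
    vcat (hcat p p') (hcat q q') = hcat (vcat p q) (vcat p' q');
  lact_vcat : forall k l m (s : 'S_m) (p : P l m) (q : P k l),
    lact s (vcat p q) = vcat (lact s p) q;
  ract_vcat : forall k l m (t : 'S_k) (p : P l m) (q : P k l),
    ract (vcat p q) t = vcat p (ract q t);
  vcat_act : forall k l m (t : 'S_l) (p : P l m) (q : P k l),
    vcat (ract p t) q = vcat p (lact t q);
  hcat_lact : forall k l k' l' (s : 'S_l) (s' : 'S_l')
      (p : P k l) (p' : P k' l'),
    hcat (lact s p) (lact s' p') = lact (perm_tens s s') (hcat p p');
  hcat_ract : forall k l k' l' (t : 'S_k) (t' : 'S_k')
      (p : P k l) (p' : P k' l'),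
    hcat (ract p t) (ract p' t') = ract (hcat p p') (perm_tens t t');
  hcatC : forall k l k' l' (p : P k l) (p' : P k' l'),
    lact (perm_swap l l') (hcat p p') =
    ract (smod_cast (addnC k' k) (addnC l' l) (hcat p' p)) (perm_swap k k') }.

Record prop_morph (K : fieldType) (P Q : prop_data K)
    (F : forall k l, P k l -> Q k l) : Prop := PropMorph {
  prop_morph_smod : smod_morph F;
  prop_morph_hcat : forall k l k' l' (p : P k l) (p' : P k' l'),
    F _ _ (hcat p p') = hcat (F _ _ p) (F _ _ p');
  prop_morph_vcat : forall k l m (p : P l m) (q : P k l),
    F _ _ (vcat p q) = vcat (F _ _ p) (F _ _ q);
  prop_morph0 : F _ _ (unit0 P) = unit0 Q;
  prop_morph1 : F _ _ (unit1 P) = unit1 Q }.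

Definition free_prop (K : fieldType) (Q : prop_data K) (M : smod K)
    (i : forall k l, M k l -> Q k l) : Prop :=
  is_prop Q /\
  forall P : prop_data K, is_prop P ->
  forall phi : (forall k l, M k l -> P k l), smod_morph phi ->
  exists! Phi : (forall k l, Q k l -> P k l),
    prop_morph Phi /\ forall k l (x : M k l), Phi k l (i k l x) = phi k l x.

Record act_stable (K : fieldType) (M : smod K)
    (A : forall k l, M k l -> Prop) : Prop := ActStable {
  stable_lact : forall k l (s : 'S_l) (x : M k l),
    x \in span (A k l) -> lact s x \in span (A k l);
  stable_ract : forall k l (t : 'S_k) (x : M k l),
    x \in span (A k l) -> ract x t \in span (A k l) }.

Record prop_stable (K : fieldType) (P : prop_data K)
    (A : forall k l, P k l -> Prop) : Prop := PropStable {
  stable_act : act_stable A;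
  stable_hcat : forall k l k' l' (p : P k l) (p' : P k' l'),
    p \in span (A k l) -> p' \in span (A k' l') ->
    hcat p p' \in span (A (k + k')%N (l + l')%N);
  stable_vcat : forall k l m (p : P l m) (q : P k l),
    p \in span (A l m) -> q \in span (A k l) -> vcat p q \in span (A k m);
  stable_unit0 : unit0 P \in span (A 0%N 0%N);
  stable_unit1 : unit1 P \in span (A 1%N 1%N) }.

Definition sub_smod (K : fieldType) (M : smod K)
    (A : forall k l, M k l -> Prop) (stA : act_stable A) : smod K :=
  @SMod K (fun k l => spanned (A k l))
    (fun k l s x => Spanned (stable_lact stA s (valP x)))
    (fun k l x t => Spanned (stable_ract stA t (valP x))).

Definition sub_prop (K : fieldType) (P : prop_data K)
    (A : forall k l, P k l -> Prop) (stA : prop_stable A) : prop_data K :=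
  @PropData K (sub_smod (stable_act stA))
    (fun k l k' l' x y => Spanned (stable_hcat stA (valP x) (valP y)))
    (fun k l m x y => Spanned (stable_vcat stA (valP x) (valP y)))
    (Spanned (stable_unit0 stA)) (Spanned (stable_unit1 stA)).

Definition sub_incl (K : fieldType) (M : smod K)
    (A : forall k l, M k l -> Prop) (stA : act_stable A)
    k l (x : sub_smod stA k l) : M k l := val x.

Definition trivial_smod (K : fieldType) (X : nat -> nat -> Type) : smod K :=
  @SMod K (fun k l => {malg K[{classic X k l}]}) (fun k l s x => x)
    (fun k l x t => x).

(* K[S_l] (x) K X_(k,l) (x) K[S_k] with left and right multiplication. *)
Definition free_smod (K : fieldType) (X : nat -> nat -> Type) : smod K :=
  @SMod K (fun k l => {malg K[{classic 'S_l * X k l * 'S_k}]})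
    (fun k l s => lext (fun c : {classic 'S_l * X k l * 'S_k} =>
       << ((permc s c.1.1, c.1.2, c.2) : {classic 'S_l * X k l * 'S_k}) >>))
    (fun k l x t => lext (fun c : {classic 'S_l * X k l * 'S_k} =>
       << ((c.1, permc c.2 t) : {classic 'S_l * X k l * 'S_k}) >>) x).

(* V(G), E(G), I(G), O(G), IO(G) and L(G). *)
Record shape := Shape {
  sV : finType; sE : finType; sI : finType; sO : finType; sIO : finType;
  sL : finType }.

(* Graphs with i(G) = k and o(G) = l: bijectivity of [alpha] and [beta] onto  *)
(* 'I_k and 'I_l forces k = |I(G)| + |IO(G)| and l = |O(G)| + |IO(G)|.        *)
(* Indices start at 0.                                                        *)
Record graph_on (S : shape) (k l : nat) := GraphOn {
  src : sE S + sO S -> sV S;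
  tgt : sE S + sI S -> sV S;
  alpha : sI S + sIO S -> 'I_k;
  beta : sO S + sIO S -> 'I_l;
  alpha_bij : bijective alpha;
  beta_bij : bijective beta }.

Record graph (k l : nat) := Graph {
  graph_shape :> shape;
  graph_str :> graph_on graph_shape k l }.

Definition indeg S k l (G : graph_on S k l) (v : sV S) : nat :=
  #|[pred e | tgt G e == v]|.
Definition outdeg S k l (G : graph_on S k l) (v : sV S) : nat :=
  #|[pred e | src G e == v]|.

(* Indices are compared as natural numbers, so that graphs whose arities are  *)
(* not convertible can be compared.                                           *)
Record giso k l k' l' (G : graph k l) (H : graph k' l') := GIso {
  isoV : sV G -> sV H;
  isoE : sE G -> sE H;
  isoI : sI G -> sI H;
  isoO : sO G -> sO H;
  isoIO : sIO G -> sIO H;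
  isoL : sL G -> sL H;
  isoV_bij : bijective isoV;
  isoE_bij : bijective isoE;
  isoI_bij : bijective isoI;
  isoO_bij : bijective isoO;
  isoIO_bij : bijective isoIO;
  isoL_bij : bijective isoL;
  iso_src : forall e, isoV (src G e) = src H (sum_map isoE isoO e);
  iso_tgt : forall e, isoV (tgt G e) = tgt H (sum_map isoE isoI e);
  iso_alpha : forall e, alpha G e = alpha H (sum_map isoI isoIO e) :> nat;
  iso_beta : forall e, beta G e = beta H (sum_map isoO isoIO e) :> nat }.

Definition gequiv k l k' l' (G : graph k l) (H : graph k' l') : Prop :=
  inhabited (giso G H).

Lemma surj_inj_bij A B (f : A -> B) :
  injective f -> (forall y, exists x, f x = y) -> bijective f.
Proof.
move=> f_inj f_surj; pose g y := sval (cid (f_surj y)).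
have fK : cancel g f by move=> y; rewrite /g; case: cid.
by exists g => // x; apply: f_inj; rewrite fK.
Qed.

Lemma bij_surj A B (f : A -> B) y : bijective f -> exists x, f x = y.
Proof. by case=> g _ gK; exists (g y). Qed.

Lemma sum_map_bij A A' B B' (f : A -> A') (g : B -> B') :
  bijective f -> bijective g -> bijective (sum_map f g).
Proof.
case=> f' fK f'K [g' gK g'K].
by exists (sum_map f' g') => -[] x /=; rewrite ?fK ?f'K ?gK ?g'K.
Qed.

Lemma sum_map_comp A B C A' B' C' (f : A -> B) (g : B -> C)
    (f' : A' -> B') (g' : B' -> C') x :
  sum_map g g' (sum_map f f' x) = sum_map (g \o f) (g' \o f') x.
Proof. by case: x. Qed.

Lemma sum_map_id A B (x : A + B) : sum_map id id x = x.
Proof. by case: x. Qed.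

Lemma card_bij (A B : finType) (f : A -> B) (P : pred A) (Q : pred B) :
  bijective f -> (forall x, P x = Q (f x)) -> #|P| = #|Q|.
Proof.
move=> f_bij PQ; rewrite -(card_image (bij_inj f_bij)).
apply: eq_card => y; have [x <-] := bij_surj y f_bij.
by rewrite mem_image; [rewrite !unfold_in PQ | apply: bij_inj].
Qed.

Lemma card_inl (A B : finType) (P : pred (A + B)) (Q : pred A) :
    (forall a, P (inl a) = Q a) -> (forall b, P (inr b) = false) ->
  #|P| = #|Q|.
Proof.
have inl_inj : injective (@inl A B) by move=> ? ? [].
move=> PQ P0; rewrite -(card_image inl_inj); apply: eq_card => -[a|b].
  by rewrite mem_image // !unfold_in PQ.
by rewrite unfold_in P0; apply/esym/negbTE/imageP => -[].
Qed.

Lemma card_inr (A B : finType) (P : pred (A + B)) (Q : pred B) :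
    (forall a, P (inl a) = false) -> (forall b, P (inr b) = Q b) ->
  #|P| = #|Q|.
Proof.
have inr_inj : injective (@inr A B) by move=> ? ? [].
move=> P0 PQ; rewrite -(card_image inr_inj); apply: eq_card => -[a|b].
  by rewrite unfold_in P0; apply/esym/negbTE/imageP => -[].
by rewrite mem_image // !unfold_in PQ.
Qed.

Fact id_bij T : bijective (@id T).
Proof. by exists id. Qed.

Definition giso_refl k l (G : graph k l) : giso G G :=
  @GIso _ _ _ _ G G id id id id id id
    (@id_bij _) (@id_bij _) (@id_bij _) (@id_bij _) (@id_bij _) (@id_bij _)
    (fun e => congr1 (src G) (esym (sum_map_id e)))
    (fun e => congr1 (tgt G) (esym (sum_map_id e)))
    (fun e => congr1 (@nat_of_ord k \o alpha G) (esym (sum_map_id e)))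
    (fun e => congr1 (@nat_of_ord l \o beta G) (esym (sum_map_id e))).

Section GIsoTrans.
Variables (k l k' l' k'' l'' : nat).
Variables (G : graph k l) (H : graph k' l') (J : graph k'' l'').
Variables (f : giso G H) (g : giso H J).

Fact giso_trans_src e : (isoV g \o isoV f) (src G e) =
  src J (sum_map (isoE g \o isoE f) (isoO g \o isoO f) e).
Proof. by rewrite -sum_map_comp -!iso_src. Qed.

Fact giso_trans_tgt e : (isoV g \o isoV f) (tgt G e) =
  tgt J (sum_map (isoE g \o isoE f) (isoI g \o isoI f) e).
Proof. by rewrite -sum_map_comp -!iso_tgt. Qed.

Fact giso_trans_alpha e :
  alpha G e = alpha J (sum_map (isoI g \o isoI f) (isoIO g \o isoIO f) e) :> nat.
Proof. by rewrite -sum_map_comp -!iso_alpha. Qed.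

Fact giso_trans_beta e :
  beta G e = beta J (sum_map (isoO g \o isoO f) (isoIO g \o isoIO f) e) :> nat.
Proof. by rewrite -sum_map_comp -!iso_beta. Qed.

Definition giso_trans : giso G J :=
  GIso (bij_comp (isoV_bij g) (isoV_bij f)) (bij_comp (isoE_bij g) (isoE_bij f))
    (bij_comp (isoI_bij g) (isoI_bij f)) (bij_comp (isoO_bij g) (isoO_bij f))
    (bij_comp (isoIO_bij g) (isoIO_bij f)) (bij_comp (isoL_bij g) (isoL_bij f))
    giso_trans_src giso_trans_tgt giso_trans_alpha giso_trans_beta.

Lemma giso_transI e : sum_map (isoE giso_trans) (isoI giso_trans) e =
  sum_map (isoE g) (isoI g) (sum_map (isoE f) (isoI f) e).
Proof. by case: e. Qed.

Lemma giso_transO e : sum_map (isoE giso_trans) (isoO giso_trans) e =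
  sum_map (isoE g) (isoO g) (sum_map (isoE f) (isoO f) e).
Proof. by case: e. Qed.
End GIsoTrans.

Section Inverse.
Variables (A B : Type) (f : A -> B) (f_bij : bijective f).

Fact inverse_subproof : exists g, cancel f g /\ cancel g f.
Proof. by case: f_bij => g *; exists g. Qed.

Definition inverse : B -> A := sval (cid inverse_subproof).

Lemma inverseK : cancel f inverse.
Proof. by rewrite /inverse; case: cid => g []. Qed.

Lemma Kinverse : cancel inverse f.
Proof. by rewrite /inverse; case: cid => g []. Qed.

Fact inverse_bij : bijective inverse.
Proof. by exists f; [apply: Kinverse | apply: inverseK]. Qed.
End Inverse.

Lemma sum_map_inverse A A' B B' (f : A -> A') (g : B -> B')
    (f_bij : bijective f) (g_bij : bijective g) :
  cancel (sum_map (inverse f_bij) (inverse g_bij)) (sum_map f g).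
Proof. by case=> x /=; rewrite Kinverse. Qed.

Section GIsoSym.
Variables (k l k' l' : nat) (G : graph k l) (H : graph k' l') (f : giso G H).

Fact giso_sym_src e : inverse (isoV_bij f) (src H e) =
  src G (sum_map (inverse (isoE_bij f)) (inverse (isoO_bij f)) e).
Proof. by rewrite -[RHS](inverseK (isoV_bij f)) iso_src sum_map_inverse. Qed.

Fact giso_sym_tgt e : inverse (isoV_bij f) (tgt H e) =
  tgt G (sum_map (inverse (isoE_bij f)) (inverse (isoI_bij f)) e).
Proof. by rewrite -[RHS](inverseK (isoV_bij f)) iso_tgt sum_map_inverse. Qed.

Fact giso_sym_alpha e : alpha H e =
  alpha G (sum_map (inverse (isoI_bij f)) (inverse (isoIO_bij f)) e) :> nat.
Proof. by rewrite (iso_alpha f) sum_map_inverse. Qed.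

Fact giso_sym_beta e : beta H e =
  beta G (sum_map (inverse (isoO_bij f)) (inverse (isoIO_bij f)) e) :> nat.
Proof. by rewrite (iso_beta f) sum_map_inverse. Qed.

Definition giso_sym : giso H G :=
  GIso (inverse_bij (isoV_bij f)) (inverse_bij (isoE_bij f))
    (inverse_bij (isoI_bij f)) (inverse_bij (isoO_bij f))
    (inverse_bij (isoIO_bij f)) (inverse_bij (isoL_bij f))
    giso_sym_src giso_sym_tgt giso_sym_alpha giso_sym_beta.
End GIsoSym.

Lemma gequiv_refl k l (G : graph k l) : gequiv G G.
Proof. by split; apply: giso_refl. Qed.

Lemma gequiv_sym k l k' l' (G : graph k l) (H : graph k' l') :
  gequiv G H -> gequiv H G.
Proof. by case=> f; split; apply: giso_sym. Qed.

Lemma gequiv_trans k l k' l' k'' l'' (G : graph k l) (H : graph k' l')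
  (J : graph k'' l'') : gequiv G H -> gequiv H J -> gequiv G J.
Proof. by case=> f [g]; split; apply: giso_trans f g. Qed.

Lemma indeg_iso k l k' l' (G : graph k l) (H : graph k' l') (f : giso G H) v :
  indeg G v = indeg H (isoV f v).
Proof.
apply: card_bij (sum_map_bij (isoE_bij f) (isoI_bij f)) _ => e /=.
by rewrite -iso_tgt (bij_eq (isoV_bij f)).
Qed.

Lemma outdeg_iso k l k' l' (G : graph k l) (H : graph k' l') (f : giso G H) v :
  outdeg G v = outdeg H (isoV f v).
Proof.
apply: card_bij (sum_map_bij (isoE_bij f) (isoO_bij f)) _ => e /=.
by rewrite -iso_src (bij_eq (isoV_bij f)).
Qed.

Section Actions.
Variables (k l : nat) (G : graph k l).

Fact glact_bij (s : 'S_l) : bijective (s \o beta G).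
Proof.
by apply: bij_comp (beta_bij G); exists s^-1%g; [apply: permK|apply: permKV].
Qed.

Definition glact (s : 'S_l) : graph k l :=
  Graph (GraphOn (src G) (tgt G) (alpha_bij G) (glact_bij s)).

Fact gract_bij (t : 'S_k) : bijective (t^-1%g \o alpha G).
Proof. by apply: bij_comp (alpha_bij G); exists t; [apply: permKV|apply: permK]. Qed.

Definition gract (t : 'S_k) : graph k l :=
  Graph (GraphOn (src G) (tgt G) (gract_bij t) (beta_bij G)).
End Actions.

Definition sum_swap A B C D (x : (A + B) + (C + D)) : (A + C) + (B + D) :=
  match x with
  | inl (inl a) => inl (inl a)
  | inl (inr b) => inr (inl b)
  | inr (inl c) => inl (inr c)
  | inr (inr d) => inr (inr d)
  end.

Lemma sum_swap_bij A B C D : bijective (@sum_swap A B C D).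
Proof. by exists (@sum_swap A C B D) => -[[]|[]]. Qed.

Section HorizontalConcatenation.
Variables (k l k' l' : nat) (G : graph k l) (G' : graph k' l').

Definition hshape : shape :=
  Shape (sV G + sV G')%type (sE G + sE G')%type (sI G + sI G')%type
    (sO G + sO G')%type (sIO G + sIO G')%type (sL G + sL G')%type.

Fact ghcat_alpha_bij :
  bijective (fun e : (sI G + sI G') + (sIO G + sIO G') =>
    unsplit (sum_map (alpha G) (alpha G') (sum_swap e))).
Proof.
have splitB m n : bijective (@unsplit m n).
  by exists (@split m n); [apply: unsplitK|apply: splitK].
apply: bij_comp (splitB _ _) _; apply: bij_comp (sum_swap_bij _ _ _ _).
exact: sum_map_bij (alpha_bij G) (alpha_bij G').
Qed.

Fact ghcat_beta_bij :
  bijective (fun e : (sO G + sO G') + (sIO G + sIO G') =>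
    unsplit (sum_map (beta G) (beta G') (sum_swap e))).
Proof.
have splitB m n : bijective (@unsplit m n).
  by exists (@split m n); [apply: unsplitK|apply: splitK].
apply: bij_comp (splitB _ _) _; apply: bij_comp (sum_swap_bij _ _ _ _).
exact: sum_map_bij (beta_bij G) (beta_bij G').
Qed.

Definition ghcat : graph (k + k') (l + l') :=
  Graph (@GraphOn hshape _ _
    (fun e => sum_map (src G) (src G') (sum_swap e))
    (fun e => sum_map (tgt G) (tgt G') (sum_swap e))
    _ _ ghcat_alpha_bij ghcat_beta_bij).
End HorizontalConcatenation.

Definition glue (A B : finType) n (b : A -> 'I_n) (a : B -> 'I_n) : finType :=
  {p : A * B | b p.1 == a p.2}.

Lemma glue1_inj (A B : finType) n (b : A -> 'I_n) (a : B -> 'I_n)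
    (p q : glue b a) :
  injective a -> (val p).1 = (val q).1 -> p = q.
Proof.
move=> a_inj pq; apply: val_inj; case: p q pq => -[x y] /= xy [[z t] /= zt] xz.
by subst z; congr (_, _); apply: a_inj; rewrite -(eqP xy) -(eqP zt).
Qed.

Lemma glue2_inj (A B : finType) n (b : A -> 'I_n) (a : B -> 'I_n)
    (p q : glue b a) :
  injective b -> (val p).2 = (val q).2 -> p = q.
Proof.
move=> b_inj pq; apply: val_inj; case: p q pq => -[x y] /= xy [[z t] /= zt] yt.
by subst t; congr (_, _); apply: b_inj; rewrite (eqP xy) (eqP zt).
Qed.

(* [gvcat G' G] is G' o G. The pairs of glued edges of kind (O, I) are its    *)
(* new internal edges; those of kind (IO, I), (O, IO) and (IO, IO) are        *)
(* respectively input, output and input-output edges.                         *)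
Section VerticalConcatenation.
Variables (k l m : nat) (G' : graph l m) (G : graph k l).

Definition glueOI :=
  glue (fun o => beta G (inl o)) (fun i => alpha G' (inl i)).
Definition glueNI :=
  glue (fun n => beta G (inr n)) (fun i => alpha G' (inl i)).
Definition glueON :=
  glue (fun o => beta G (inl o)) (fun n => alpha G' (inr n)).
Definition glueNN :=
  glue (fun n => beta G (inr n)) (fun n => alpha G' (inr n)).

Definition vshape : shape :=
  Shape (sV G + sV G')%type ((sE G + sE G') + glueOI)%type
    (sI G + glueNI)%type (sO G' + glueON)%type glueNN (sL G + sL G')%type.

(* The edge of G or of G' that provides the source (resp. the target) of an   *)
(* edge of G' o G.                                                            *)
Definition vcat_out (e : ((sE G + sE G') + glueOI) + (sO G' + glueON)) :
    (sE G + sO G) + (sE G' + sO G') :=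
  match e with
  | inl (inl (inl e)) => inl (inl e)
  | inl (inl (inr e')) => inr (inl e')
  | inl (inr p) => inl (inr (val p).1)
  | inr (inl o') => inr (inr o')
  | inr (inr p) => inl (inr (val p).1)
  end.

Definition vcat_in (e : ((sE G + sE G') + glueOI) + (sI G + glueNI)) :
    (sE G + sI G) + (sE G' + sI G') :=
  match e with
  | inl (inl (inl e)) => inl (inl e)
  | inl (inl (inr e')) => inr (inl e')
  | inl (inr p) => inr (inr (val p).2)
  | inr (inl i) => inl (inr i)
  | inr (inr p) => inr (inr (val p).2)
  end.

Definition vcat_alpha (e : (sI G + glueNI) + glueNN) : 'I_k :=
  match e with
  | inl (inl i) => alpha G (inl i)
  | inl (inr p) => alpha G (inr (val p).1)
  | inr p => alpha G (inr (val p).1)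
  end.

Definition vcat_beta (e : (sO G' + glueON) + glueNN) : 'I_m :=
  match e with
  | inl (inl o') => beta G' (inl o')
  | inl (inr p) => beta G' (inr (val p).2)
  | inr p => beta G' (inr (val p).2)
  end.

Let aI := bij_inj (alpha_bij G').
Let bI := bij_inj (beta_bij G).

Let aI1 : injective (fun i => alpha G' (inl i)). Proof. by move=> x y /aI[]. Qed.
Let aI2 : injective (fun i => alpha G' (inr i)). Proof. by move=> x y /aI[]. Qed.
Let bI1 : injective (fun i => beta G (inl i)). Proof. by move=> x y /bI[]. Qed.
Let bI2 : injective (fun i => beta G (inr i)). Proof. by move=> x y /bI[]. Qed.

Lemma vcat_out_bij : bijective vcat_out.
Proof.
apply: surj_inj_bij => [|[[e|o]|[e'|o']]]; last first.
- by exists (inr (inl o')).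
- by exists (inl (inl (inr e'))).
- have [[i'|n'] eq_o] := bij_surj (beta G (inl o)) (alpha_bij G').
    have /eqP-E := esym eq_o.
    by exists (inl (inr (exist _ (o, i') E))).
  have /eqP-E := esym eq_o.
  by exists (inr (inr (exist _ (o, n') E))).
- by exists (inl (inl (inl e))).
move=> [[[e|e]|p]|[o|p]] [[[f|f]|q]|[o'|q]] //=.
all: try by case=> ->.
- by case=> pq; have -> : p = q := glue1_inj aI1 pq.
- case=> pq; case: p q pq => -[x y] /= xy [[z t] /= zt] xz; subst z.
  by have := aI (etrans (esym (eqP xy)) (eqP zt)).
- case=> pq; case: p q pq => -[x y] /= xy [[z t] /= zt] xz; subst z.
  by have := aI (etrans (esym (eqP xy)) (eqP zt)).
- by case=> pq; have -> : p = q := glue1_inj aI2 pq.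
Qed.

Lemma vcat_in_bij : bijective vcat_in.
Proof.
apply: surj_inj_bij => [|[[e|i]|[e'|i']]]; last first.
- have [[o|n] eq_i] := bij_surj (alpha G' (inl i')) (beta_bij G).
    have /eqP-E := eq_i.
    by exists (inl (inr (exist _ (o, i') E))).
  have /eqP-E := eq_i.
  by exists (inr (inr (exist _ (n, i') E))).
- by exists (inl (inl (inr e'))).
- by exists (inr (inl i)).
- by exists (inl (inl (inl e))).
move=> [[[e|e]|p]|[o|p]] [[[f|f]|q]|[o'|q]] //=.
all: try by case=> ->.
- by case=> pq; have -> : p = q := glue2_inj bI1 pq.
- case=> pq; case: p q pq => -[x y] /= xy [[z t] /= zt] yt; subst t.
  by have := bI (etrans (eqP xy) (esym (eqP zt))).
- case=> pq; case: p q pq => -[x y] /= xy [[z t] /= zt] yt; subst t.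
  by have := bI (etrans (eqP xy) (esym (eqP zt))).
- by case=> pq; have -> : p = q := glue2_inj bI2 pq.
Qed.

Fact vcat_alpha_bij : bijective vcat_alpha.
Proof.
have aG := bij_inj (alpha_bij G).
apply: surj_inj_bij => [|r]; last first.
  have [[i|n] <-] := bij_surj r (alpha_bij G); first by exists (inl (inl i)).
  have [[i'|n'] eq_n] := bij_surj (beta G (inr n)) (alpha_bij G').
    have /eqP-E := esym eq_n.
    by exists (inl (inr (exist _ (n, i') E))).
  have /eqP-E := esym eq_n.
  by exists (inr (exist _ (n, n') E)).
move=> [[i|p]|p] [[j|q]|q] /= /aG //.
- by case=> ->.
- by case=> pq; have -> : p = q := glue1_inj aI1 pq.
- case=> pq; case: p q pq => -[x y] /= xy [[z t] /= zt] xz; subst z.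
  by have := aI (etrans (esym (eqP xy)) (eqP zt)).
- case=> pq; case: p q pq => -[x y] /= xy [[z t] /= zt] xz; subst z.
  by have := aI (etrans (esym (eqP xy)) (eqP zt)).
- by case=> pq; have -> : p = q := glue1_inj aI2 pq.
Qed.

Fact vcat_beta_bij : bijective vcat_beta.
Proof.
have bG := bij_inj (beta_bij G').
apply: surj_inj_bij => [|r]; last first.
  have [[o|n] <-] := bij_surj r (beta_bij G'); first by exists (inl (inl o)).
  have [[o'|n'] eq_n] := bij_surj (alpha G' (inr n)) (beta_bij G).
    have /eqP-E := eq_n.
    by exists (inl (inr (exist _ (o', n) E))).
  have /eqP-E := eq_n.
  by exists (inr (exist _ (n', n) E)).
move=> [[i|p]|p] [[j|q]|q] /= /bG //.
- by case=> ->.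
- by case=> pq; have -> : p = q := glue2_inj bI1 pq.
- case=> pq; case: p q pq => -[x y] /= xy [[z t] /= zt] yt; subst t.
  by have := bI (etrans (eqP xy) (esym (eqP zt))).
- case=> pq; case: p q pq => -[x y] /= xy [[z t] /= zt] yt; subst t.
  by have := bI (etrans (eqP xy) (esym (eqP zt))).
- by case=> pq; have -> : p = q := glue2_inj bI2 pq.
Qed.

Definition gvcat : graph k m :=
  Graph (@GraphOn vshape _ _
    (fun e => sum_map (src G) (src G') (vcat_out e))
    (fun e => sum_map (tgt G) (tgt G') (vcat_in e))
    _ _ vcat_alpha_bij vcat_beta_bij).
End VerticalConcatenation.

Fact gunit0_bij : bijective (fun e : void + void => of_void 'I_0
  (match e with inl e | inr e => e end)).
Proof. by apply: surj_inj_bij => [[[]|[]]|[]]. Qed.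

Definition gunit0 : graph 0 0 :=
  Graph (@GraphOn (Shape void void void void void void) _ _
    (fun e => match e with inl e | inr e => e end)
    (fun e => match e with inl e | inr e => e end)
    _ _ gunit0_bij gunit0_bij).

Fact gunit1_bij : bijective (fun e : void + unit => ord0 : 'I_1).
Proof.
apply: surj_inj_bij => [[[]|[]] [[]|[]] //|i].
by exists (inr tt); rewrite [i]ord1.
Qed.

Definition gunit1 : graph 1 1 :=
  Graph (@GraphOn (Shape void void void void unit void) _ _
    (fun e => match e with inl e | inr e => e end)
    (fun e => match e with inl e | inr e => e end)
    _ _ gunit1_bij gunit1_bij).

Definition upward k l (G : graph k l) : Prop :=
  (forall c : seq (sE G), c != [::] ->
     ~~ path.cycle (fun e e' => tgt G (inl e) == src G (inl e')) c)
  /\ (#|sL G| = 0)%N.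

Definition single_loop k l (G : graph k l) : Prop :=
  [/\ #|sV G| = 0%N, #|sE G| = 0%N, #|sI G| = 0%N, #|sO G| = 0%N
    & #|sIO G| = 0%N /\ #|sL G| = 1%N].

(* The single loop counts as indecomposable although it has no vertex: it is  *)
(* a generator of the ProP of graphs that no other indecomposable produces.   *)
Definition indecomposable k l (G : graph k l) : Prop :=
  [/\ #|sV G| <> 0%N \/ single_loop G,
      #|sIO G| = 0%N,
      #|sL G| = 0%N \/ single_loop G,
      forall m (G' : graph m l) (G'' : graph k m),
        gequiv G (gvcat G' G'') -> #|sV G'| = 0%N \/ #|sV G''| = 0%N
    & forall k1 l1 k2 l2 (G' : graph k1 l1) (G'' : graph k2 l2)
        (s : 'S_(l1 + l2)) (t : 'S_(k1 + k2)),
        gequiv G (gract (glact (ghcat G' G'') s) t) ->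
        #|sV G'| = 0%N \/ #|sV G''| = 0%N].

Definition total_order_on (T : finType) (A : {pred T}) (r : rel T) : Prop :=
  [/\ {in A, reflexive r}, {in A &, antisymmetric r},
      {in A & &, transitive r} & {in A &, total r}].

(* Only the restrictions of [leI] to the I(v) and of [leO] to the O(v) are *)
(* meaningful.                                                             *)
Record planar S k l (G : graph_on S k l) := Planar {
  leI : rel (sE S + sI S);
  leO : rel (sE S + sO S);
  leI_order : forall v, total_order_on [pred e | tgt G e == v] leI;
  leO_order : forall v, total_order_on [pred e | src G e == v] leO }.

(* The flag [pl] selects planar graphs; for [pl = false] the last field is    *)
(* vacuous.                                                                   *)
Record dgraph_on (pl : bool) (X : nat -> nat -> Type) (S : shape) (k l : nat) :=
  DGraphOn {
    dgraph_str :> graph_on S k l;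
    dec : sV S -> {kl : nat * nat & X kl.1 kl.2};
    decP : forall v, tag (dec v) = (indeg dgraph_str v, outdeg dgraph_str v);
    planarity : pl -> planar dgraph_str }.

Record dgraph (pl : bool) (X : nat -> nat -> Type) (k l : nat) := DGraph {
  dgraph_shape :> shape;
  dgraph_val :> dgraph_on pl X dgraph_shape k l }.

Definition underlying pl X k l (G : dgraph pl X k l) : graph k l :=
  Graph (dgraph_str G).

Definition planar_iso k l k' l' (G : graph k l) (H : graph k' l')
    (f : giso G H) (p : planar G) (q : planar H) : Prop :=
  (forall e e', tgt G e = tgt G e' ->
     leI p e e' =
     leI q (sum_map (isoE f) (isoI f) e) (sum_map (isoE f) (isoI f) e')) /\
  (forall e e', src G e = src G e' ->
     leO p e e' =
     leO q (sum_map (isoE f) (isoO f) e) (sum_map (isoE f) (isoO f) e')).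

Definition dequiv pl X k l k' l' (G : dgraph pl X k l) (H : dgraph pl X k' l')
    : Prop :=
  exists f : giso (underlying G) (underlying H),
    (forall v, dec H (isoV f v) = dec G v) /\
    (forall h : pl, planar_iso f (planarity G h) (planarity H h)).

Lemma dequiv_gequiv pl X k l k' l' (G : dgraph pl X k l)
    (H : dgraph pl X k' l') :
  dequiv G H -> gequiv (underlying G) (underlying H).
Proof. by case=> f _; split. Qed.

Lemma dequiv_refl pl X k l (G : dgraph pl X k l) : dequiv G G.
Proof.
by exists (giso_refl _); split=> [v|h] //; split=> e e' _; rewrite !sum_map_id.
Qed.

Lemma dequiv_trans pl X k l k' l' k'' l'' (G : dgraph pl X k l)
    (H : dgraph pl X k' l') (J : dgraph pl X k'' l'') :
  dequiv G H -> dequiv H J -> dequiv G J.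
Proof.
case=> f [fdec fpl] [g [gdec gpl]]; exists (giso_trans f g); split=> [v|h].
  by rewrite /= gdec fdec.
have [fI fO] := fpl h; have [gI gO] := gpl h.
split=> e e' ee'.
  rewrite !giso_transI (fI _ _ ee'); apply: gI.
  by rewrite -!(iso_tgt f) ee'.
rewrite !giso_transO (fO _ _ ee'); apply: gO.
by rewrite -!(iso_src f) ee'.
Qed.

Lemma dequiv_sym pl X k l k' l' (G : dgraph pl X k l)
    (H : dgraph pl X k' l') : dequiv G H -> dequiv H G.
Proof.
case=> f [fdec fpl]; exists (giso_sym f); split=> [v|h].
  by rewrite -fdec; congr (dec H _); apply: Kinverse.
have [lI lO] := fpl h; split=> e e' ee'.
  rewrite lI; last by rewrite -!(iso_tgt (giso_sym f)) ee'.
  by congr (leI _ _ _); apply: esym; apply: sum_map_inverse.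
rewrite lO; last by rewrite -!(iso_src (giso_sym f)) ee'.
by congr (leO _ _ _); apply: esym; apply: sum_map_inverse.
Qed.

Definition sum_rel A B (r : rel A) (r' : rel B) : rel (A + B) := fun x y =>
  match x, y with
  | inl a, inl a' => r a a'
  | inr b, inr b' => r' b b'
  | _, _ => false
  end.

Section HalfEdges.
Variables (H H1 H2 V1 V2 : finType) (t1 : H1 -> V1) (t2 : H2 -> V2).
Variable f : H -> H1 + H2.
Hypothesis f_bij : bijective f.

Lemma card_half_edges v :
  #|[pred e | sum_map t1 t2 (f e) == v]| =
  match v with
  | inl v1 => #|[pred e | t1 e == v1]|
  | inr v2 => #|[pred e | t2 e == v2]|
  end.
Proof.
rewrite (@card_bij _ _ f _ [pred e | sum_map t1 t2 e == v] f_bij) //.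
by case: v => v; [apply: card_inl | apply: card_inr].
Qed.

Lemma order_half_edges r1 r2 :
    (forall v, total_order_on [pred e | t1 e == v] r1) ->
    (forall v, total_order_on [pred e | t2 e == v] r2) ->
  forall v, total_order_on [pred e | sum_map t1 t2 (f e) == v]
                           (relpre f (sum_rel r1 r2)).
Proof.
have f_inj := bij_inj f_bij.
move=> o1 o2 [v|v].
  have [r_refl r_asym r_trans r_tot] := o1 v; split.
  - move=> e; rewrite inE /=; case: (f e) => //= a; exact: r_refl.
  - move=> e e'; rewrite !inE /= => he he' hr; apply: f_inj; move: he he' hr.
    by case: (f e) (f e') => a [b|b] //= ha hb hr; rewrite (r_asym a b).
  - move=> y x z; rewrite !inE /=.
    case: (f x) (f y) (f z) => a [b|b] [c|c] //= ha hb hc; exact: r_trans.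
  - move=> x y; rewrite !inE /=.
    case: (f x) (f y) => a [b|b] //= ha hb; exact: r_tot.
have [r_refl r_asym r_trans r_tot] := o2 v; split.
- move=> e; rewrite inE /=; case: (f e) => //= a; exact: r_refl.
- move=> e e'; rewrite !inE /= => he he' hr; apply: f_inj; move: he he' hr.
  by case: (f e) (f e') => a [b|b] //= ha hb hr; rewrite (r_asym a b).
- move=> y x z; rewrite !inE /=.
  case: (f x) (f y) (f z) => a [b|b] [c|c] //= ha hb hc; exact: r_trans.
- move=> x y; rewrite !inE /=.
  case: (f x) (f y) => a [b|b] //= ha hb; exact: r_tot.
Qed.
End HalfEdges.

Section PlanarOperations.

Definition planar_hcat k l k' l' (G : graph k l) (G' : graph k' l')
    (p : planar G) (p' : planar G') : planar (ghcat G G') :=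
  @Planar _ _ _ (ghcat G G')
    (relpre (@sum_swap _ _ _ _) (sum_rel (leI p) (leI p')))
    (relpre (@sum_swap _ _ _ _) (sum_rel (leO p) (leO p')))
    (order_half_edges (sum_swap_bij _ _ _ _) (leI_order p) (leI_order p'))
    (order_half_edges (sum_swap_bij _ _ _ _) (leO_order p) (leO_order p')).

Definition planar_vcat k l m (G' : graph l m) (G : graph k l)
    (p' : planar G') (p : planar G) : planar (gvcat G' G) :=
  @Planar _ _ _ (gvcat G' G)
    (relpre (@vcat_in _ _ _ G' G) (sum_rel (leI p) (leI p')))
    (relpre (@vcat_out _ _ _ G' G) (sum_rel (leO p) (leO p')))
    (order_half_edges (vcat_in_bij G' G) (leI_order p) (leI_order p'))
    (order_half_edges (vcat_out_bij G' G) (leO_order p) (leO_order p')).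

Definition planar_lact k l (G : graph k l) (s : 'S_l) (p : planar G) :
    planar (glact G s) :=
  @Planar _ _ _ (glact G s) (leI p) (leO p) (leI_order p) (leO_order p).

Definition planar_ract k l (G : graph k l) (t : 'S_k) (p : planar G) :
    planar (gract G t) :=
  @Planar _ _ _ (gract G t) (leI p) (leO p) (leI_order p) (leO_order p).

End PlanarOperations.

Definition sum_dec A B C (d : A -> C) (d' : B -> C) (v : A + B) : C :=
  match v with inl a => d a | inr b => d' b end.

Section DecoratedOperations.
Variables (pl : bool) (X : nat -> nat -> Type).

Definition dlact k l (G : dgraph pl X k l) (s : 'S_l) : dgraph pl X k l :=
  DGraph (@DGraphOn pl X _ _ _ (glact (underlying G) s) (dec G) (decP G)
    (fun h => planar_lact s (planarity G h : planar (underlying G)))).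

Definition dract k l (G : dgraph pl X k l) (t : 'S_k) : dgraph pl X k l :=
  DGraph (@DGraphOn pl X _ _ _ (gract (underlying G) t) (dec G) (decP G)
    (fun h => planar_ract t (planarity G h : planar (underlying G)))).

Section Horizontal.
Variables (k l k' l' : nat) (G : dgraph pl X k l) (G' : dgraph pl X k' l').
Let U := ghcat (underlying G) (underlying G').

Fact dhcat_decP (v : sV U) :
  tag (sum_dec (dec G) (dec G') v) = (indeg U v, outdeg U v).
Proof.
rewrite /indeg /outdeg !card_half_edges; try exact: sum_swap_bij.
by case: v => v /=; rewrite decP.
Qed.

Definition dhcat : dgraph pl X (k + k') (l + l') :=
  DGraph (@DGraphOn pl X _ _ _ U _ dhcat_decP (fun h => planar_hcat
    (planarity G h : planar (underlying G))
    (planarity G' h : planar (underlying G')))).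
End Horizontal.

Section Vertical.
Variables (k l m : nat) (G' : dgraph pl X l m) (G : dgraph pl X k l).
Let U := gvcat (underlying G') (underlying G).

Fact dvcat_decP (v : sV U) :
  tag (sum_dec (dec G) (dec G') v) = (indeg U v, outdeg U v).
Proof.
rewrite /indeg /outdeg !card_half_edges.
- by case: v => v /=; rewrite decP.
- exact: vcat_out_bij.
- exact: vcat_in_bij.
Qed.

Definition dvcat : dgraph pl X k m :=
  DGraph (@DGraphOn pl X _ _ _ U _ dvcat_decP (fun h => planar_vcat
    (planarity G' h : planar (underlying G'))
    (planarity G h : planar (underlying G)))).
End Vertical.

Section NoVertex.
Variables (k l : nat) (G : graph k l) (V0 : sV G -> False).

Definition novertex_planar : planar G.
Proof.
by apply: (@Planar _ _ _ G (fun _ _ => true) (fun _ _ => true)) => v;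
  case: (V0 v).
Defined.

Definition novertex_dgraph : dgraph pl X k l :=
  DGraph (@DGraphOn pl X _ _ _ G (fun v => False_rect _ (V0 v))
    (fun v => False_ind _ (V0 v)) (fun=> novertex_planar)).
End NoVertex.

Definition dunit0 : dgraph pl X 0 0 :=
  @novertex_dgraph 0 0 gunit0 (fun v => of_void False v).
Definition dunit1 : dgraph pl X 1 1 :=
  @novertex_dgraph 1 1 gunit1 (fun v => of_void False v).

End DecoratedOperations.

Definition glact_iso k l (G H : graph k l) (s : 'S_l) (f : giso G H) :
  giso (glact G s) (glact H s).
Proof.
apply: (@GIso _ _ _ _ (glact G s) (glact H s) _ _ _ _ _ _
  (isoV_bij f) (isoE_bij f) (isoI_bij f) (isoO_bij f) (isoIO_bij f) (isoL_bij f)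
  (iso_src f) (iso_tgt f) (iso_alpha f)) => e /=.
by congr (nat_of_ord (s _)); apply: val_inj; apply: iso_beta.
Defined.

Definition gract_iso k l (G H : graph k l) (t : 'S_k) (f : giso G H) :
  giso (gract G t) (gract H t).
Proof.
refine (@GIso _ _ _ _ (gract G t) (gract H t) _ _ _ _ _ _
  (isoV_bij f) (isoE_bij f) (isoI_bij f) (isoO_bij f) (isoIO_bij f) (isoL_bij f)
  (iso_src f) (iso_tgt f) _ (iso_beta f)) => e /=.
by congr (nat_of_ord (t^-1%g _)); apply: val_inj; apply: iso_alpha.
Defined.

Section GhcatIso.
Variables (k l k' l' : nat) (G H : graph k l) (G' H' : graph k' l').
Variables (f : giso G H) (f' : giso G' H').

Fact unsplit_sum_map m n (A B A' B' : Type) (a : A -> 'I_m) (b : B -> 'I_n)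
    (a' : A' -> 'I_m) (b' : B' -> 'I_n) (x : A + B) (y : A' + B') :
  match x, y with
  | inl u, inl v => a u = a' v :> nat
  | inr u, inr v => b u = b' v :> nat
  | _, _ => False
  end ->
  unsplit (sum_map a b x) = unsplit (sum_map a' b' y) :> nat.
Proof. by case: x y => x [] y //= ->. Qed.

Definition ghcat_iso : giso (ghcat G G') (ghcat H H').
Proof.
refine (@GIso _ _ _ _ (ghcat G G') (ghcat H H') _ _ _ _ _ _
  (sum_map_bij (isoV_bij f) (isoV_bij f')) (sum_map_bij (isoE_bij f) (isoE_bij f'))
  (sum_map_bij (isoI_bij f) (isoI_bij f')) (sum_map_bij (isoO_bij f) (isoO_bij f'))
  (sum_map_bij (isoIO_bij f) (isoIO_bij f')) (sum_map_bij (isoL_bij f) (isoL_bij f'))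
  _ _ _ _).
- by case=> -[e|e] /=; rewrite iso_src.
- by case=> -[e|e] /=; rewrite iso_tgt.
- by case=> -[e|e]; apply: unsplit_sum_map; rewrite /= ?(iso_alpha f) ?(iso_alpha f').
- by case=> -[e|e]; apply: unsplit_sum_map; rewrite /= ?(iso_beta f) ?(iso_beta f').
Defined.
End GhcatIso.

Section GlueMap.
Variables (A B A' B' : finType) (n : nat).
Variables (b : A -> 'I_n) (a : B -> 'I_n) (b' : A' -> 'I_n) (a' : B' -> 'I_n).
Variables (fA : A -> A') (fB : B -> B').
Hypothesis bE : forall x, b x = b' (fA x).
Hypothesis aE : forall x, a x = a' (fB x).

Fact glue_map_subproof (p : glue b a) : b' (fA (val p).1) == a' (fB (val p).2).
Proof. by rewrite -bE -aE; apply: (valP p). Qed.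

Definition glue_map (p : glue b a) : glue b' a' :=
  exist _ (fA (val p).1, fB (val p).2) (glue_map_subproof p).

Lemma glue_map_bij : bijective fA -> bijective fB -> bijective glue_map.
Proof.
move=> A_bij B_bij; apply: surj_inj_bij => [p q pq|[[x y] /= xy]].
  apply: val_inj; case: p q pq => -[x y] /= xy [[z t] /= zt] [].
  by move=> /(bij_inj A_bij)-> /(bij_inj B_bij)->.
have [x0 x0E] := bij_surj x A_bij; have [y0 y0E] := bij_surj y B_bij.
have E : b x0 == a y0 by rewrite bE aE x0E y0E.
by exists (exist _ (x0, y0) E); apply: val_inj; rewrite /= x0E y0E.
Qed.
End GlueMap.

Section GvcatIso.
Variables (k l m : nat) (G' H' : graph l m) (G H : graph k l).
Variables (f' : giso G' H') (f : giso G H).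

Fact iso_alphaI i : alpha G' (inl i) = alpha H' (inl (isoI f' i)).
Proof. by apply: val_inj; rewrite /= (iso_alpha f'). Qed.
Fact iso_alphaN i : alpha G' (inr i) = alpha H' (inr (isoIO f' i)).
Proof. by apply: val_inj; rewrite /= (iso_alpha f'). Qed.
Fact iso_betaO i : beta G (inl i) = beta H (inl (isoO f i)).
Proof. by apply: val_inj; rewrite /= (iso_beta f). Qed.
Fact iso_betaN i : beta G (inr i) = beta H (inr (isoIO f i)).
Proof. by apply: val_inj; rewrite /= (iso_beta f). Qed.

Definition glueOI_map : glueOI G' G -> glueOI H' H :=
  glue_map (b' := fun e => beta H (inl e)) (a' := fun e => alpha H' (inl e))
    iso_betaO iso_alphaI.
Definition glueNI_map : glueNI G' G -> glueNI H' H :=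
  glue_map (b' := fun e => beta H (inr e)) (a' := fun e => alpha H' (inl e))
    iso_betaN iso_alphaI.
Definition glueON_map : glueON G' G -> glueON H' H :=
  glue_map (b' := fun e => beta H (inl e)) (a' := fun e => alpha H' (inr e))
    iso_betaO iso_alphaN.
Definition glueNN_map : glueNN G' G -> glueNN H' H :=
  glue_map (b' := fun e => beta H (inr e)) (a' := fun e => alpha H' (inr e))
    iso_betaN iso_alphaN.

Definition gvcat_isoE : sE (gvcat G' G) -> sE (gvcat H' H) :=
  sum_map (sum_map (isoE f) (isoE f')) glueOI_map.
Definition gvcat_isoI : sI (gvcat G' G) -> sI (gvcat H' H) :=
  sum_map (isoI f) glueNI_map.
Definition gvcat_isoO : sO (gvcat G' G) -> sO (gvcat H' H) :=
  sum_map (isoO f') glueON_map.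

Lemma vcat_in_iso e :
  vcat_in (sum_map gvcat_isoE gvcat_isoI e) =
  sum_map (sum_map (isoE f) (isoI f)) (sum_map (isoE f') (isoI f')) (vcat_in e).
Proof. by case: e => [[[]|]|[]]. Qed.

Lemma vcat_out_iso e :
  vcat_out (sum_map gvcat_isoE gvcat_isoO e) =
  sum_map (sum_map (isoE f) (isoO f)) (sum_map (isoE f') (isoO f')) (vcat_out e).
Proof. by case: e => [[[]|]|[]]. Qed.

Definition gvcat_iso : giso (gvcat G' G) (gvcat H' H).
Proof.
refine (@GIso _ _ _ _ (gvcat G' G) (gvcat H' H) _ gvcat_isoE gvcat_isoI
  gvcat_isoO glueNN_map _
  (sum_map_bij (isoV_bij f) (isoV_bij f')) _ _ _ _
  (sum_map_bij (isoL_bij f) (isoL_bij f')) _ _ _ _).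
- apply: sum_map_bij; first exact: sum_map_bij (isoE_bij f) (isoE_bij f').
  exact: glue_map_bij (isoO_bij f) (isoI_bij f').
- apply: sum_map_bij; first exact: isoI_bij.
  exact: glue_map_bij (isoIO_bij f) (isoI_bij f').
- apply: sum_map_bij; first exact: isoO_bij.
  exact: glue_map_bij (isoO_bij f) (isoIO_bij f').
- exact: glue_map_bij (isoIO_bij f) (isoIO_bij f').
- move=> e; rewrite [RHS]/= vcat_out_iso [LHS]/=.
  by case: (vcat_out e) => x /=; rewrite iso_src.
- move=> e; rewrite [RHS]/= vcat_in_iso [LHS]/=.
  by case: (vcat_in e) => x /=; rewrite iso_tgt.
- by case=> [[i|p]|p] /=; rewrite (iso_alpha f).
- by case=> [[i|p]|p] /=; rewrite (iso_beta f').
Defined.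
End GvcatIso.

Section DecoratedCongruence.
Variables (pl : bool) (X : nat -> nat -> Type).

Lemma dlact_equiv k l (G H : dgraph pl X k l) (s : 'S_l) :
  dequiv G H -> dequiv (dlact G s) (dlact H s).
Proof. by case=> f [fd fp]; exists (glact_iso s f). Qed.

Lemma dract_equiv k l (G H : dgraph pl X k l) (t : 'S_k) :
  dequiv G H -> dequiv (dract G t) (dract H t).
Proof. by case=> f [fd fp]; exists (gract_iso t f). Qed.

Fact sum_rel_iso (A B A' B' VA VB : Type) (tA : A -> VA) (tB : B -> VB)
    (fA : A -> A') (fB : B -> B') (rA : rel A) (rB : rel B) (rA' : rel A')
    (rB' : rel B') :
    (forall x y, tA x = tA y -> rA x y = rA' (fA x) (fA y)) ->
    (forall x y, tB x = tB y -> rB x y = rB' (fB x) (fB y)) ->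
  forall x y, sum_map tA tB x = sum_map tA tB y ->
    sum_rel rA rB x y = sum_rel rA' rB' (sum_map fA fB x) (sum_map fA fB y).
Proof. by move=> hA hB [x|x] [y|y] //= [] ?; [apply: hA | apply: hB]. Qed.

Lemma dhcat_equiv k l k' l' (G H : dgraph pl X k l) (G' H' : dgraph pl X k' l') :
  dequiv G H -> dequiv G' H' -> dequiv (dhcat G G') (dhcat H H').
Proof.
move=> [f [fd fp]] [f' [fd' fp']]; exists (ghcat_iso f f'); split=> [|h].
  by case=> v /=; rewrite ?fd ?fd'.
have [fI fO] := fp h; have [fI' fO'] := fp' h; split=> e e' ee'.
  have := sum_rel_iso fI fI' ee'.
  by case: e e' {ee'} => -[e|e] [] [e'|e'].
have := sum_rel_iso fO fO' ee'.
by case: e e' {ee'} => -[e|e] [] [e'|e'].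
Qed.

Lemma dvcat_equiv k l m (G' H' : dgraph pl X l m) (G H : dgraph pl X k l) :
  dequiv G' H' -> dequiv G H -> dequiv (dvcat G' G) (dvcat H' H).
Proof.
move=> [f' [fd' fp']] [f [fd fp]]; exists (gvcat_iso f' f); split=> [|h].
  by case=> v /=; rewrite ?fd ?fd'.
have [fI fO] := fp h; have [fI' fO'] := fp' h; split=> e e' ee'.
  by apply: etrans (sum_rel_iso fI fI' ee') _; rewrite -!vcat_in_iso.
by apply: etrans (sum_rel_iso fO fO' ee') _; rewrite -!vcat_out_iso.
Qed.

End DecoratedCongruence.

(* Isomorphism classes. A record containing arbitrary finite types lives in   *)
(* a universe too large to index a basis, hence classes are taken among       *)
(* graphs whose sets of vertices, edges... are ordinals; [skeletonize] brings *)
(* every graph to this form.                                                  *)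

Record skeleton (pl : bool) (X : nat -> nat -> Type) (k l : nat) := Skeleton {
  skV : nat; skE : nat; skI : nat; skO : nat; skIO : nat; skL : nat;
  sk_val : dgraph_on pl X
    (Shape 'I_skV 'I_skE 'I_skI 'I_skO 'I_skIO 'I_skL) k l }.

Definition skeleton_graph pl X k l (s : skeleton pl X k l) : dgraph pl X k l :=
  DGraph (sk_val s).

Section Skeletonize.
Variables (pl : bool) (X : nat -> nat -> Type) (k l : nat).
Variable G : dgraph pl X k l.

Let ord_shape : shape :=
  Shape 'I_#|sV G| 'I_#|sE G| 'I_#|sI G| 'I_#|sO G| 'I_#|sIO G| 'I_#|sL G|.

Fact enum_rank_eq (A : finType) (x : A) (i : 'I_#|A|) :
  (enum_rank x == i) = (x == enum_val i).
Proof. by rewrite -[i in LHS]enum_valK (inj_eq enum_rank_inj). Qed.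

Fact enum_val_sum_bij (A B : finType) :
  bijective (sum_map (@enum_val A A) (@enum_val B B)).
Proof. exact: sum_map_bij (enum_val_bij A) (enum_val_bij B). Qed.

Definition skel_str : graph_on ord_shape k l :=
  @GraphOn ord_shape k l
    (fun e => enum_rank (src G (sum_map enum_val enum_val e)))
    (fun e => enum_rank (tgt G (sum_map enum_val enum_val e)))
    _ _ (bij_comp (alpha_bij G) (enum_val_sum_bij _ _))
    (bij_comp (beta_bij G) (enum_val_sum_bij _ _)).

Fact skel_decP v :
  tag (dec G (enum_val v)) = (indeg skel_str v, outdeg skel_str v).
Proof.
rewrite decP; congr (_, _); apply/esym; apply: card_bij (enum_val_sum_bij _ _) _ => e;
  exact: enum_rank_eq.
Qed.

Fact skel_order (A B : finType) (t : A + B -> sV G) (r : rel (A + B)) :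
  (forall v, total_order_on [pred e | t e == v] r) ->
  forall v, total_order_on
    [pred e | enum_rank (t (sum_map (@enum_val A A) (@enum_val B B) e)) == v]
    (relpre (sum_map (@enum_val A A) (@enum_val B B)) r).
Proof.
move=> ord_r v; have [r_refl r_asym r_trans r_tot] := ord_r (enum_val v).
have tE e : (enum_rank (t (sum_map (@enum_val A A) (@enum_val B B) e)) == v) =
            (t (sum_map (@enum_val A A) (@enum_val B B) e) == enum_val v).
  exact: enum_rank_eq.
split.
- by move=> e; rewrite inE tE => he; apply: r_refl.
- move=> e e'; rewrite !inE !tE => he he' hr.
  by apply: (bij_inj (enum_val_sum_bij A B)); apply: r_asym.
- by move=> y x z; rewrite !inE !tE => hy hx hz; apply: r_trans.
- by move=> x y; rewrite !inE !tE => hx hy; apply: r_tot.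
Qed.

Definition skeletonize : skeleton pl X k l :=
  Skeleton (@DGraphOn pl X ord_shape k l skel_str
    (fun v => dec G (enum_val v)) skel_decP
    (fun h => @Planar ord_shape k l skel_str _ _
       (skel_order (leI_order (planarity G h)))
       (skel_order (leO_order (planarity G h))))).

Lemma skeletonizeP : dequiv (skeleton_graph skeletonize) G.
Proof.
unshelve eexists.
  refine (@GIso _ _ _ _ (underlying (skeleton_graph skeletonize)) (underlying G)
   _ _ _ _ _ _ (enum_val_bij _) (enum_val_bij _) (enum_val_bij _)
   (enum_val_bij _) (enum_val_bij _) (enum_val_bij _) _ _ _ _) => e //=.
  - by rewrite enum_rankK.
  - by rewrite enum_rankK.
by split=> // h; split.
Qed.

End Skeletonize.

Section Classes.
Variables (pl : bool) (X : nat -> nat -> Type) (k l : nat).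

Definition cskeleton := {classic skeleton pl X k l}.
HB.instance Definition _ := Choice.on cskeleton.

Definition skel_rel (s t : cskeleton) : bool :=
  `[< dequiv (skeleton_graph s) (skeleton_graph t) >].

Fact skel_rel_equiv : equiv_class_of skel_rel.
Proof.
split=> [s|s t|t s u].
- by apply/asboolP/dequiv_refl.
- by apply/asboolP/asboolP; apply: dequiv_sym.
- by move=> /asboolP st /asboolP tu; apply/asboolP; apply: dequiv_trans st tu.
Qed.

Canonical skel_equiv := EquivRelPack skel_rel_equiv.

Definition isoclass := {eq_quot skel_rel}%qT.
HB.instance Definition _ := Choice.on isoclass.

Definition gclass (G : dgraph pl X k l) : isoclass :=
  (\pi_({eq_quot skel_rel}) (skeletonize G : cskeleton))%qT.

Definition grepr (c : isoclass) : dgraph pl X k l := skeleton_graph (repr c).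

Lemma gclassP G H : gclass G = gclass H <-> dequiv G H.
Proof.
split=> [/eqmodP/asboolP GH|GH].
  apply: dequiv_trans (skeletonizeP H).
  by apply: dequiv_trans GH; apply/dequiv_sym/skeletonizeP.
apply/eqmodP/asboolP; apply: dequiv_trans (skeletonizeP G) _.
by apply: dequiv_trans GH _; apply/dequiv_sym/skeletonizeP.
Qed.

Lemma greprK c : gclass (grepr c) = c.
Proof.
rewrite -[RHS]reprK; apply/eqmodP/asboolP.
exact: (skeletonizeP (grepr c)).
Qed.

Lemma gclassK G : dequiv (grepr (gclass G)) G.
Proof. by apply/gclassP; rewrite greprK. Qed.

End Classes.

Section GraphProp.
Variables (pl : bool) (K : fieldType) (X : nat -> nat -> Type).

Definition gen k l (G : dgraph pl X k l) : {malg K[isoclass pl X k l]} :=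
  << gclass G >>.

Definition gr_smod : smod K :=
  @SMod K (fun k l => {malg K[isoclass pl X k l]})
    (fun k l s => lext (fun c => gen (dlact (grepr c) s)))
    (fun k l x t => lext (fun c => gen (dract (grepr c) t)) x).

Definition gr_prop : prop_data K :=
  @PropData K gr_smod
    (fun k l k' l' => lext2 (fun c c' => gen (dhcat (grepr c) (grepr c'))))
    (fun k l m => lext2 (fun c c' => gen (dvcat (grepr c) (grepr c'))))
    (gen (dunit0 pl X)) (gen (dunit1 pl X)).

Lemma lact_gen k l (G : dgraph pl X k l) s :
  lact s (gen G : gr_smod k l) = gen (dlact G s).
Proof.
rewrite /= lextU; congr (mkmalgU _ _).
exact/gclassP/dlact_equiv/gclassK.
Qed.

Lemma ract_gen k l (G : dgraph pl X k l) t :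
  ract (gen G : gr_smod k l) t = gen (dract G t).
Proof.
rewrite /= lextU; congr (mkmalgU _ _).
exact/gclassP/dract_equiv/gclassK.
Qed.

Lemma hcat_gen k l k' l' (G : dgraph pl X k l) (G' : dgraph pl X k' l') :
  hcat (gen G : gr_prop k l) (gen G' : gr_prop k' l') = gen (dhcat G G').
Proof.
rewrite /= lext2U; congr (mkmalgU _ _).
by apply/gclassP/dhcat_equiv; apply: gclassK.
Qed.

Lemma vcat_gen k l m (G' : dgraph pl X l m) (G : dgraph pl X k l) :
  vcat (gen G' : gr_prop l m) (gen G : gr_prop k l) = gen (dvcat G' G).
Proof.
rewrite /= lext2U; congr (mkmalgU _ _).
by apply/gclassP/dvcat_equiv; apply: gclassK.
Qed.

Definition graph_gens (C : forall k l, graph k l -> Prop) k l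
    (x : gr_prop k l) : Prop :=
  exists G : dgraph pl X k l, C k l (underlying G) /\ x = gen G.

End GraphProp.

Lemma span_linear (K : fieldType) (V W : lmodType K) (A : V -> Prop)
    (B : W -> Prop) (f : V -> W) :
    linear f -> (forall x, A x -> f x \in span B) ->
  forall x, x \in span A -> f x \in span B.
Proof.
move=> f_lin fAB; have f0 : f 0 = 0.
  by have := f_lin (-1) 0 0; rewrite scaler0 addr0 scaleN1r addNr.
apply: span_ind => [|x y fx fy|a x Ax]; first by rewrite f0 rpred0.
- by rewrite -[x]scale1r f_lin scale1r rpredD.
- by rewrite -[_ *: x]addr0 f_lin f0 addr0 rpredZ // fAB.
Qed.

Lemma span_bilinear (K : fieldType) (U V W : lmodType K) (A : U -> Prop)
    (B : V -> Prop) (C : W -> Prop) (f : U -> V -> W) :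
    (forall y, linear (fun x => f x y)) -> (forall x, linear (f x)) ->
    (forall x y, A x -> B y -> f x y \in span C) ->
  forall x y, x \in span A -> y \in span B -> f x y \in span C.
Proof.
move=> f_linl f_linr fABC x y Ax By; move: x Ax.
apply: span_linear (f_linl y) _ => x Ax; move: y By.
by apply: span_linear (f_linr x) _ => y; apply: fABC.
Qed.

Section Acyclic.

Lemma no_cycle_sum (V V' E E' F : eqType) (s t : F -> V + V')
    (s1 t1 : E -> V) (s2 t2 : E' -> V') (j1 : E -> F) (j2 : E' -> F) :
    (forall e, s (j1 e) = inl (s1 e) /\ t (j1 e) = inl (t1 e)) ->
    (forall e, s (j2 e) = inr (s2 e) /\ t (j2 e) = inr (t2 e)) ->
    (forall f, [\/ exists e, f = j1 e, exists e, f = j2 e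
                 | (exists v, s f = inl v) /\ (exists v, t f = inr v)]) ->
    (forall c, c != [::] -> ~~ path.cycle (fun e e' => t1 e == s1 e') c) ->
    (forall c, c != [::] -> ~~ path.cycle (fun e e' => t2 e == s2 e') c) ->
  forall c, c != [::] -> ~~ path.cycle (fun e e' => t e == s e') c.
Proof.
move=> j1E j2E jF acE acE' c c0; apply/negP => cyc.
pose up f := if t f is inr _ then true else false.
have up_mono : subrel (fun e e' => t e == s e') (fun e e' => up e ==> up e').
  move=> e e' /eqP ts; rewrite /up ts.
  case: (jF e') => [[a ->]|[a ->]|[[v ->] [w ->]]] //.
    by case: (j1E a) => -> ->.
  by case: (j2E a) => -> ->.
have up_trans : transitive (fun e e' => up e ==> up e').
  by move=> y x z; case: (up x) (up y) (up z) => [] [] [].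
have := sub_cycle up_mono cyc; rewrite (cycle_all2rel up_trans) => /allrelP c_up.
have upE x y : x \in c -> y \in c -> up x = up y.
  by move=> xc yc; have := c_up _ _ xc yc; have := c_up _ _ yc xc; case: (up x) (up y) => [] [] //=.
have s_up x : x \in c -> exists2 y, y \in c & t y = s x.
  move=> xc; exists (prev c x); first by rewrite mem_prev.
  exact/eqP/(prev_cycle cyc xc).
have [x xc] : exists x, x \in c.
  by case: c c0 {cyc c_up upE s_up} => // x c _; exists x; rewrite mem_head.
case up_x : (up x).
  have /(_ c) [|c' c'E] : forall d, {subset d <= c} -> exists d', d = map j2 d'.
  - elim=> [|y d IHd] dc; first by exists [::].
    have [|d' ->] := IHd; first by move=> z zd; apply: dc; rewrite inE zd orbT.
    have yc : y \in c by apply: dc; rewrite mem_head.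
    have [[a yE]|[a ->]|[[v sy] _]] := jF y.
    + by have := upE _ _ yc xc; rewrite up_x /up yE; case: (j1E a) => _ ->.
    + by exists (a :: d').
    have [z zc tz] := s_up _ yc.
    by have := upE _ _ zc xc; rewrite up_x /up tz sy.
  - by [].
  have c'0 : c' != [::] by apply: contra c0; rewrite c'E => /eqP->.
  move: (acE' c' c'0) cyc; rewrite c'E cycle_map => /negP nc cyc; apply: nc.
  apply: sub_cycle cyc => e e' /=.
  by case: (j2E e) (j2E e') => _ -> [-> _].
have /(_ c) [|c' c'E] : forall d, {subset d <= c} -> exists d', d = map j1 d'.
- elim=> [|y d IHd] dc; first by exists [::].
  have [|d' ->] := IHd; first by move=> z zd; apply: dc; rewrite inE zd orbT.
  have yc : y \in c by apply: dc; rewrite mem_head.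
  have [[a ->]|[a yE]|[_ [v ty]]] := jF y.
  + by exists (a :: d').
  + by have := upE _ _ yc xc; rewrite up_x /up yE; case: (j2E a) => _ ->.
  by have := upE _ _ yc xc; rewrite up_x /up ty.
- by [].
have c'0 : c' != [::] by apply: contra c0; rewrite c'E => /eqP->.
move: (acE c' c'0) cyc; rewrite c'E cycle_map => /negP nc cyc; apply: nc.
apply: sub_cycle cyc => e e' /=.
by case: (j1E e) (j1E e') => _ -> [-> _].
Qed.

Lemma upward_iso k l k' l' (G : graph k l) (H : graph k' l') :
  giso G H -> upward G -> upward H.
Proof.
move=> f [acG L0]; split; last first.
  by rewrite -L0; apply/esym/(bij_eq_card (isoL_bij f)).
move=> c c0; pose g := giso_sym f.
have mc0 : map (isoE g) c != [::] by case: c c0.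
apply: contra (acG _ mc0); rewrite cycle_map; apply: sub_cycle => e e' /= /eqP te.
by have := iso_tgt g (inl e); rewrite te (iso_src g) /= => ->.
Qed.

Lemma upward_gequiv k l k' l' (G : graph k l) (H : graph k' l') :
  gequiv G H -> upward G -> upward H.
Proof. by case; apply: upward_iso. Qed.

Lemma upward_ghcat k l k' l' (G : graph k l) (G' : graph k' l') :
  upward G -> upward G' -> upward (ghcat G G').
Proof.
move=> [acG L0] [acG' L0']; split; last by rewrite card_sum L0 L0'.
apply: (no_cycle_sum (j1 := inl) (j2 := inr) _ _ _ acG acG') => //.
by case=> e; [apply: Or31; exists e | apply: Or32; exists e].
Qed.

Lemma upward_gvcat k l m (G' : graph l m) (G : graph k l) :
  upward G' -> upward G -> upward (gvcat G' G).
Proof.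
move=> [acG' L0'] [acG L0]; split; last by rewrite card_sum L0 L0'.
apply: (no_cycle_sum (j1 := inl \o inl) (j2 := inl \o inr) _ _ _ acG acG') => //.
case=> [[e|e]|p]; [apply: Or31; by exists e | apply: Or32; by exists e |].
by apply: Or33; split; eexists.
Qed.

Lemma upward_novertex k l (G : graph k l) :
  (sE G -> False) -> (sL G -> False) -> upward G.
Proof.
move=> E0 L0; split; first by case=> [|e c] // _; case: (E0 e).
by apply: eq_card0 => x; case: (L0 x).
Qed.

End Acyclic.

Section Indecomposable.

Lemma giso_in k l k' l' (G : graph k l) (H : graph k' l') : giso G H -> k = k'.
Proof.
move=> f; rewrite -[LHS]card_ord -[RHS]card_ord.
rewrite -(bij_eq_card (alpha_bij G)) -(bij_eq_card (alpha_bij H)).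
exact: bij_eq_card (sum_map_bij (isoI_bij f) (isoIO_bij f)).
Qed.

Lemma giso_out k l k' l' (G : graph k l) (H : graph k' l') : giso G H -> l = l'.
Proof.
move=> f; rewrite -[LHS]card_ord -[RHS]card_ord.
rewrite -(bij_eq_card (beta_bij G)) -(bij_eq_card (beta_bij H)).
exact: bij_eq_card (sum_map_bij (isoO_bij f) (isoIO_bij f)).
Qed.

Lemma indecomposable_gequiv k l (G H : graph k l) :
  gequiv G H -> indecomposable G -> indecomposable H.
Proof.
move=> GH; have [f] := GH; case=> [V1 IO0 L1 decV decH].
have cV := bij_eq_card (isoV_bij f); have cE := bij_eq_card (isoE_bij f).
have cI := bij_eq_card (isoI_bij f); have cO := bij_eq_card (isoO_bij f).
have cN := bij_eq_card (isoIO_bij f); have cL := bij_eq_card (isoL_bij f).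
have sl : single_loop G -> single_loop H.
  by rewrite /single_loop cV cE cI cO cN cL.
split.
- by rewrite -cV; case: V1; [left | right; apply: sl].
- by rewrite -cN.
- by rewrite -cL; case: L1; [left | right; apply: sl].
- by move=> m G' G'' HG; apply: decV (gequiv_trans GH HG).
- by move=> k1 l1 k2 l2 G' G'' s t HG; apply: decH (gequiv_trans GH HG).
Qed.

(* Two graphs that differ only by their (pointwise equal) index maps. *)
Definition giso_id S k l (G H : graph_on S k l) :
    src G =1 src H -> tgt G =1 tgt H -> alpha G =1 alpha H ->
    beta G =1 beta H -> giso (Graph G) (Graph H).
Proof.
move=> es et ea eb.
refine (@GIso _ _ _ _ (Graph G) (Graph H) id id id id id id (@id_bij _)
  (@id_bij _) (@id_bij _) (@id_bij _) (@id_bij _) (@id_bij _) _ _ _ _) => e /=.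
- by rewrite sum_map_id es.
- by rewrite sum_map_id et.
- by rewrite sum_map_id ea.
- by rewrite sum_map_id eb.
Defined.

Lemma glactK k l (G : graph k l) (s : 'S_l) : gequiv (glact (glact G s) s^-1%g) G.
Proof. by case: G => S G; split; apply: giso_id => e //=; rewrite permK. Qed.

Lemma gractK k l (G : graph k l) (t : 'S_k) : gequiv (gract (gract G t) t^-1%g) G.
Proof. by case: G => S G; split; apply: giso_id => e //=; rewrite invgK permKV. Qed.

Lemma indecomposable_glact k l (G : graph k l) (s : 'S_l) :
  indecomposable G -> indecomposable (glact G s).
Proof.
case=> V1 IO0 L1 decV decH; split=> // [m G' G'' | k1 l1 k2 l2 G' G'' u t].
  case=> f; apply: (decV _ (glact G' s^-1%g) G'').
  apply: gequiv_trans (gequiv_sym (glactK G s)) _.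
  apply: gequiv_trans (inhabits (glact_iso s^-1%g f)) _.
  by split; apply: giso_id => // -[[e|p]|p].
move=> GH; have [f] := GH; have kE := giso_in f; have lE := giso_out f.
subst k l; apply: (decH _ _ _ _ G' G'' (permc s^-1%g u) t).
apply: gequiv_trans (gequiv_sym (glactK G s)) _.
apply: gequiv_trans (inhabits (glact_iso s^-1%g f)) _.
by split; apply: giso_id => // e /=; rewrite permM.
Qed.

Lemma indecomposable_gract k l (G : graph k l) (t : 'S_k) :
  indecomposable G -> indecomposable (gract G t).
Proof.
case=> V1 IO0 L1 decV decH; split=> // [m G' G'' | k1 l1 k2 l2 G' G'' s u].
  case=> f; apply: (decV _ G' (gract G'' t^-1%g)).
  apply: gequiv_trans (gequiv_sym (gractK G t)) _.
  apply: gequiv_trans (inhabits (gract_iso t^-1%g f)) _.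
  by split; apply: giso_id => // -[[e|p]|p].
move=> GH; have [f] := GH; have kE := giso_in f; have lE := giso_out f.
subst k l; apply: (decH _ _ _ _ G' G'' s (permc u t^-1%g)).
apply: gequiv_trans (gequiv_sym (gractK G t)) _.
apply: gequiv_trans (inhabits (gract_iso t^-1%g f)) _.
by split; apply: giso_id => // e /=; rewrite invMg permM.
Qed.

End Indecomposable.

Section SubGraphProps.
Variables (pl : bool) (K : fieldType) (X : nat -> nat -> Type).
Local Notation Gr := (gr_prop pl K X).

Lemma graph_gens_act_stable (C : forall k l, graph k l -> Prop) :
    (forall k l (G : graph k l) s, C k l G -> C k l (glact G s)) ->
    (forall k l (G : graph k l) t, C k l G -> C k l (gract G t)) ->
  act_stable (M := Gr) (graph_gens (pl := pl) (K := K) (X := X) C).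
Proof.
move=> Cl Cr; split=> k l s; apply: span_linear.
- exact: lext_is_linear.
- move=> _ [G [CG ->]]; rewrite [lact _ _]lact_gen; apply: span_gen.
  by exists (dlact G s); split=> //; exact: (Cl _ _ (underlying G) s CG).
- exact: lext_is_linear.
- move=> _ [G [CG ->]]; rewrite [ract _ _]ract_gen; apply: span_gen.
  by exists (dract G s); split=> //; exact: (Cr _ _ (underlying G) s CG).
Qed.

Definition up_gens := graph_gens (pl := pl) (K := K) (X := X) upward.
Definition ind_gens := graph_gens (pl := pl) (K := K) (X := X) indecomposable.

Fact ind_stable : act_stable (M := Gr) ind_gens.
Proof.
apply: graph_gens_act_stable => *;
  [exact: indecomposable_glact | exact: indecomposable_gract].
Qed.

Fact up_stable : prop_stable (P := Gr) up_gens.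
Proof.
split.
- by apply: graph_gens_act_stable.
- move=> k l k' l'; apply: span_bilinear => [y|x|].
  + exact: lext2_linl.
  + exact: lext2_linr.
  move=> _ _ [G [uG ->]] [G' [uG' ->]]; rewrite [hcat _ _]hcat_gen.
  by apply: span_gen; exists (dhcat G G'); split=> //; apply: upward_ghcat.
- move=> k l m; apply: span_bilinear => [y|x|].
  + exact: lext2_linl.
  + exact: lext2_linr.
  move=> _ _ [G' [uG' ->]] [G [uG ->]]; rewrite [vcat _ _]vcat_gen.
  by apply: span_gen; exists (dvcat G' G); split=> //; apply: upward_gvcat.
- apply: span_gen; exists (dunit0 pl X); split=> //.
  by apply: upward_novertex => -[].
- apply: span_gen; exists (dunit1 pl X); split=> //.
  by apply: upward_novertex => -[].
Qed.

Definition gr_ind : smod K := sub_smod ind_stable.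
Definition gr_up : prop_data K := sub_prop up_stable.

Definition up_ind_gens k l (x : gr_up k l) : Prop := ind_gens (val x).

Fact up_ind_stable : act_stable (M := gr_up) up_ind_gens.
Proof.
split=> k l s; apply: span_linear.
- by move=> a x y; apply: val_inj; apply: lext_is_linear.
- move=> x [G [iG xE]]; apply: span_gen; exists (dlact G s); split.
    exact: indecomposable_glact.
  by rewrite /= xE -lact_gen.
- by move=> a x y; apply: val_inj; apply: lext_is_linear.
- move=> x [G [iG xE]]; apply: span_gen; exists (dract G s); split.
    exact: indecomposable_gract.
  by rewrite /= xE -ract_gen.
Qed.

Definition gr_up_ind : smod K := sub_smod up_ind_stable.

End SubGraphProps.

Definition gr_ind_incl pl K X :
    forall k l, gr_ind pl K X k l -> gr_prop pl K X k l :=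
  sub_incl (stA := ind_stable pl K X).

Definition gr_up_ind_incl pl K X :
    forall k l, gr_up_ind pl K X k l -> gr_up pl K X k l :=
  sub_incl (stA := up_ind_stable pl K X).

Notation Gr := (gr_prop false).
Notation Gr_ind := (gr_ind false).
Notation Gr_up := (gr_up false).
Notation Gr_up_ind := (gr_up_ind false).
Notation PGr := (gr_prop true).
Notation PGr_ind := (gr_ind true).
Notation PGr_up := (gr_up true).
Notation PGr_up_ind := (gr_up_ind true).

(* Main.v *)
(* A graph is read as a wiring: a bijection from the "names" (input indices
   and outgoing half-edges) to the "sinks" (output indices and incoming
   half-edges), together with the vertices carrying the half-edges; a loop is
   an extra node without half-edges. A graph C occurs in a graph J on a set D
   of nodes, with a list u of names of J as inputs and a list v as outputs,
   when it embeds in J compatibly with the wirings. D, u and v determine C up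
   to isomorphism, and the occurrences of a composite, of a product... are
   exactly the composites and products of occurrences of the factors on
   disjoint sets of nodes; all the axioms of a ProP for graphs follow.

   A graph is indecomposable exactly when it has no input-output edge and its
   nodes are strongly connected, so every graph is obtained from permutations
   by successively composing with C * I_n, where C runs through the strongly
   connected components in an order compatible with the edges. Given values
   of the indecomposable graphs in a ProP P, such a run has a value in P. Two
   runs over the same nodes have the same value: their last components are
   equal or disjoint, and in the second case both can be moved to the end and
   interchanged, by induction on the number of nodes. Hence the value only
   depends on the graph, it is compatible with all operations, and it is the
   only possible one. Without cycles and loops the strongly connected graphs
   are the corollas. *)

From HB Require Import structures.
From mathcomp Require Import all_boot all_order all_fingroup all_algebra.
From mathcomp Require Import generic_quotient finmap boolp.
From mathcomp.multinomials Require Import monalg.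
Require Import Defs.

Set Implicit Arguments.
Unset Strict Implicit.
Unset Printing Implicit Defensive.

Import GRing.Theory.
Local Open Scope ring_scope.

(** * Arrows of a ProP, and permutations of lists *)

(** The edges of an iterated composite are nested pairs of glued edges, and explicit isomorphisms
    between such types would be unmanageable. Working inside one ambient graph [J] avoids them: a
    strand is named by the place where it begins in [J], so the inputs and outputs of all
    occurrences are lists in one type, two occurrences can be glued when they share the middle list,
    and a permutation is a pair of lists. Taking for [J] the graph itself gives the isomorphisms
    back. The price is the condition [fresh]: an input of a piece must not be a strand that starts
    in a piece placed later, because gluing the two would require a feedback that no composite
    provides. A run is a relation and not a function, since unrelated components have no preferred
    order. Its combinatorial data do not mention [P], so a run in any ProP can be replayed in the
    ProP of graphs, where it rebuilds the subgraph that it traverses; this is how the properties of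
    its lists are obtained. When two runs end with disjoint components, both are compared with a
    third one that treats the common part of their beginnings and then both components side by
    side. *)

Section Arrows.
Variables (K : fieldType) (P : prop_data K).

(** Arities in the proof are sizes of lists and agree only propositionally. Packing them with the
    element makes the laws of a ProP plain equations without casts. *)
Definition arrow := {kl : nat * nat & P kl.1 kl.2}.
Definition arr k l (p : P k l) : arrow :=
  @Tagged _ (k, l) (fun kl => P kl.1 kl.2) p.
Definition adom (a : arrow) := (tag a).1.
Definition acod (a : arrow) := (tag a).2.

Lemma arr_inj k l : injective (@arr k l).
Proof. by move=> p q /eqP; rewrite eq_Tagged => /eqP. Qed.

Lemma arr_cast k l k' l' (ek : k = k') (el : l = l') (p : P k l) :
  arr (smod_cast ek el p) = arr p.
Proof. by subst k' l'. Qed.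

Lemma arrP k l a : adom a = k -> acod a = l -> exists p : P k l, a = arr p.
Proof. by case: a => -[k' l'] p /= <- <-; exists p. Qed.

(* The zero value is only reached for arrows that cannot be composed. *)
Definition recast k l k' l' (p : P k l) : P k' l' :=
  match k =P k', l =P l' with
  | ReflectT ek, ReflectT el => smod_cast ek el p
  | _, _ => 0
  end.

Lemma recast_id k l (p : P k l) : recast k l p = p.
Proof.
rewrite /recast; case: eqP => // ek; case: eqP => // el.
by rewrite (eq_axiomK ek) (eq_axiomK el).
Qed.

Definition acomp (b a : arrow) : arrow :=
  arr (vcat (tagged b) (recast (adom a) (adom b) (tagged a))).
Definition atens (a b : arrow) : arrow := arr (hcat (tagged a) (tagged b)).
Definition aid n : arrow := arr (unitn P n).
(** The symmetry of [P] attached to [s]. By [lact_arr] and [ract_arr] both actions are compositions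
    with such arrows. *)
Definition aperm n (s : 'S_n) : arrow := arr (lact s (unitn P n)).

Lemma acomp_arr k l m (p : P l m) (q : P k l) :
  acomp (arr p) (arr q) = arr (vcat p q).
Proof. by rewrite /acomp /= recast_id. Qed.

Hypothesis PP : is_prop P.

Lemma arrow_ind (Q : arrow -> Prop) :
  (forall k l (p : P k l), Q (arr p)) -> forall a, Q a.
Proof. by move=> QP [[k l] p]; apply: (QP k l p). Qed.

Lemma arr_pair a b : acod a = adom b ->
  exists k l m (p : P k l) (q : P l m), a = arr p /\ b = arr q.
Proof.
case: a b => -[k l] p [[l' m] q] /= e; rewrite /acod /adom /= in e; subst l'.
by exists k, l, m, p, q.
Qed.

Lemma acompA a b c : acod a = adom b -> acod b = adom c ->
  acomp c (acomp b a) = acomp (acomp c b) a.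
Proof.
case/arr_pair=> k [l [m [p [q [-> ->]]]]] /esym/arrP/(_ (erefl _)) [].
by rewrite /acod /= => r ->; rewrite !acomp_arr (vcatA PP).
Qed.

Lemma acomp1l n a : acod a = n -> acomp (aid n) a = a.
Proof. by case/(arrP (erefl _)) => p ->; rewrite acomp_arr vcat1p. Qed.

Lemma acomp1r n a : adom a = n -> acomp a (aid n) = a.
Proof. by case/arrP/(_ (erefl _)) => p ->; rewrite acomp_arr vcatp1. Qed.

Lemma atensA (a b c : arrow) : atens a (atens b c) = atens (atens a b) c.
Proof.
revert a b c; do 3 apply: arrow_ind => ? ? ?.
by rewrite /atens /= -hcatA // arr_cast.
Qed.

Lemma atens0l a : atens (aid 0) a = a.
Proof. by move: a; apply: arrow_ind => k l p; rewrite /atens /= hcat0p. Qed.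

Lemma atens0r a : atens a (aid 0) = a.
Proof.
by move: a; apply: arrow_ind => k l p; rewrite /atens /= -[in RHS](hcatp0 PP p)
  arr_cast.
Qed.

Lemma aidD m n : aid (m + n) = atens (aid m) (aid n).
Proof.
elim: m => [|m IHm]; first by rewrite atens0l.
have aidS k : aid k.+1 = atens (arr (unit1 P)) (aid k) by [].
by rewrite addSn !aidS IHm atensA.
Qed.

Lemma hcat_unitn m n : hcat (unitn P m) (unitn P n) = unitn P (m + n).
Proof. by apply: arr_inj; rewrite -/(aid (m + n)) aidD. Qed.

Lemma atens_comp a b a' b' : acod a = adom b -> acod a' = adom b' ->
  acomp (atens b b') (atens a a') = atens (acomp b a) (acomp b' a').
Proof.
case/arr_pair=> k [l [m [p [q [-> ->]]]]].
case/arr_pair=> k' [l' [m' [p' [q' [-> ->]]]]].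
by rewrite !acomp_arr /atens /= -(hvcat PP) -acomp_arr.
Qed.

Lemma lact_arr k l (s : 'S_l) (p : P k l) :
  arr (lact s p) = acomp (aperm s) (arr p).
Proof. by rewrite acomp_arr -lact_vcat // vcat1p. Qed.

Lemma ract_arr k l (t : 'S_k) (p : P k l) :
  arr (ract p t) = acomp (arr p) (aperm t).
Proof. by rewrite acomp_arr -vcat_act // vcatp1. Qed.

Lemma aperm1 n : aperm (1%g : 'S_n) = aid n.
Proof. by rewrite /aperm lact1 //; apply: prop_is_smod. Qed.

Lemma apermM n (s t : 'S_n) : aperm (permc s t) = acomp (aperm s) (aperm t).
Proof. by rewrite -lact_arr /aperm lactM //; apply: prop_is_smod. Qed.

Lemma aperm_tens m n (s : 'S_m) (t : 'S_n) :
  atens (aperm s) (aperm t) = aperm (perm_tens s t).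
Proof. by rewrite /atens /= hcat_lact // hcat_unitn. Qed.

Lemma aperm_swap k l k' l' a b :
    adom a = k -> acod a = l -> adom b = k' -> acod b = l' ->
  acomp (aperm (perm_swap l l')) (atens a b) =
  acomp (atens b a) (aperm (perm_swap k k')).
Proof.
move=> ak /(arrP ak)[p ->] bk /(arrP bk)[q ->].
rewrite /atens /= -lact_arr hcatC // ract_arr; congr (acomp _ _).
by rewrite arr_cast.
Qed.

End Arrows.

(** * Permutations given by two orderings of a list *)

Section ListPermutations.
Variables (K : fieldType) (P : prop_data K) (H : eqType).

Lemma size_codom_ord n (f : 'I_n -> H) : size (codom f) = n.
Proof. by rewrite size_codom card_ord. Qed.

Lemma nth_codom_ord n (f : 'I_n -> H) x (i : 'I_n) : nth x (codom f) i = f i.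
Proof.
rewrite (nth_map i) ?size_enum_ord //.
by rewrite nth_ord_enum.
Qed.

Lemma codom_ordP n (f g : 'I_n -> H) : codom f = codom g -> f =1 g.
Proof. by move=> fg i; rewrite -(nth_codom_ord f (f i)) fg nth_codom_ord. Qed.

Lemma uniq_codom_ord n (f : 'I_n -> H) : uniq (codom f) <-> injective f.
Proof.
split=> [/injectiveP //|/injectiveP //].
Qed.

Lemma codom_ordW (u : seq H) : exists f : 'I_(size u) -> H, u = codom f.
Proof.
exists (tnth (in_tuple u)); case: u => [|x u] /=.
  by apply/esym/size0nil; rewrite size_codom_ord.
apply: (@eq_from_nth _ x); first by rewrite size_codom_ord.
move=> i iu; rewrite (nth_codom_ord _ _ (Ordinal iu)).
by rewrite (tnth_nth x).
Qed.

(** Convention for the whole proof: the entry in position [i] of [u] stands in position [s i] of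
    [v], in agreement with the left action, which composes [beta] with [s]. *)
Lemma codom_ord_perm (u v : seq H) : uniq u -> perm_eq u v ->
  exists n (f : 'I_n -> H) (s : 'S_n),
    [/\ injective f, u = codom f & v = codom (f \o s^-1%g)].
Proof.
have [f uE] := codom_ordW u; move: uE; move: (size u) f => n f -> {u}.
move/uniq_codom_ord => f_inj fv; have := perm_size fv; rewrite size_codom_ord => sv.
have [g vE] := codom_ordW v; move: g vE; rewrite -sv => g vE.
subst v; have g_inj : injective g.
  by apply/uniq_codom_ord; rewrite -(perm_uniq fv); apply/uniq_codom_ord.
have gf i : exists j, g j = f i.
  have : f i \in codom g by rewrite -(perm_mem fv) codom_f.
  by case/codomP => j ->; exists j.
pose s i := sval (cid (gf i)); have gs i : g (s i) = f i := svalP (cid (gf i)).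
have s_inj : injective s by move=> i j e; apply: f_inj; rewrite -!gs e.
exists n, f, (perm s_inj); split=> //; apply: eq_codom => j /=.
by rewrite -gs -(permE s_inj) permKV.
Qed.

(** The symmetry whose strand labelled [x] enters at the place of [x] in [u] and leaves at its place
    in [v]. The default [1%g] is reached only when no permutation carries the positions of [u] to
    those of [v]. *)
Definition lperm (u v : seq H) : arrow P :=
  aperm P (odflt 1%g [pick s : 'S_(size u) |
    [forall i, index (tnth (in_tuple u) i) v == s i]]).

Lemma lpermE n (f : 'I_n -> H) (s : 'S_n) :
  injective f -> lperm (codom f) (codom (f \o s^-1%g)) = aperm P s.
Proof.
move=> f_inj; rewrite /lperm; set v := codom (f \o _).
have : size (codom f) = n := size_codom_ord f.
move uE: (codom f) => u un; subst n; congr aperm.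
have fE i : tnth (in_tuple u) i = f i.
  by rewrite (tnth_nth (f i)) /= -[RHS](nth_codom_ord f (f i)) uE.
have vs i : index (f i) v = s i.
  have := nth_codom_ord (f \o s^-1%g) (f i) (s i); rewrite /= permK => <-.
  rewrite index_uniq //; first by rewrite size_codom_ord.
  by apply/uniq_codom_ord/inj_comp => //; apply: perm_inj.
case: pickP => [t /forallP tP|/(_ s)/negbT/negP[]] /=; last first.
  by apply/forallP => i; rewrite fE vs.
by apply/permP => i; apply/val_inj/esym; rewrite /= -(eqP (tP i)) fE vs.
Qed.

Hypothesis PP : is_prop P.

Lemma lperm_id u : uniq u -> lperm u u = aid P (size u).
Proof.
move=> uu; have [f uE] := codom_ordW u; have f_inj : injective f.
  by apply/uniq_codom_ord; rewrite -uE.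
rewrite -(aperm1 PP) -(lpermE _ f_inj) -uE; congr lperm; rewrite [LHS]uE.
by apply: eq_codom => i; rewrite /= invg1 perm1.
Qed.

Lemma lperm_comp u v w : uniq u -> perm_eq u v -> perm_eq v w ->
  acomp (lperm v w) (lperm u v) = lperm u w.
Proof.
move=> uu uv vw; have [n [f [s [f_inj uE vE]]]] := codom_ord_perm uu uv.
have fs_inj : injective (f \o s^-1%g) by apply: inj_comp => //; apply: perm_inj.
have [g] : exists g : 'I_n -> H, w = codom g.
  have [g wE] := codom_ordW w; move: g wE.
  by rewrite -(perm_size vw) vE size_codom_ord => g wE; exists g.
move=> wE; have [m [g' [t [g'_inj vE' wE']]]] : exists m (g' : 'I_m -> H) (t : 'S_m),
    [/\ injective g', v = codom g' & w = codom (g' \o t^-1%g)].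
  by apply: codom_ord_perm => //; rewrite -(perm_uniq uv).
have mn : m = n by rewrite -(size_codom_ord g') -vE' vE size_codom_ord.
subst m; have g'E : g' =1 f \o s^-1%g by apply: codom_ordP; rewrite -vE'.
rewrite vE' wE' lpermE // -vE' uE vE lpermE // -apermM //.
rewrite -(lpermE _ f_inj); congr lperm; apply: eq_codom => i /=.
by rewrite g'E /= invMg permM.
Qed.

End ListPermutations.

Section ListConcatenation.
Variables (H : eqType).

Definition fcat m n (f : 'I_m -> H) (g : 'I_n -> H) (i : 'I_(m + n)) : H :=
  match split i with inl a => f a | inr b => g b end.

Lemma fcatl m n (f : 'I_m -> H) (g : 'I_n -> H) a : fcat f g (lshift n a) = f a.
Proof. by rewrite /fcat (unsplitK (inl a)). Qed.

Lemma fcatr m n (f : 'I_m -> H) (g : 'I_n -> H) b : fcat f g (rshift m b) = g b.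
Proof. by rewrite /fcat (unsplitK (inr b)). Qed.

Lemma enum_ord_split m n :
  enum 'I_(m + n) = map (@lshift m n) (enum 'I_m) ++ map (@rshift m n) (enum 'I_n).
Proof.
apply: (inj_map val_inj); rewrite val_enum_ord iotaD map_cat add0n.
rewrite -(map_comp val (@lshift m n)) -(map_comp val (@rshift m n))
  -(val_enum_ord m); congr (_ ++ _).
rewrite -[m in LHS]addn0 iotaDl -val_enum_ord -map_comp; exact: eq_map.
Qed.

Lemma codom_split m n (h : 'I_(m + n) -> H) :
  codom h = codom (h \o @lshift m n) ++ codom (h \o @rshift m n).
Proof. by rewrite /codom /image_mem enum_ord_split map_cat -!map_comp. Qed.

Lemma codom_fcat m n (f : 'I_m -> H) (g : 'I_n -> H) :
  codom (fcat f g) = codom f ++ codom g.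
Proof.
by rewrite codom_split; congr (_ ++ _); apply: eq_codom => i /=;
  rewrite ?fcatl ?fcatr.
Qed.

Lemma codom_cast m n (e : m = n) (f : 'I_n -> H) :
  codom (f \o cast_ord e) = codom f.
Proof. by subst n; apply: eq_codom => i /=; rewrite cast_ord_id. Qed.

Lemma fcat_perm_tens m n (f : 'I_m -> H) (g : 'I_n -> H) (s : 'S_m) (t : 'S_n) :
  fcat f g \o perm_tens s t =1 fcat (f \o s) (g \o t).
Proof.
move=> i; rewrite /= permE /tens_fun /fcat unsplitK.
by case: (split i).
Qed.

Lemma perm_tensV m n (s : 'S_m) (t : 'S_n) :
  ((perm_tens s t)^-1 = perm_tens s^-1 t^-1)%g.
Proof.
apply/eqP; rewrite eq_invg_mul; apply/eqP/permP => i.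
rewrite permM perm1 !permE /tens_fun unsplitK -[RHS](splitK i).
by case: (split i) => j /=; rewrite permK.
Qed.

Lemma codom_swap m n (f : 'I_m -> H) (g : 'I_n -> H) :
  codom (fcat f g \o (perm_swap m n)^-1%g) = codom g ++ codom f.
Proof.
rewrite -codom_fcat -(codom_cast (addnC m n)); apply: eq_codom => j /=.
rewrite -[j in RHS](permKV (perm_swap m n)).
move: ((perm_swap m n)^-1%g j) => i; rewrite permE /swap_fun.
rewrite cast_ord_comp cast_ord_id /fcat.
by case: (split i) => c; rewrite ?(unsplitK (inr c)) ?(unsplitK (inl c)).
Qed.

End ListConcatenation.

Section ListPermutations2.
Variables (K : fieldType) (P : prop_data K) (PP : is_prop P).

Lemma lperm_cat (H : eqType) (u u' v v' : seq H) :
    uniq (u ++ u') -> perm_eq u v -> perm_eq u' v' ->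
  lperm P (u ++ u') (v ++ v') = atens (lperm P u v) (lperm P u' v').
Proof.
move=> uu; have := uu; rewrite cat_uniq => /and3P[u1 _ u2].
case/(codom_ord_perm u1) => m [f [s [f_inj uE ->]]].
case/(codom_ord_perm u2) => n [f' [s' [f'_inj uE' ->]]].
move: uu; subst u u'; rewrite -!codom_fcat => /uniq_codom_ord ff_inj.
rewrite !lpermE // aperm_tens // -(lpermE P _ ff_inj); congr lperm.
rewrite perm_tensV; apply: eq_codom => j; exact/esym/fcat_perm_tens.
Qed.

(** Naturality of the symmetry, which is the axiom [hcatC] in the language of labels. Only the sizes
    of the lists matter, so inputs and outputs may be labelled in different types. *)
Lemma lperm_swap (H H' : eqType) (u u' : seq H) (v v' : seq H') a b :
    uniq (u ++ u') -> uniq (v ++ v') ->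
    adom a = size u -> acod a = size v -> adom b = size u' -> acod b = size v' ->
  acomp (lperm P (v ++ v') (v' ++ v)) (atens a b) =
  acomp (atens b a) (lperm P (u ++ u') (u' ++ u)).
Proof.
have swapE (I : eqType) (w w' : seq I) : uniq (w ++ w') ->
    lperm P (w ++ w') (w' ++ w) = aperm P (perm_swap (size w) (size w')).
  have [f wE] := codom_ordW w; have [f' wE'] := codom_ordW w'.
  move: (size w) (size w') f f' wE wE' => m n f f' -> -> {w w'}.
  rewrite -!codom_fcat => /uniq_codom_ord ff_inj.
  rewrite -(lpermE P _ ff_inj); congr lperm.
  by rewrite codom_swap codom_fcat.
move=> uu vv *; rewrite !swapE //; exact: aperm_swap.
Qed.

Lemma lperm_map (H H' : eqType) (h : H -> H') (u v : seq H) :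
  {in u &, injective h} -> uniq u -> perm_eq u v ->
  lperm P (map h u) (map h v) = lperm P u v.
Proof.
move=> h_inj uu uv; have [n [f [s [f_inj uE vE]]]] := codom_ord_perm uu uv.
subst u v; rewrite lpermE // /codom /image_mem -(map_comp h f)
  -(map_comp h (f \o s^-1%g)).
apply: (@lpermE _ _ _ _ (h \o f)) => i j /= /h_inj e.
by apply/f_inj/e; apply: codom_f.
Qed.

End ListPermutations2.

(** * Boxes acting on a block of strands *)

Section BlockArrows.
Variables (K : fieldType) (P : prop_data K) (PP : is_prop P) (H : eqType).
Implicit Types (u v w r s : seq H) (a b c : arrow P).
Local Notation lperm := (@lperm K P H).

Definition ahom u v a := adom a = size u /\ acod a = size v.

Lemma ahom_comp u v w a b : ahom u v a -> ahom v w b -> ahom u w (acomp b a).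
Proof. by case=> au _ [_ bw]. Qed.

Lemma ahom_tens u v u' v' a b :
  ahom u v a -> ahom u' v' b -> ahom (u ++ u') (v ++ v') (atens a b).
Proof.
case=> au av [bu bv]; split; rewrite size_cat.
  by rewrite -au -bu.
by rewrite -av -bv.
Qed.

Lemma ahom_id u : ahom u u (aid P (size u)). Proof. by []. Qed.

Lemma ahom_lperm u v : perm_eq u v -> ahom u v (lperm u v).
Proof. by move/perm_size => uv; split. Qed.

Lemma acompAh t u v w a b c : ahom t u a -> ahom u v b -> ahom v w c ->
  acomp c (acomp b a) = acomp (acomp c b) a.
Proof. by case=> _ au [bu bv] [cv _]; apply: acompA; rewrite ?au ?bv. Qed.

Lemma acomp1lh u v a : ahom u v a -> acomp (aid P (size v)) a = a.
Proof. by case=> _ av; apply: acomp1l. Qed.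

Lemma acomp1rh u v a : ahom u v a -> acomp a (aid P (size u)) = a.
Proof. by case=> au _; apply: acomp1r. Qed.

Lemma atens_comph u v w u' v' w' a b a' b' :
    ahom u v a -> ahom v w b -> ahom u' v' a' -> ahom v' w' b' ->
  acomp (atens b b') (atens a a') = atens (acomp b a) (acomp b' a').
Proof.
by case=> _ av [bv _] [_ av'] [bv' _]; apply: atens_comp; rewrite ?av ?av'.
Qed.

Lemma lperm_catl u u' v : uniq (u ++ v) -> perm_eq u u' ->
  lperm (u ++ v) (u' ++ v) = atens (lperm u u') (aid P (size v)).
Proof.
move=> uv uu'; rewrite lperm_cat // lperm_id //.
by move: uv; rewrite cat_uniq => /and3P[].
Qed.

Lemma lperm_catr u v v' : uniq (u ++ v) -> perm_eq v v' ->
  lperm (u ++ v) (u ++ v') = atens (aid P (size u)) (lperm v v').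
Proof.
move=> uv vv'; rewrite lperm_cat // lperm_id //.
by move: uv; rewrite cat_uniq => /and3P[].
Qed.

(** Used for one component that occurs with its ends and idle strands in two orders: the local
    permutations merge into permutations of the full lists. *)
Lemma block_conj i i' o o' r r' a :
    ahom i o a -> uniq (i' ++ r') -> uniq (o ++ r) ->
    perm_eq i' i -> perm_eq o o' -> perm_eq r' r ->
  atens (acomp (lperm o o') (acomp a (lperm i' i))) (aid P (size r')) =
  acomp (lperm (o ++ r) (o' ++ r'))
    (acomp (atens a (aid P (size r))) (lperm (i' ++ r') (i ++ r))).
Proof.
move=> ah ui uo ii oo rr; have rr' : perm_eq r r' by rewrite perm_sym.
have [ur ur'] : uniq r /\ uniq r'.
  by split; [move: uo | move: ui]; rewrite cat_uniq => /and3P[].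
rewrite !lperm_cat //.
rewrite (atens_comph (ahom_lperm ii) ah (ahom_lperm rr) (ahom_id _)).
rewrite (atens_comph (ahom_comp (ahom_lperm ii) ah) (ahom_lperm oo)
  (ahom_comp (ahom_lperm rr) (ahom_id _)) (ahom_lperm rr')).
congr atens; rewrite (acomp1lh (ahom_lperm rr)) lperm_comp //.
by rewrite lperm_id.
Qed.

(** By interchange both sides are [a] beside the permutation of the idle strands. *)
Lemma block_slide i o r r' a :
    ahom i o a -> uniq (i ++ r) -> uniq (o ++ r) -> perm_eq r r' ->
  acomp (atens a (aid P (size r'))) (lperm (i ++ r) (i ++ r')) =
  acomp (lperm (o ++ r) (o ++ r')) (atens a (aid P (size r))).
Proof.
move=> ah ui uo rr; rewrite !lperm_catr //.
rewrite (atens_comph (ahom_id _) ah (ahom_lperm rr) (ahom_id _)).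
rewrite (atens_comph ah (ahom_id _) (ahom_id _) (ahom_lperm rr)).
by rewrite (acomp1lh ah) (acomp1rh ah) (acomp1lh (ahom_lperm rr))
  (acomp1rh (ahom_lperm rr)).
Qed.

Lemma block_swap i1 o1 i2 o2 r a b :
    ahom i1 o1 a -> ahom i2 o2 b -> uniq (i1 ++ i2 ++ r) -> uniq (o1 ++ o2 ++ r) ->
  acomp (lperm (o1 ++ o2 ++ r) (o2 ++ o1 ++ r)) (atens a (atens b (aid P (size r)))) =
  acomp (atens b (atens a (aid P (size r)))) (lperm (i1 ++ i2 ++ r) (i2 ++ i1 ++ r)).
Proof.
move=> ah bh; rewrite !catA => ui uo.
have pC (x y : seq H) : perm_eq (x ++ y) (y ++ x) by rewrite perm_catC.
have [ui' uo'] : uniq (i1 ++ i2) /\ uniq (o1 ++ o2).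
  by split; [move: ui | move: uo]; rewrite cat_uniq => /and3P[].
rewrite !atensA // !lperm_catl //.
rewrite (atens_comph (ahom_tens ah bh) (ahom_lperm (pC _ _)) (ahom_id _) (ahom_id _)).
rewrite (atens_comph (ahom_lperm (pC _ _)) (ahom_tens bh ah) (ahom_id _) (ahom_id _)).
congr atens; case: ah bh => a1 a2 [b1 b2]; exact: lperm_swap.
Qed.

(** The inputs of [a] are idle while [b] acts and the outputs of [b] are idle while [a] acts, so
    interchange merges the two consecutive boxes into one parallel layer. [r1] is the order in which
    the step of [a] lists its idle strands. *)
Lemma block_seq w i1 o1 i2 o2 r r1 a b :
    ahom i1 o1 a -> ahom i2 o2 b ->
    perm_eq w (i1 ++ i2 ++ r) -> perm_eq (o2 ++ r) r1 ->
    uniq w -> uniq (o1 ++ o2 ++ r) -> uniq (o2 ++ i1 ++ r) ->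
  acomp (atens a (aid P (size r1))) (acomp (lperm (o2 ++ i1 ++ r) (i1 ++ r1))
    (acomp (atens b (aid P (size (i1 ++ r)))) (lperm w (i2 ++ i1 ++ r)))) =
  acomp (lperm (o1 ++ o2 ++ r) (o1 ++ r1))
    (acomp (atens a (atens b (aid P (size r)))) (lperm w (i1 ++ i2 ++ r))).
Proof.
move=> ah bh wE r1E uw uo uoi.
have ui12 : uniq (i1 ++ i2 ++ r) by rewrite -(perm_uniq wE).
have pCA (x y z : seq H) : perm_eq (x ++ y ++ z) (y ++ x ++ z) by rewrite perm_catCA.
have wE' : perm_eq w (i2 ++ i1 ++ r) by rewrite (perm_trans wE).
have ui21 : uniq (i2 ++ i1 ++ r) by rewrite -(perm_uniq wE').
have uio : uniq (i1 ++ o2 ++ r) by rewrite (perm_uniq (pCA _ _ _)).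
have idh : ahom (i1 ++ r) (i1 ++ r) (aid P (size (i1 ++ r))) := ahom_id _.
have bIh : ahom (i2 ++ i1 ++ r) (o2 ++ i1 ++ r) (atens b (aid P (size (i1 ++ r)))).
  exact: ahom_tens bh idh.
have rE : perm_eq (i1 ++ o2 ++ r) (i1 ++ r1) by rewrite perm_cat2l.
have aIh : ahom (i1 ++ o2 ++ r) (o1 ++ o2 ++ r) (atens a (aid P (size (o2 ++ r)))).
  exact: ahom_tens ah (ahom_id _).
have aIh1 : ahom (i1 ++ r1) (o1 ++ r1) (atens a (aid P (size r1))).
  exact: ahom_tens ah (ahom_id _).
have orE : perm_eq (o1 ++ o2 ++ r) (o1 ++ r1) by rewrite perm_cat2l.
have abh : ahom (i1 ++ i2 ++ r) (i1 ++ o2 ++ r)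
  (atens (aid P (size i1)) (atens b (aid P (size r)))).
  exact: ahom_tens (ahom_id _) (ahom_tens bh (ahom_id _)).
rewrite -(@lperm_comp _ _ _ PP (o2 ++ i1 ++ r) (i1 ++ o2 ++ r)) //.
rewrite -(acompAh (ahom_comp (ahom_lperm wE') bIh) (ahom_lperm (pCA _ _ _))
  (ahom_lperm rE)).
set x := acomp (lperm (o2 ++ i1 ++ r) _) _.
(* Here [b] is moved behind the block [i1]: naturality of the symmetry, with the identity on [i1] as
   the second box. *)
have xE : x = acomp (atens (aid P (size i1)) (atens b (aid P (size r))))
  (lperm w (i1 ++ i2 ++ r)).
  rewrite /x (acompAh (ahom_lperm wE') bIh (ahom_lperm (pCA _ _ _))).
  rewrite size_cat aidD // (block_swap bh (ahom_id i1)) //.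
  rewrite -(acompAh (ahom_lperm wE') (ahom_lperm (pCA _ _ _)) abh) lperm_comp //.
have xh : ahom w (i1 ++ o2 ++ r) x.
  by rewrite xE; apply: ahom_comp (ahom_lperm wE) abh.
rewrite (acompAh xh (ahom_lperm rE) aIh1) (block_slide ah uio uo r1E).
rewrite -(acompAh xh aIh (ahom_lperm orE)) xE; congr acomp.
rewrite (acompAh (ahom_lperm wE) abh aIh); congr acomp.
rewrite size_cat aidD //.
have bIrh := ahom_tens bh (ahom_id r).
have idor : ahom (o2 ++ r) (o2 ++ r) (atens (aid P (size o2)) (aid P (size r))).
  exact: ahom_tens (ahom_id _) (ahom_id _).
rewrite (atens_comph (ahom_id _) ah bIrh idor) (acomp1rh ah); congr atens.
rewrite -(aidD PP) -size_cat; exact: acomp1lh bIrh.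
Qed.

End BlockArrows.

(** * Wirings *)

Section Wiring.
Variables (k l : nat) (G : graph k l).

(** An internal edge counts in both [hA] and [hB], once for its beginning and once for its end. *)
Definition hA : finType := (sE G + sO G)%type.
Definition hB : finType := (sE G + sI G)%type.
Definition name : finType := ('I_k + hA)%type.
Definition sink : finType := ('I_l + hB)%type.
Definition node : finType := (sV G + sL G)%type.

Definition wire (x : name) : sink :=
  match x with
  | inl i => match inverse (alpha_bij G) i with
             | inl e => inr (inr e)
             | inr n => inl (beta G (inr n))
             end
  | inr (inl e) => inr (inl e)
  | inr (inr o) => inl (beta G (inl o))
  end.

Definition unwire (y : sink) : name :=
  match y with
  | inl j => match inverse (beta_bij G) j with
             | inl o => inr (inr o)
             | inr n => inl (alpha G (inr n))
             end
  | inr (inl e) => inr (inl e)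
  | inr (inr i) => inl (alpha G (inl i))
  end.

Lemma wire_alpha e : wire (inl (alpha G e)) =
  match e with inl i => inr (inr i) | inr n => inl (beta G (inr n)) end.
Proof. by rewrite /= inverseK. Qed.

Lemma unwire_beta e : unwire (inl (beta G e)) =
  match e with inl o => inr (inr o) | inr n => inl (alpha G (inr n)) end.
Proof. by rewrite /= inverseK. Qed.

Lemma wireK x : unwire (wire x) = x.
Proof.
case: x => [i|[e|o]]; last first.
- by rewrite [wire _]/= unwire_beta.
- by [].
have [e <-] := bij_surj i (alpha_bij G).
by rewrite wire_alpha; case: e => e //; rewrite unwire_beta.
Qed.

Lemma unwireK y : wire (unwire y) = y.
Proof.
case: y => [j|[e|i]]; last first.
- by rewrite [unwire _]/= wire_alpha.
- by [].
have [e <-] := bij_surj j (beta_bij G).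
by rewrite unwire_beta; case: e => e //; rewrite wire_alpha.
Qed.

Definition inputs : seq name := codom (fun i : 'I_k => inl i : name).
(** A strand that leaves is still named by its beginning. Outputs therefore live in the same type as
    inputs, and the outputs of one occurrence can be the inputs of the next. *)
Definition outputs : seq name := codom (fun j : 'I_l => unwire (inl j)).

End Wiring.

Arguments wire {k l} G x.
Arguments unwire {k l} G y.
Arguments wireK {k l G} x.
Arguments unwireK {k l G} y.

Section SumBijection.

Lemma sum_map_split A A' B B' (f : A + B -> A' + B') : bijective f ->
    (forall a, exists a', f (inl a) = inl a') ->
    (forall b, exists b', f (inr b) = inr b') ->
  exists g h, [/\ bijective g, bijective h & f =1 sum_map g h].
Proof.
move=> f_bij fl fr; pose g a := sval (cid (fl a)); pose h b := sval (cid (fr b)).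
have gE a : f (inl a) = inl (g a) := svalP (cid (fl a)).
have hE b : f (inr b) = inr (h b) := svalP (cid (fr b)).
have f_inj := bij_inj f_bij; exists g, h; split; last by case.
- apply: surj_inj_bij => [a a' e|a'].
    by have /f_inj[] : f (inl a) = f (inl a') by rewrite !gE e.
  have [[a|b]] := bij_surj (inl a') f_bij; rewrite ?gE ?hE // => -[<-].
  by exists a.
- apply: surj_inj_bij => [a a' e|b'].
    by have /f_inj[] : f (inr a) = f (inr a') by rewrite !hE e.
  have [[a|b]] := bij_surj (inr b') f_bij; rewrite ?gE ?hE // => -[<-].
  by exists b.
Qed.

Lemma inj_lift A B C (f : A -> C) (g : B -> C) : injective f -> injective g ->
    (forall a, exists b, g b = f a) -> (forall b, exists a, f a = g b) ->
  exists2 h : A -> B, bijective h & forall a, g (h a) = f a.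
Proof.
move=> f_inj g_inj fg gf; pose h a := sval (cid (fg a)).
have hE a : g (h a) = f a := svalP (cid (fg a)).
exists h => //; apply: surj_inj_bij => [a a' e|b].
  by apply: f_inj; rewrite -!hE e.
by have [a aE] := gf b; exists a; apply: g_inj; rewrite hE.
Qed.

End SumBijection.

Section WiringIso.
Variables (k l : nat) (G H : graph k l).
Variables (fV : sV G -> sV H) (fL : sL G -> sL H).
Variables (fA : hA G -> hA H) (fB : hB G -> hB H).
Hypothesis (fV_bij : bijective fV) (fL_bij : bijective fL).
Hypothesis (fA_bij : bijective fA) (fB_bij : bijective fB).
Hypothesis fsrc : forall a, fV (src G a) = src H (fA a).
Hypothesis ftgt : forall b, fV (tgt G b) = tgt H (fB b).
Hypothesis fwire : forall x, wire H (sum_map id fA x) = sum_map id fB (wire G x).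

(** The kind of an edge can be read off the wiring: each of its two ends is either an index or a
    half-edge. Maps of half-edges that commute with [wire] therefore respect the kinds and split
    into maps of [sE], [sO] and [sI]. *)
Lemma wiring_giso : exists f : giso G H,
  [/\ isoV f = fV, sum_map (isoE f) (isoO f) =1 fA &
      sum_map (isoE f) (isoI f) =1 fB].
Proof.
have [fE [fO [fE_bij fO_bij fAE]]] : exists fE fO,
    [/\ bijective fE, bijective fO & fA =1 sum_map fE fO].
  apply: sum_map_split => // [e|o].
    have := fwire (inr (inl e)); rewrite /=; case: (fA _) => // e' _.
    by exists e'.
  have := fwire (inr (inr o)); rewrite /=; case: (fA _) => // o' _.
  by exists o'.
have [fE' [fI [_ fI_bij fBE]]] : exists fE' fI,
    [/\ bijective fE', bijective fI & fB =1 sum_map fE' fI].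
  apply: sum_map_split => // [e|i].
    have := fwire (inr (inl e)); rewrite /=.
    by case: (fA _) => //= e' [<-]; exists e'.
  have := fwire (inl (alpha G (inl i))); rewrite wire_alpha [RHS]/=.
  have [[i'|n] <-] := bij_surj (alpha G (inl i)) (alpha_bij H).
    by rewrite [sum_map _ _ _]/= wire_alpha => -[<-]; exists i'.
  by rewrite [sum_map _ _ _]/= wire_alpha.
have fEE : fE' =1 fE.
  by move=> e; have := fwire (inr (inl e)); rewrite /= fAE /= fBE => -[].
(* Input-output edges have no half-edge; their map is recovered from the input indices, which stay
   fixed. *)
pose fN0 e := inverse (alpha_bij H) (alpha G e).
have fN0E e : alpha H (fN0 e) = alpha G e by rewrite /fN0 Kinverse.
have fN0_bij : bijective fN0.
  by apply: bij_comp (alpha_bij G); apply: inverse_bij.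
have [fI' [fN [_ fN_bij fNE]]] : exists fI' fN,
    [/\ bijective fI', bijective fN & fN0 =1 sum_map fI' fN].
  apply: sum_map_split => // e.
    have := fN0E (inl e); set e' := fN0 _ => aE; have := fwire (inl (alpha G (inl e))).
    by rewrite -{1}aE [sum_map _ _ (inl _)]/= !wire_alpha; case: e' {aE} => // e' _;
      exists e'.
  have := fN0E (inr e); set e' := fN0 _ => aE; have := fwire (inl (alpha G (inr e))).
  by rewrite -{1}aE [sum_map _ _ (inl _)]/= !wire_alpha; case: e' {aE} => // e' _;
    exists e'.
have fIE : fI' =1 fI.
  move=> i; have := fN0E (inl i); rewrite fNE [sum_map _ _ _]/= => aE.
  have := fwire (inl (alpha G (inl i))).
  by rewrite -{1}aE [sum_map _ _ (inl _)]/= !wire_alpha /= fBE => -[].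
unshelve eexists.
  refine (@GIso _ _ _ _ G H fV fE fI fO fN fL _ _ _ _ _ _ _ _ _ _) => //.
  - by move=> a; rewrite fsrc fAE.
  - by move=> b; rewrite ftgt fBE; congr tgt; case: b => //= e; rewrite fEE.
  - move=> e; rewrite -fN0E fNE; congr (nat_of_ord (alpha H _)).
    by case: e => //= i; rewrite fIE.
  - case=> [o|n].
      by have := fwire (inr (inr o)); rewrite /= fAE /= => -[->].
    have := fN0E (inr n); rewrite fNE [sum_map _ _ _]/= => aE.
    have := fwire (inl (alpha G (inr n))).
    by rewrite -{1}aE [sum_map _ _ (inl _)]/= !wire_alpha /= => -[->].
split=> //= x.
by rewrite fBE; case: x => //= e; rewrite fEE.
Qed.

End WiringIso.

Lemma giso_wire k l (G H : graph k l) (f : giso G H) x :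
  wire H (sum_map id (sum_map (isoE f) (isoO f)) x) =
  sum_map id (sum_map (isoE f) (isoI f)) (wire G x).
Proof.
case: x => [i|[e|o]] //=; last by congr inl; apply/val_inj/esym/(iso_beta f).
have [e <-] := bij_surj i (alpha_bij G); have aE := iso_alpha f e.
rewrite inverseK (val_inj aE : alpha G e = alpha H _) inverseK.
case: e {aE} => e //=; congr inl; apply/val_inj/esym/(iso_beta f).
Qed.

(** * Wirings of composites and products *)

Section WiringOfCompositions.
Variables (k l m : nat) (G' : graph l m) (G : graph k l).
Local Notation GG := (gvcat G' G).

Definition vinl (b : hB G) : hB GG := inverse (vcat_in_bij G' G) (inl b).
Definition vinr (b : hB G') : hB GG := inverse (vcat_in_bij G' G) (inr b).
Definition voutl (a : hA G) : hA GG := inverse (vcat_out_bij G' G) (inl a).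
Definition voutr (a : hA G') : hA GG := inverse (vcat_out_bij G' G) (inr a).

Definition vnamel (x : name G) : name GG :=
  match x with inl i => inl i | inr a => inr (voutl a) end.
(** A strand entering [G'] at [j] continues the strand of [G] that leaves at [j], so in the
    composite it takes its name from [G]. *)
Definition vnamer (x : name G') : name GG :=
  match x with inl j => vnamel (unwire G (inl j)) | inr a => inr (voutr a) end.

Let vslE y b : vcat_in y = inl b -> vinl b = y.
Proof. by rewrite /vinl => <-; rewrite inverseK. Qed.
Let vsrE y b : vcat_in y = inr b -> vinr b = y.
Proof. by rewrite /vinr => <-; rewrite inverseK. Qed.
Let valE y a : vcat_out y = inl a -> voutl a = y.
Proof. by rewrite /voutl => <-; rewrite inverseK. Qed.
Let varE y a : vcat_out y = inr a -> voutr a = y.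
Proof. by rewrite /voutr => <-; rewrite inverseK. Qed.

(** The hypothesis selects the strands that stop inside [G]. The others go on into [G'] and fall
    under [wire_vnamer]. *)
Lemma wire_vnamel x b : wire G x = inr b -> wire GG (vnamel x) = inr (vinl b).
Proof.
case: x => [i|[e|o]] //.
  have [[j|n] <-] := bij_surj i (alpha_bij G); rewrite wire_alpha // => -[<-].
  rewrite [vnamel _]/= -[alpha G (inl j)]/(alpha GG (inl (inl j))) wire_alpha.
  by congr (inr _); apply/esym/vslE.
move=> -[<-]; rewrite [vnamel _]/= (@valE (inl (inl (inl e)))) //.
by rewrite (@vslE (inl (inl (inl e)))).
Qed.

Lemma wire_vnamer x : wire GG (vnamer x) = sum_map id vinr (wire G' x).
Proof.
case: x => [j|[e|o]]; last first.
- by rewrite [vnamer _]/= (@varE (inr (inl o))).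
- rewrite [vnamer _]/= (@varE (inl (inl (inr e)))) //.
  by rewrite [wire G' _]/= [RHS]/= (@vsrE (inl (inl (inr e)))).
have [e eE] := bij_surj j (beta_bij G); have [f fE] := bij_surj j (alpha_bij G').
rewrite -[vnamer _]/(vnamel (unwire G (inl j))) -[X in unwire G (inl X)]eE
  unwire_beta -[X in wire G' (inl X)]fE.
(* The four cases are the four kinds of glued pairs; in each of them the pair itself is the edge of
   the composite. *)
rewrite wire_alpha; case: e f eE fE => [o|n] [i|n'] eE fE.
- have /eqP-E : beta G (inl o) = alpha G' (inl i) by rewrite eE fE.
  pose p : glueOI G' G := exist _ (o, i) E.
  rewrite [vnamel _]/= (@valE (inl (inr p))) //.
  by rewrite [RHS]/= (@vsrE (inl (inr p))).
- have /eqP-E : beta G (inl o) = alpha G' (inr n') by rewrite eE fE.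
  pose p : glueON G' G := exist _ (o, n') E.
  by rewrite [vnamel _]/= (@valE (inr (inr p))).
- have /eqP-E : beta G (inr n) = alpha G' (inl i) by rewrite eE fE.
  pose p : glueNI G' G := exist _ (n, i) E.
  rewrite [vnamel _]/= -[alpha G (inr n)]/(alpha GG (inl (inr p))) wire_alpha.
  by rewrite [RHS]/= (@vsrE (inr (inr p))).
- have /eqP-E : beta G (inr n) = alpha G' (inr n') by rewrite eE fE.
  pose p : glueNN G' G := exist _ (n, n') E.
  by rewrite [vnamel _]/= -[alpha G (inr n)]/(alpha GG (inr p)) wire_alpha.
Qed.

Lemma vname_cover (x : name GG) :
  (exists y b, vnamel y = x /\ wire G y = inr b) \/ exists y, vnamer y = x.
Proof.
have nlP y : (exists z b, vnamel z = vnamel y /\ wire G z = inr b) \/ exists z,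
  vnamer z = vnamel y.
  case wy: (wire G y) => [j|b]; last by left; exists y, b.
  by right; exists (inl j); rewrite -[vnamer _]/(vnamel (unwire G (inl j))) -wy wireK.
case: x => [i|a]; first exact: (nlP (inl i)).
have <- : inverse (vcat_out_bij G' G) (vcat_out a) = a by rewrite inverseK.
case: (vcat_out a) => a'; first exact: (nlP (inr a')).
by right; exists (inr a').
Qed.

Lemma unwire_vcat j : unwire GG (inl j) = vnamer (unwire G' (inl j)).
Proof. by apply: (can_inj wireK); rewrite wire_vnamer !unwireK. Qed.

Lemma vcat_in_vinl b : vcat_in (vinl b) = inl b. Proof. exact: Kinverse. Qed.
Lemma vcat_in_vinr b : vcat_in (vinr b) = inr b. Proof. exact: Kinverse. Qed.
Lemma vcat_out_voutl b : vcat_out (voutl b) = inl b. Proof. exact: Kinverse. Qed.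
Lemma vcat_out_voutr b : vcat_out (voutr b) = inr b. Proof. exact: Kinverse. Qed.

Lemma vinr_inj : injective vinr.
Proof. by move=> a b e; have := vcat_in_vinr a; rewrite e vcat_in_vinr => -[]. Qed.
Lemma voutl_inj : injective voutl.
Proof. by move=> a b e; have := vcat_out_voutl a; rewrite e vcat_out_voutl => -[]. Qed.

Lemma vnamel_inj : injective vnamel.
Proof. by move=> [i|a] [j|b] //= [] => [->|/voutl_inj->]. Qed.

Lemma vnamer_inj : injective vnamer.
Proof.
move=> x y /(congr1 (wire GG)); rewrite !wire_vnamer => e.
apply: (can_inj wireK); case: (wire G' x) (wire G' y) e => a [b|b] //= [].
  by move->.
by move/vinr_inj->.
Qed.

Lemma vsink_cover b : (exists c, b = vinl c) \/ (exists c, b = vinr c).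
Proof.
have <- : inverse (vcat_in_bij G' G) (vcat_in b) = b by rewrite inverseK.
by case: (vcat_in b) => c; [left | right]; exists c.
Qed.

Lemma vhalf_cover b : (exists c, b = voutl c) \/ (exists c, b = voutr c).
Proof.
have <- : inverse (vcat_out_bij G' G) (vcat_out b) = b by rewrite inverseK.
by case: (vcat_out b) => c; [left | right]; exists c.
Qed.

End WiringOfCompositions.

Arguments vinl {k l m} G' G _.
Arguments vinr {k l m} G' G _.
Arguments voutl {k l m} G' G _.
Arguments voutr {k l m} G' G _.
Arguments vnamel {k l m} G' G x.
Arguments vnamer {k l m} G' G x.


Section WiringOfProducts.
Variables (k l k' l' : nat) (G : graph k l) (G' : graph k' l').
Local Notation GG := (ghcat G G').

Definition hinl (b : hB G) : hB GG := sum_map inl inl b.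
Definition hinr (b : hB G') : hB GG := sum_map inr inr b.
Definition houtl (b : hA G) : hA GG := sum_map inl inl b.
Definition houtr (b : hA G') : hA GG := sum_map inr inr b.

Definition hnamel (x : name G) : name GG := sum_map (@lshift k k') houtl x.
Definition hnamer (x : name G') : name GG := sum_map (@rshift k k') houtr x.

Lemma wire_hnamel x : wire GG (hnamel x) = sum_map (@lshift l l') hinl (wire G x).
Proof.
case: x => [i|[e|o]] //.
have [e <-] := bij_surj i (alpha_bij G); rewrite wire_alpha.
case: e => e.
  by rewrite -[hnamel _]/(inl (alpha GG (inl (inl e)))) wire_alpha.
by rewrite -[hnamel _]/(inl (alpha GG (inr (inl e)))) wire_alpha.
Qed.

Lemma wire_hnamer x : wire GG (hnamer x) = sum_map (@rshift l l') hinr (wire G' x).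
Proof.
case: x => [i|[e|o]] //.
have [e <-] := bij_surj i (alpha_bij G'); rewrite wire_alpha.
case: e => e.
  by rewrite -[hnamer _]/(inl (alpha GG (inl (inr e)))) wire_alpha.
by rewrite -[hnamer _]/(inl (alpha GG (inr (inr e)))) wire_alpha.
Qed.

Lemma hname_cover (x : name GG) : (exists y, x = hnamel y) \/ exists y, x = hnamer y.
Proof.
case: x => [i|[[e|e]|[o|o]]].
- rewrite -[i](splitK i); case: (split i) => j; [left | right].
    by exists (inl j).
  by exists (inl j).
- by left; exists (inr (inl e)).
- by right; exists (inr (inl e)).
- by left; exists (inr (inr o)).
- by right; exists (inr (inr o)).
Qed.

Lemma hsink_cover b : (exists c, b = hinl c) \/ (exists c, b = hinr c).
Proof.
case: b => [[e|e]|[o|o]]; [left | right | left | right].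
- by exists (inl e).
- by exists (inl e).
- by exists (inr o).
- by exists (inr o).
Qed.

Lemma hhalf_cover b : (exists c, b = houtl c) \/ (exists c, b = houtr c).
Proof.
case: b => [[e|e]|[o|o]]; [left | right | left | right].
- by exists (inl e).
- by exists (inl e).
- by exists (inr o).
- by exists (inr o).
Qed.

Lemma unwire_hcatl j : unwire GG (inl (lshift l' j)) = hnamel (unwire G (inl j)).
Proof. by apply: (can_inj wireK); rewrite wire_hnamel !unwireK. Qed.

Lemma unwire_hcatr j : unwire GG (inl (rshift l j)) = hnamer (unwire G' (inl j)).
Proof. by apply: (can_inj wireK); rewrite wire_hnamer !unwireK. Qed.

End WiringOfProducts.

Arguments hinl {k l k' l'} G G' _.
Arguments hinr {k l k' l'} G G' _.
Arguments houtl {k l k' l'} G G' _.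
Arguments houtr {k l k' l'} G G' _.
Arguments hnamel {k l k' l'} G G' x.
Arguments hnamer {k l k' l'} G G' x.

Local Notation dhA G := (hA (underlying G)).
Local Notation dhB G := (hB (underlying G)).
Local Notation dname G := (name (underlying G)).
Local Notation dnode G := (node (underlying G)).
Local Notation dwire G := (wire (underlying G)).
Local Notation dunwire G := (unwire (underlying G)).
Local Notation dinputs G := (inputs (underlying G)).
Local Notation doutputs G := (outputs (underlying G)).

(** * Embeddings of decorated graphs *)

Section Embeddings.
Variables (pl : bool) (X : nat -> nat -> Type).
Implicit Types k l : nat.
Local Notation dgraph := (dgraph pl X).

(** Half-edges go to half-edges, whereas an input of [C] may begin anywhere in [G]; hence [emI]
    takes values among all names. *)
Record emb_data k l k' l' (C : dgraph k' l') (G : dgraph k l) := EmbData {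
  emV : sV C -> sV G;
  emL : sL C -> sL G;
  emA : dhA C -> dhA G;
  emB : dhB C -> dhB G;
  emI : 'I_k' -> dname G }.

Definition emN k l k' l' (C : dgraph k' l') (G : dgraph k l)
    (e : emb_data C G) (x : dname C) : dname G :=
  match x with inl i => emI e i | inr a => inr (emA e a) end.

Definition emVL k l k' l' (C : dgraph k' l') (G : dgraph k l)
    (e : emb_data C G) : dnode C -> dnode G := sum_map (emV e) (emL e).

(** The fields [em_A] and [em_B] make the embedding full at the vertices of [D]: all half-edges
    there come from [C]. The field [em_wire] speaks only of strands that end inside [C], because a
    strand that leaves [C] may continue in [G] in any way. *)
Record is_emb k l k' l' (C : dgraph k' l') (G : dgraph k l)
    (e : emb_data C G) (D : {set dnode G}) (u v : seq (dname G)) : Prop := IsEmb {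
  em_injV : injective (emVL e);
  em_injN : injective (emN e);
  em_D : forall x, x \in D <-> exists y, emVL e y = x;
  em_src : forall a, src G (emA e a) = emV e (src C a);
  em_tgt : forall b, tgt G (emB e b) = emV e (tgt C b);
  em_A : forall a, inl (src G a) \in D -> exists a', emA e a' = a;
  em_B : forall b, inl (tgt G b) \in D -> exists b', emB e b' = b;
  em_dec : forall v, dec G (emV e v) = dec C v;
  em_wire : forall x b, dwire C x = inr b -> dwire G (emN e x) = inr (emB e b);
  em_u : u = codom (emI e);
  em_v : v = codom (fun j : 'I_l' => emN e (dunwire C (inl j)));
  em_leI : forall (h : pl) b b', tgt C b = tgt C b' ->
    leI (planarity C h) b b' = leI (planarity G h) (emB e b) (emB e b');
  em_leO : forall (h : pl) a a', src C a = src C a' ->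
    leO (planarity C h) a a' = leO (planarity G h) (emA e a) (emA e a') }.

Definition Emb k l k' l' (C : dgraph k' l') (G : dgraph k l) D u v : Prop :=
  exists e : emb_data C G, is_emb e D u v.
Arguments Emb {k l k' l'} C G D u v.

Section Facts.
Variables (k l k' l' : nat) (C : dgraph k' l') (G : dgraph k l).
Variables (e : emb_data C G) (D : {set dnode G}) (u v : seq (dname G)).
Hypothesis eP : is_emb e D u v.

Lemma em_injA : injective (emA e).
Proof. by move=> a a' aa; have /(em_injN eP)[] : emN e (inr a) = emN e (inr a') by
  rewrite /= aa. Qed.

Lemma em_injV1 : injective (emV e).
Proof. by move=> a a' aa; have /(em_injV eP)[] : emVL e (inl a) = emVL e (inl a') by
  rewrite /emVL /= aa. Qed.

Lemma em_unwire b : emN e (dunwire C (inr b)) = dunwire G (inr (emB e b)).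
Proof. by rewrite -(em_wire eP (unwireK _)) wireK. Qed.

Lemma em_injB : injective (emB e).
Proof.
move=> b b' bb; have /(em_injN eP) : emN e (dunwire C (inr b)) = emN e
  (dunwire C (inr b')).
  by rewrite !em_unwire bb.
by move/(can_inj unwireK) => -[].
Qed.

Lemma em_memA a : inl (src G (emA e a)) \in D.
Proof. by apply/(em_D eP); exists (inl (src C a)); rewrite (em_src eP). Qed.

Lemma em_memB b : inl (tgt G (emB e b)) \in D.
Proof. by apply/(em_D eP); exists (inl (tgt C b)); rewrite (em_tgt eP). Qed.

Lemma em_memu i : emI e i \in u.
Proof. by rewrite (em_u eP) codom_f. Qed.

End Facts.

(** No feedback: a strand of [u] that started at a vertex of [D] would have two names in a piece on
    [D] with inputs [u], and [emN] would not be injective. *)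
Definition fresh k l (G : dgraph k l) (u : seq (dname G)) (D : {set dnode G}) :=
  forall a, inr a \in u -> inl (src G a) \in D -> False.

Definition consumed k l (G : dgraph k l) (D : {set dnode G}) (x : dname G) : bool :=
  if dwire G x is inr b then inl (tgt G b) \in D else false.

Definition made k l (G : dgraph k l) (D : {set dnode G}) (x : dname G) : bool :=
  if x is inr a then inl (src G a) \in D else false.

(** Exactly the condition for some graph to occur on [D] with ends [u] and [v]: necessary by
    [emb_frontier], sufficient by [frontier_emb]. Strands of [u] that do not end in [D] reappear in
    [v]; they are the input-output edges of the occurring graph. *)
Record frontier k l (G : dgraph k l) (D : {set dnode G}) u v : Prop := Frontier {
  fr_uniqu : uniq u;
  fr_uniqv : uniq v;
  fr_fresh : fresh u D;
  fr_mem : forall x, (x \in v) = ((x \in u) || made D x) && ~~ consumed D x;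
  fr_src : forall b, inl (tgt G b) \in D ->
    (dunwire G (inr b) \in u) || made D (dunwire G (inr b)) }.

(** By fullness an incoming half-edge at [D] comes from [C], and wirings are injective; so a strand
    that leaves [C] cannot end in [D] after all. *)
Lemma emb_consumed k l k' l' (C : dgraph k' l') (G : dgraph k l)
    (e : emb_data C G) D u v y : is_emb e D u v ->
  consumed D (emN e y) = if dwire C y is inr _ then true else false.
Proof.
move=> eP; case wy: (dwire C y) => [j|b]; last first.
  by rewrite /consumed (em_wire eP wy) (em_memB eP).
apply/negP; rewrite /consumed; case wx: (dwire G _) => [//|b] /(em_B eP)[b' bE].
move: wx; rewrite -bE -(em_wire eP (unwireK (inr b'))).
move/(can_inj wireK) => /(em_injN eP) yE; move: wy.
by rewrite yE unwireK.
Qed.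

Lemma emb_frontier k l k' l' (C : dgraph k' l') (G : dgraph k l) D u v :
  Emb C G D u v -> frontier D u v.
Proof.
case=> e eP; have iN := em_injN eP.
have nameE x : (x \in u) || made D x -> exists y, emN e y = x.
  case/orP; first by rewrite (em_u eP) => /codomP[i ->]; exists (inl i).
  by case: x => //= a /(em_A eP)[a' <-]; exists (inr a').
have nameP y : (emN e y \in u) || made D (emN e y).
  case: y => [i|a] /=; first by rewrite (em_memu eP).
  by rewrite (em_memA eP) orbT.
split.
- rewrite (em_u eP); apply/uniq_codom_ord => i j ij.
  by have /iN[] : emN e (inl i) = emN e (inl j).
- rewrite (em_v eP); apply/uniq_codom_ord => i j /iN /(can_inj unwireK).
  by case.
- move=> a; rewrite (em_u eP) => /codomP[i aE] /(em_A eP)[a' a'E].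
  by have /iN : emN e (inr a') = emN e (inl i) by rewrite /= a'E aE.
- move=> x; apply/idP/andP => [|[/nameE[y <-]]].
    by rewrite (em_v eP) => /codomP[j ->]; rewrite nameP (emb_consumed _ eP) unwireK.
  rewrite (emb_consumed _ eP); case wy: (dwire C y) => [j|//] _.
  by rewrite (em_v eP); apply/codomP; exists j; rewrite -wy wireK.
- by move=> b /(em_B eP)[b' <-]; rewrite -(em_unwire eP) nameP.
Qed.

Lemma emb_size k l k' l' (C : dgraph k' l') (G : dgraph k l) D u v :
  Emb C G D u v -> size u = k' /\ size v = l'.
Proof. by case=> e eP; rewrite (em_u eP) (em_v eP) !size_codom_ord. Qed.

(** Both embeddings are injective with the same images on nodes and half-edges, so they differ by
    bijections. The lists [u] and [v] match inputs and outputs position by position, and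
    [wiring_giso] turns the bijections into an isomorphism. *)
Lemma emb_uniq k l k1 l1 k2 l2 (C1 : dgraph k1 l1) (C2 : dgraph k2 l2)
    (G : dgraph k l) D u v :
  Emb C1 G D u v -> Emb C2 G D u v -> dequiv C1 C2.
Proof.
move=> E1 E2; have [s1 s1'] := emb_size E1; have [s2 s2'] := emb_size E2.
have k12 : k2 = k1 by rewrite -s2 s1.
have l12 : l2 = l1 by rewrite -s2' s1'.
clear s1 s1' s2 s2'; subst k2 l2; case: E1 E2 => e eP [f fP].
have [hVL hVL_bij hVLE] : exists2 h : dnode C1 -> dnode C2, bijective h &
    forall x, emVL f (h x) = emVL e x.
  apply: inj_lift (em_injV eP) (em_injV fP) _ _ => x.
    by apply/(em_D fP)/(em_D eP); exists x.
  by apply/(em_D eP)/(em_D fP); exists x.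
have [hV [hL [hV_bij hL_bij hVL_E]]] : exists g h,
    [/\ bijective g, bijective h & hVL =1 sum_map g h].
  apply: sum_map_split => // x.
    by have := hVLE (inl x); case: (hVL _) => // y _; exists y.
  by have := hVLE (inr x); case: (hVL _) => // y _; exists y.
have hVE x : emV f (hV x) = emV e x.
  by have := hVLE (inl x); rewrite hVL_E /= => -[].
have [gA gA_bij gAE] : exists2 h : dhA C1 -> dhA C2, bijective h &
    forall x, emA f (h x) = emA e x.
  apply: inj_lift (em_injA eP) (em_injA fP) _ _ => x.
    exact: em_A fP _ (em_memA eP x).
  exact: em_A eP _ (em_memA fP x).
have [gB gB_bij gBE] : exists2 h : dhB C1 -> dhB C2, bijective h &
    forall x, emB f (h x) = emB e x.
  apply: inj_lift (em_injB eP) (em_injB fP) _ _ => x.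
    exact: em_B fP _ (em_memB eP x).
  exact: em_B eP _ (em_memB fP x).
have hNE (x : dname C1) : emN f (sum_map id gA x : dname C2) = emN e x.
  case: x => [i|a] /=; last by rewrite gAE.
  by apply: codom_ordP; rewrite -(em_u eP) -(em_u fP).
have hwire (x : dname C1) : dwire C2 (sum_map id gA x : dname C2) = sum_map id gB
  (dwire C1 x).
  case wx: (dwire C1 x) => [j|b] /=; last first.
    have := em_wire eP wx; rewrite -hNE -gBE -(em_wire fP (unwireK (inr (gB b)))).
    by move/(can_inj wireK)/(em_injN fP)->; rewrite unwireK.
  have -> : (sum_map id gA x : dname C2) = dunwire C2 (inl j); last by rewrite unwireK.
  apply: (em_injN fP); rewrite hNE -(wireK x) wx.
  apply: (codom_ordP (f := fun j => emN e (dunwire C1 (inl j)))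
                     (g := fun j => emN f (dunwire C2 (inl j)))).
  by rewrite -(em_v eP) -(em_v fP).
have [||g [gV giA giB]] := @wiring_giso _ _ (underlying C1) (underlying C2)
    hV hL gA gB hV_bij hL_bij gA_bij gB_bij _ _ hwire.
- by move=> a; apply: (em_injV1 fP); rewrite hVE -(em_src fP) gAE -(em_src eP).
- by move=> b; apply: (em_injV1 fP); rewrite hVE -(em_tgt fP) gBE -(em_tgt eP).
exists g; split=> [x|h].
  by rewrite -(em_dec fP) gV hVE (em_dec eP).
split=> x y xy; rewrite ?giA ?giB.
- rewrite (em_leI fP) ?gBE; first exact: (em_leI eP).
  by apply: (em_injV1 fP); rewrite -!(em_tgt fP) !gBE !(em_tgt eP) xy.
- rewrite (em_leO fP) ?gAE; first exact: (em_leO eP).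
  by apply: (em_injV1 fP); rewrite -!(em_src fP) !gAE !(em_src eP) xy.
Qed.

End Embeddings.
Arguments Emb {pl X k l k' l'} C G D u v.

(** * Occurrences of composites, products, units and permuted graphs *)

Section EmbeddingOperations.
Variables (pl : bool) (X : nat -> nat -> Type).
Implicit Types k l : nat.
Local Notation dgraph := (dgraph pl X).

Lemma emb_dequiv k l (C G : dgraph k l) : dequiv C G ->
  Emb C G setT (dinputs G) (doutputs G).
Proof.
case=> f [fdec fpl].
exists (@EmbData _ _ _ _ _ _ C G (isoV f) (isoL f)
  (sum_map (isoE f) (isoO f)) (sum_map (isoE f) (isoI f)) inl).
have N_E (x : dname C) : emN (@EmbData _ _ _ _ _ _ C G (isoV f) (isoL f)
    (sum_map (isoE f) (isoO f)) (sum_map (isoE f) (isoI f)) inl) x =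
    sum_map id (sum_map (isoE f) (isoO f)) x by case: x.
have VL_bij := sum_map_bij (isoV_bij f) (isoL_bij f).
have A_bij := sum_map_bij (isoE_bij f) (isoO_bij f).
have B_bij := sum_map_bij (isoE_bij f) (isoI_bij f).
split.
- exact: bij_inj VL_bij.
- move=> x y; rewrite !N_E; apply: bij_inj.
  by apply: sum_map_bij => //; apply: id_bij.
- by move=> x; split=> // _; have [y yE] := bij_surj x VL_bij; exists y.
- by move=> a; apply/esym/(iso_src f).
- by move=> b; apply/esym/(iso_tgt f).
- by move=> a _; have [y yE] := bij_surj a A_bij; exists y.
- by move=> a _; have [y yE] := bij_surj a B_bij; exists y.
- by move=> v; rewrite fdec.
- by move=> x b; rewrite N_E (giso_wire f) => ->.
- by [].
- apply: eq_codom => j; apply: (can_inj wireK).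
  by rewrite N_E (giso_wire f) !unwireK.
- by move=> h b b' bb; have [fI _] := fpl h; apply: fI.
- by move=> h b b' bb; have [_ fO] := fpl h; apply: fO.
Qed.

Lemma emb_refl k l (G : dgraph k l) : Emb G G setT (dinputs G) (doutputs G).
Proof. exact/emb_dequiv/dequiv_refl. Qed.

Lemma emb_trans k l k' l' k'' l'' (C : dgraph k'' l'') (G : dgraph k' l')
    (J : dgraph k l) (e : emb_data G J) D u v D' u' v' :
    is_emb e D u v -> Emb C G D' u' v' ->
  Emb C J (emVL e @: D') (map (emN e) u') (map (emN e) v').
Proof.
move=> eP [f fP]; exists (EmbData (emV e \o emV f) (emL e \o emL f)
  (emA e \o emA f) (emB e \o emB f) (emN e \o emI f)).
set g := EmbData _ _ _ _ _.
have VLE x : emVL g x = emVL e (emVL f x) by case: x.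
have NE x : emN g x = emN e (emN f x) by case: x.
split=> /=.
- by move=> x y; rewrite !VLE => /(em_injV eP)/(em_injV fP).
- by move=> x y; rewrite !NE => /(em_injN eP)/(em_injN fP).
- move=> x; split=> [/imsetP[y /(em_D fP)[z <-] ->]|[z <-]]; first by exists z.
  by rewrite VLE; apply/imset_f/(em_D fP); exists z.
- by move=> a; rewrite (em_src eP) (em_src fP).
- by move=> b; rewrite (em_tgt eP) (em_tgt fP).
- move=> a aD; have [a' aE] : exists a', emA e a' = a.
    apply: (em_A eP); case/imsetP: aD => y _ ->; apply/(em_D eP); by exists y.
  have [|a'' a'E] := em_A fP (a := a'); last by exists a''; rewrite /= a'E.
  by move: aD; rewrite -aE (em_src eP) -[inl _]/(emVL e (inl _)) mem_imset //;
    apply: em_injV eP.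
- move=> b bD; have [b' bE] : exists b', emB e b' = b.
    apply: (em_B eP); case/imsetP: bD => y _ ->; apply/(em_D eP); by exists y.
  have [|b'' b'E] := em_B fP (b := b'); last by exists b''; rewrite /= b'E.
  by move: bD; rewrite -bE (em_tgt eP) -[inl _]/(emVL e (inl _)) mem_imset //;
    apply: em_injV eP.
- by move=> w; rewrite (em_dec eP) (em_dec fP).
- by move=> x b xb; rewrite NE; apply/(em_wire eP)/(em_wire fP).
- by rewrite (em_u fP) /codom /image_mem -map_comp.
- rewrite (em_v fP) /codom /image_mem -(map_comp (emN e)).
  by apply: eq_map => j /=; rewrite NE.
- move=> h b b' bb; rewrite (em_leI fP) // (em_leI eP) //.
  by rewrite !(em_tgt fP) bb.
- move=> h b b' bb; rewrite (em_leO fP) // (em_leO eP) //.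
  by rewrite !(em_src fP) bb.
Qed.

Lemma emb_inputs k l k' l' (G : dgraph k' l') (J : dgraph k l)
    (e : emb_data G J) D u v : is_emb e D u v -> map (emN e) (dinputs G) = u.
Proof. by move=> eP; rewrite (em_u eP) /inputs /codom /image_mem -map_comp. Qed.

Lemma emb_outputs k l k' l' (G : dgraph k' l') (J : dgraph k l)
    (e : emb_data G J) D u v : is_emb e D u v -> map (emN e) (doutputs G) = v.
Proof. by move=> eP; rewrite (em_v eP) /outputs /codom /image_mem -map_comp. Qed.

Lemma emb_setT k l k' l' (G : dgraph k' l') (J : dgraph k l)
    (e : emb_data G J) D u v : is_emb e D u v -> emVL e @: setT = D.
Proof.
move=> eP; apply/setP => x; apply/imsetP/idP => [[y _ ->]|/(em_D eP)[y <-]].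
  by apply/(em_D eP); exists y.
by exists y.
Qed.

(** Composites and products have the same nodes, so this serves both. *)
Lemma sum_emVL k l k1 l1 k2 l2 (G : dgraph k1 l1) (G' : dgraph k2 l2)
    (J : dgraph k l) (e : emb_data G J) (f : emb_data G' J) D1 D2 u v u' v' :
    is_emb e D1 u v -> is_emb f D2 u' v' -> [disjoint D1 & D2] ->
  let h := sum_map (sum_dec (emV e) (emV f)) (sum_dec (emL e) (emL f)) in
  injective h /\ forall x, x \in D1 :|: D2 <-> exists y, h y = x.
Proof.
move=> eP fP dis.
have disF x : x \in D1 -> x \in D2 -> False.
  by move=> x1 x2; move: (disjointFr dis x1); rewrite x2.
have memV1 x : emVL e x \in D1 by apply/(em_D eP); exists x.
have memV2 x : emVL f x \in D2 by apply/(em_D fP); exists x.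
split.
- move=> [[x|x]|[x|x]] [[y|y]|[y|y]] //= [xy].
  + by rewrite (em_injV1 eP xy).
  + by case: (disF (inl (emV e x))); [exact: (memV1 (inl x)) | rewrite xy;
      exact: (memV2 (inl y))].
  + by case: (disF (inl (emV e y))); [exact: (memV1 (inl y)) | rewrite -xy;
      exact: (memV2 (inl x))].
  + by rewrite (em_injV1 fP xy).
  + by have /(em_injV eP)[->] : emVL e (inr x) = emVL e (inr y) by rewrite /emVL /= xy.
  + by case: (disF (inr (emL e x))); [exact: (memV1 (inr x)) | rewrite xy;
      exact: (memV2 (inr y))].
  + by case: (disF (inr (emL e y))); [exact: (memV1 (inr y)) | rewrite -xy;
      exact: (memV2 (inr x))].
  + by have /(em_injV fP)[->] : emVL f (inr x) = emVL f (inr y) by rewrite /emVL /= xy.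
- move=> x; rewrite inE; split=> [/orP[/(em_D eP)|/(em_D fP)] [y <-]|[y <-]].
  + by case: y => y; [exists (inl (inl y)) | exists (inr (inl y))].
  + by case: y => y; [exists (inl (inr y)) | exists (inr (inr y))].
  + case: y => [[y|y]|[y|y]]; apply/orP; [left | right | left | right].
    * exact: (memV1 (inl y)).
    * exact: (memV2 (inl y)).
    * exact: (memV1 (inr y)).
    * exact: (memV2 (inr y)).
Qed.

Section Vertical.
Variables (k l m : nat) (G' : dgraph l m) (G : dgraph k l).
Local Notation GG := (dvcat G' G).
Local Notation vnamel_inj := (@vnamel_inj _ _ _ (underlying G') (underlying G)).
Local Notation vnamer_inj := (@vnamer_inj _ _ _ (underlying G') (underlying G)).
Local Notation vhalf_cover := (@vhalf_cover _ _ _ (underlying G') (underlying G)).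
Local Notation vsink_cover := (@vsink_cover _ _ _ (underlying G') (underlying G)).
Local Notation vname_cover := (@vname_cover _ _ _ (underlying G') (underlying G)).
Local Notation wire_vnamel := (@wire_vnamel _ _ _ (underlying G') (underlying G)).
Local Notation wire_vnamer := (@wire_vnamer _ _ _ (underlying G') (underlying G)).
Local Notation vnamel := (@vnamel _ _ _ (underlying G') (underlying G)).
Local Notation vnamer := (@vnamer _ _ _ (underlying G') (underlying G)).
Local Notation vinl := (@vinl _ _ _ (underlying G') (underlying G)).
Local Notation vinr := (@vinr _ _ _ (underlying G') (underlying G)).
Local Notation voutl := (@voutl _ _ _ (underlying G') (underlying G)).
Local Notation voutr := (@voutr _ _ _ (underlying G') (underlying G)).

Lemma emb_vcatl :
  Emb G GG [set x | match x with inl (inl _) | inr (inl _) => true | _ => false end]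
    (dinputs GG) (map vnamel (doutputs G)).
Proof.
exists (@EmbData _ _ _ _ _ _ G GG inl inl voutl
  vinl inl).
set e := EmbData _ _ _ _ _.
have NE x : emN e x = vnamel x by case: x.
split=> /=.
- by move=> [x|x] [y|y] // [->].
- by move=> x y; rewrite !NE; apply: vnamel_inj.
- move=> x; rewrite inE; split; last by case=> -[y|y] <-.
  by case: x => [[x|x]|[x|x]] // _; [exists (inl x) | exists (inr x)].
- by move=> a; rewrite vcat_out_voutl.
- by move=> a; rewrite vcat_in_vinl.
- move=> a; case: (vhalf_cover a) => -[c ->]; first by exists c.
  by rewrite inE /= vcat_out_voutr.
- move=> a; case: (vsink_cover a) => -[c ->]; first by exists c.
  by rewrite inE /= vcat_in_vinr.
- by [].
- by move=> x b xb; rewrite NE; exact: (wire_vnamel xb).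
- by [].
- rewrite /outputs /codom /image_mem -map_comp.
  by apply: eq_map => j /=; rewrite NE.
- by move=> h b b' bb; rewrite !vcat_in_vinl.
- by move=> h b b' bb; rewrite !vcat_out_voutl.
Qed.

Lemma emb_vcatr :
  Emb G' GG [set x | match x with inl (inr _) | inr (inr _) => true | _ => false end]
    (map vnamel (doutputs G)) (doutputs GG).
Proof.
exists (@EmbData _ _ _ _ _ _ G' GG inr inr voutr
  vinr (fun j => vnamel (dunwire G (inl j)))).
set e := EmbData _ _ _ _ _.
have NE x : emN e x = vnamer x by case: x.
split=> /=.
- by move=> [x|x] [y|y] // [->].
- by move=> x y; rewrite !NE; apply: vnamer_inj.
- move=> x; rewrite inE; split; last by case=> -[y|y] <-.
  by case: x => [[x|x]|[x|x]] // _; [exists (inl x) | exists (inr x)].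
- by move=> a; rewrite vcat_out_voutr.
- by move=> a; rewrite vcat_in_vinr.
- move=> a; case: (vhalf_cover a) => -[c ->]; last by exists c.
  by rewrite inE /= vcat_out_voutl.
- move=> a; case: (vsink_cover a) => -[c ->]; last by exists c.
  by rewrite inE /= vcat_in_vinl.
- by [].
- by move=> x b xb; rewrite NE; apply: etrans (wire_vnamer x) _; rewrite xb.
- by rewrite /outputs /codom /image_mem -map_comp.
- by apply: eq_codom => j; rewrite NE unwire_vcat.
- by move=> h b b' bb; rewrite !vcat_in_vinr.
- by move=> h b b' bb; rewrite !vcat_out_voutr.
Qed.

Lemma emb_vcat k0 l0 (J : dgraph k0 l0) D1 D2 u v w :
    Emb G J D1 u v -> Emb G' J D2 v w -> [disjoint D1 & D2] -> fresh u D2 ->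
  Emb GG J (D1 :|: D2) u w.
Proof.
move=> [e eP] [f fP] dis fr.
have disF x : x \in D1 -> x \in D2 -> False.
  by move=> x1 x2; move: (disjointFr dis x1); rewrite x2.
exists (@EmbData _ _ _ _ _ _ GG J (sum_dec (emV e) (emV f)) (sum_dec (emL e) (emL f))
  (fun a => sum_dec (emA e) (emA f) (vcat_out a))
  (fun a => sum_dec (emB e) (emB f) (vcat_in a)) (emI e)).
set g := EmbData _ _ _ _ _.
have gl x : emN g (vnamel x) = emN e x.
  by case: x => //= a; rewrite vcat_out_voutl.
have gr x : emN g (vnamer x) = emN f x.
  case: x => [j|a]; last by rewrite /= vcat_out_voutr.
  rewrite -[vnamer _]/(vnamel (dunwire G (inl j))) gl /=.
  apply: (codom_ordP (f := fun j => emN e (dunwire G (inl j)))).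
  by rewrite -(em_v eP) (em_u fP).
have g_src a : src J (emA g a) = emV g (src GG a).
  case: (vhalf_cover a) => -[c ->]; rewrite /= ?vcat_out_voutl ?vcat_out_voutr /=.
    exact: em_src eP c.
  exact: em_src fP c.
have g_tgt a : tgt J (emB g a) = emV g (tgt GG a).
  case: (vsink_cover a) => -[c ->]; rewrite /= ?vcat_in_vinl ?vcat_in_vinr /=.
    exact: em_tgt eP c.
  exact: em_tgt fP c.
split=> //.
- exact: (sum_emVL eP fP dis).1.
(* Names of the first factor never meet half-edges of the second: for its inputs by freshness, for
   its half-edges because [D1] and [D2] are disjoint. *)
- have cross (x : dname G) (a : dhA G') : emN e x = emN f (inr a) -> False.
    case: x => [i|b] /= e'.
      by apply: (fr (emA f a)); [rewrite -e' (em_memu eP) | apply: em_memA fP a].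
    case: e' => e'; apply: (disF (inl (src J (emA e b)))); first exact: em_memA eP b.
    by rewrite e'; apply: em_memA fP a.
  have coverN x : (exists y, x = vnamel y) \/
      exists a, x = inr (voutr a).
    case: x => [i|a]; first by left; exists (inl i).
    by case: (vhalf_cover a) => -[c ->]; [left; exists (inr c) | right; exists c].
  move=> x y; case: (coverN x) (coverN y) => -[x' ->] [[y' ->]|[y' ->]].
  + by rewrite !gl => /(em_injN eP)->.
  + by rewrite gl -[inr _]/(vnamer (inr y')) gr => /cross.
  + by rewrite gl -[inr _]/(vnamer (inr x')) gr => /esym/cross.
  + by rewrite -[inr (voutr x')]/(vnamer (inr x'))
      -[inr (voutr y')]/(vnamer (inr y')) !gr => /(em_injN fP)[->].
- exact: (sum_emVL eP fP dis).2.
- move=> a; rewrite inE => /orP[/(em_A eP)|/(em_A fP)] [c <-].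
    by exists (voutl c); rewrite /= vcat_out_voutl.
  by exists (voutr c); rewrite /= vcat_out_voutr.
- move=> a; rewrite inE => /orP[/(em_B eP)|/(em_B fP)] [c <-].
    by exists (vinl c); rewrite /= vcat_in_vinl.
  by exists (vinr c); rewrite /= vcat_in_vinr.
- by case=> x /=; [apply: em_dec eP x | apply: em_dec fP x].
- move=> x b; case: (vname_cover x) => [[y [c [<-]]] yc|[y <-]].
    rewrite (wire_vnamel yc) gl => -[<-].
    by rewrite (em_wire eP yc) /= vcat_in_vinl.
  rewrite wire_vnamer gr; case yc: (dwire G' y) => [//|c] [<-].
  by rewrite (em_wire fP yc) /= vcat_in_vinr.
- exact: em_u eP.
- by rewrite (em_v fP); apply: eq_codom => j; rewrite unwire_vcat gr.
- move=> h b b'.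
  case: (vsink_cover b) (vsink_cover b') => -[c ->] [[c' ->]|[c' ->]];
    rewrite /= ?vcat_in_vinl ?vcat_in_vinr //= => -[cc].
    exact: em_leI eP h _ _ cc.
  exact: em_leI fP h _ _ cc.
- move=> h b b'.
  case: (vhalf_cover b) (vhalf_cover b') => -[c ->] [[c' ->]|[c' ->]];
    rewrite /= ?vcat_out_voutl ?vcat_out_voutr //= => -[cc].
    exact: em_leO eP h _ _ cc.
  exact: em_leO fP h _ _ cc.
Qed.

Lemma emb_vcat_inv k0 l0 (J : dgraph k0 l0) D u w : Emb GG J D u w ->
  exists D1 D2 v, [/\ D = D1 :|: D2, [disjoint D1 & D2], fresh u D,
    Emb G J D1 u v & Emb G' J D2 v w].
Proof.
move=> E; have fr := fr_fresh (emb_frontier E); case: E => e eP.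
have := emb_trans eP emb_vcatr; have := emb_trans eP emb_vcatl.
rewrite (emb_inputs eP) (emb_outputs eP); set D1 := imset _ _; set v := map _ _.
move=> El; set D2 := imset _ _ => Er.
exists D1, D2, v; split=> //.
- rewrite -(emb_setT eP) -imsetU (_ : _ :|: _ = setT) //; apply/setP => x.
  by rewrite !inE; case: x => -[].
- rewrite -setI_eq0 -imsetI; last by move=> x y _ _; exact: (em_injV eP).
  apply/eqP/setP => x; rewrite inE; apply/imsetP => -[y].
  by rewrite !inE; case: y => -[].
Qed.

End Vertical.

Section Horizontal.
Variables (k l k' l' : nat) (G : dgraph k l) (G' : dgraph k' l').
Local Notation GG := (dhcat G G').
Local Notation hnamel := (@hnamel _ _ _ _ (underlying G) (underlying G')).
Local Notation hnamer := (@hnamer _ _ _ _ (underlying G) (underlying G')).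
Local Notation houtl := (@houtl _ _ _ _ (underlying G) (underlying G')).
Local Notation houtr := (@houtr _ _ _ _ (underlying G) (underlying G')).
Local Notation hinl := (@hinl _ _ _ _ (underlying G) (underlying G')).
Local Notation hinr := (@hinr _ _ _ _ (underlying G) (underlying G')).
Local Notation hhalf_cover := (@hhalf_cover _ _ _ _ (underlying G) (underlying G')).
Local Notation hsink_cover := (@hsink_cover _ _ _ _ (underlying G) (underlying G')).
Local Notation hname_cover := (@hname_cover _ _ _ _ (underlying G) (underlying G')).
Local Notation wire_hnamel := (@wire_hnamel _ _ _ _ (underlying G) (underlying G')).
Local Notation wire_hnamer := (@wire_hnamer _ _ _ _ (underlying G) (underlying G')).

Lemma emb_hcatl :
  Emb G GG [set x | match x with inl (inl _) | inr (inl _) => true | _ => false end]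
    (map hnamel (dinputs G)) (map hnamel (doutputs G)).
Proof.
exists (@EmbData _ _ _ _ _ _ G GG inl inl houtl hinl (fun i => inl (lshift k' i))).
set e := EmbData _ _ _ _ _.
have NE x : emN e x = hnamel x by case: x.
split.
- by move=> [x|x] [y|y] // [->].
- move=> x y; rewrite !NE; case: x y => [x|[x|x]] [y|[y|y]] // [].
  + by move/val_inj->.
  + by move->.
  + by move->.
- move=> x; rewrite inE; split; last by case=> -[y|y] <-.
  by case: x => [[x|x]|[x|x]] // _; [exists (inl x) | exists (inr x)].
- by case.
- by case.
- by move=> a; case: (hhalf_cover a) => -[[c|c] ->]; rewrite ?inE // => _;
    [exists (inl c) | exists (inr c)].
- by move=> a; case: (hsink_cover a) => -[[c|c] ->]; rewrite ?inE // => _;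
    [exists (inl c) | exists (inr c)].
- by [].
- by move=> x b xb; rewrite NE; apply: etrans (wire_hnamel x) _; rewrite xb.
- by rewrite /inputs /codom /image_mem -map_comp.
- by rewrite /outputs /codom /image_mem -map_comp; apply: eq_map => j /=; rewrite NE.
- by move=> h [b|b] [b'|b'].
- by move=> h [b|b] [b'|b'].
Qed.

Lemma emb_hcatr :
  Emb G' GG [set x | match x with inl (inr _) | inr (inr _) => true | _ => false end]
    (map hnamer (dinputs G')) (map hnamer (doutputs G')).
Proof.
exists (@EmbData _ _ _ _ _ _ G' GG inr inr houtr hinr (fun i => inl (rshift k i))).
set e := EmbData _ _ _ _ _.
have NE x : emN e x = hnamer x by case: x.
split.
- by move=> [x|x] [y|y] // [->].
- move=> x y; rewrite !NE; case: x y => [x|[x|x]] [y|[y|y]] // [].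
  + by move/addnI/val_inj->.
  + by move->.
  + by move->.
- move=> x; rewrite inE; split; last by case=> -[y|y] <-.
  by case: x => [[x|x]|[x|x]] // _; [exists (inl x) | exists (inr x)].
- by case.
- by case.
- by move=> a; case: (hhalf_cover a) => -[[c|c] ->]; rewrite ?inE // => _;
    [exists (inl c) | exists (inr c)].
- by move=> a; case: (hsink_cover a) => -[[c|c] ->]; rewrite ?inE // => _;
    [exists (inl c) | exists (inr c)].
- by [].
- by move=> x b xb; rewrite NE; apply: etrans (wire_hnamer x) _; rewrite xb.
- by rewrite /inputs /codom /image_mem -map_comp.
- by rewrite /outputs /codom /image_mem -map_comp; apply: eq_map => j /=; rewrite NE.
- by move=> h [b|b] [b'|b'].
- by move=> h [b|b] [b'|b'].
Qed.

Lemma inputs_hcat : dinputs GG = map hnamel (dinputs G) ++ map hnamer (dinputs G').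
Proof. by rewrite /inputs codom_split /codom /image_mem -!map_comp. Qed.

Lemma outputs_hcat : doutputs GG = map hnamel (doutputs G) ++ map hnamer (doutputs G').
Proof.
rewrite /outputs codom_split /codom /image_mem -!map_comp.
congr (_ ++ _); apply: eq_map => j; first exact: unwire_hcatl.
exact: unwire_hcatr.
Qed.

Lemma emb_hcat k0 l0 (J : dgraph k0 l0) D1 D2 u v u' v' :
    Emb G J D1 u v -> Emb G' J D2 u' v' -> [disjoint D1 & D2] ->
    uniq (u ++ u') -> fresh u D2 -> fresh u' D1 ->
  Emb GG J (D1 :|: D2) (u ++ u') (v ++ v').
Proof.
move=> [e eP] [f fP] dis uu fr fr'.
have disF x : x \in D1 -> x \in D2 -> False.
  by move=> x1 x2; move: (disjointFr dis x1); rewrite x2.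
exists (@EmbData _ _ _ _ _ _ GG J (sum_dec (emV e) (emV f)) (sum_dec (emL e) (emL f))
  (fun a => sum_dec (emA e) (emA f) (sum_swap a))
  (fun a => sum_dec (emB e) (emB f) (sum_swap a)) (fcat (emI e) (emI f))).
set g := EmbData _ _ _ _ _.
have gl x : emN g (hnamel x) = emN e x by case: x => [i|[a|a]] //=; rewrite fcatl.
have gr x : emN g (hnamer x) = emN f x by case: x => [i|[a|a]] //=; rewrite fcatr.
have g_src a : src J (emA g a) = emV g (src GG a).
  by case: (hhalf_cover a) => -[[c|c] ->]; [exact: em_src eP (inl c) |
    exact: em_src eP (inr c) | exact: em_src fP (inl c) | exact: em_src fP (inr c)].
have g_tgt a : tgt J (emB g a) = emV g (tgt GG a).
  by case: (hsink_cover a) => -[[c|c] ->]; [exact: em_tgt eP (inl c) |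
    exact: em_tgt eP (inr c) | exact: em_tgt fP (inl c) | exact: em_tgt fP (inr c)].
split=> //.
- exact: (sum_emVL eP fP dis).1.
- have cross x y : emN e x = emN f y -> False.
    case: x y => [i|a] [j|b] /= e'.
    - move: uu; rewrite cat_uniq => /and3P[_ /hasP[]]; exists (emI f j).
        exact: em_memu fP j.
      by rewrite /= -e'; apply: em_memu eP i.
    - by apply: (fr (emA f b)); [rewrite -e' (em_memu eP) | apply: em_memA fP b].
    - by apply: (fr' (emA e a)); [rewrite e' (em_memu fP) | apply: em_memA eP a].
    case: e' => e'; apply: (disF (inl (src J (emA e a)))); first exact: em_memA eP a.
    by rewrite e'; apply: em_memA fP b.
  move=> x y; case: (hname_cover x) (hname_cover y) => -[x' ->] [[y' ->]|[y' ->]].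
  + by rewrite !gl => /(em_injN eP)->.
  + by rewrite gl gr => /cross.
  + by rewrite gl gr => /esym/cross.
  + by rewrite !gr => /(em_injN fP)->.
- exact: (sum_emVL eP fP dis).2.
- move=> a; rewrite inE => /orP[/(em_A eP)|/(em_A fP)] [c <-].
    by exists (houtl c); case: c.
  by exists (houtr c); case: c.
- move=> a; rewrite inE => /orP[/(em_B eP)|/(em_B fP)] [c <-].
    by exists (hinl c); case: c.
  by exists (hinr c); case: c.
- by case=> x /=; [apply: em_dec eP x | apply: em_dec fP x].
- move=> x b; case: (hname_cover x) => -[y ->];
    rewrite ?wire_hnamel ?wire_hnamer ?gl ?gr.
    case yc: (dwire G y) => [//|c] [<-].
    by rewrite (em_wire eP yc); case: c {yc}.
  case yc: (dwire G' y) => [//|c] [<-].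
  by rewrite (em_wire fP yc); case: c {yc}.
- by rewrite codom_fcat (em_u eP) (em_u fP).
- rewrite codom_split (em_v eP) (em_v fP); congr (_ ++ _); apply: eq_codom => j.
    by rewrite /= -gl -unwire_hcatl.
  by rewrite /= -gr -unwire_hcatr.
- move=> h b b'.
  case: (hsink_cover b) (hsink_cover b') => -[c ->] [[c' ->]|[c' ->]];
    case: c c' => c [] c' //= [cc];
    by [exact: em_leI eP h _ _ cc | exact: em_leI fP h _ _ cc].
- move=> h b b'.
  case: (hhalf_cover b) (hhalf_cover b') => -[c ->] [[c' ->]|[c' ->]];
    case: c c' => c [] c' //= [cc];
    by [exact: em_leO eP h _ _ cc | exact: em_leO fP h _ _ cc].
Qed.

Lemma emb_hcat_inv k0 l0 (J : dgraph k0 l0) D y z : Emb GG J D y z ->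
  exists D1 D2 u u' v v', [/\ D = D1 :|: D2, [disjoint D1 & D2],
    y = u ++ u', z = v ++ v' & Emb G J D1 u v /\ Emb G' J D2 u' v'].
Proof.
move=> [e eP].
have := emb_trans eP emb_hcatr; have := emb_trans eP emb_hcatl.
set D1 := imset _ _; set u := map _ _; set v := map _ _ => El.
set D2 := imset _ _; set u' := map _ _; set v' := map _ _ => Er.
exists D1, D2, u, u', v, v'; split=> //.
- rewrite -(emb_setT eP) -imsetU (_ : _ :|: _ = setT) //; apply/setP => x.
  by rewrite !inE; case: x => -[].
- rewrite -setI_eq0 -imsetI; last by move=> x x' _ _; exact: (em_injV eP).
  apply/eqP/setP => x; rewrite inE; apply/imsetP => -[x'].
  by rewrite !inE; case: x' => -[].
- by rewrite -(emb_inputs eP) inputs_hcat map_cat.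
- by rewrite -(emb_outputs eP) outputs_hcat map_cat.
Qed.

End Horizontal.

End EmbeddingOperations.

Section EmbeddingUnits.
Variables (pl : bool) (X : nat -> nat -> Type).
Implicit Types k l : nat.
Local Notation dgraph := (dgraph pl X).

Fixpoint dunitn n : dgraph n n :=
  if n is n'.+1 then dhcat (dunit1 pl X) (dunitn n') else dunit0 pl X.

Section Ambient.
Variables (k l : nat) (J : dgraph k l).
Implicit Types (D : {set dnode J}) (u v : seq (dname J)).

Lemma emb_unit0 : Emb (dunit0 pl X) J set0 [::] [::].
Proof.
exists (@EmbData _ _ _ _ _ _ (dunit0 pl X) J (of_void _) (of_void _)
  (fun a => match a with inl x => of_void _ x | inr x => of_void _ x end)
  (fun a => match a with inl x => of_void _ x | inr x => of_void _ x end)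
  (fun i => of_void _ (match i with Ordinal _ h => False_rect _ (notF h) end))).
split.
- by case=> -[].
- by case=> [[]|[[]|[]]].
- by move=> x; rewrite inE; split=> // -[] [[]|[]].
- by case=> -[].
- by case=> -[].
- by move=> a; rewrite inE.
- by move=> a; rewrite inE.
- by case.
- by case=> [[]|[[]|[]]].
- by apply/esym/size0nil; rewrite size_codom_ord.
- by apply/esym/size0nil; rewrite size_codom_ord.
- by move=> h [[]|[]].
- by move=> h [[]|[]].
Qed.

Lemma emb_unit0_inv D u v : Emb (dunit0 pl X) J D u v ->
  [/\ D = set0, u = [::] & v = [::]].
Proof.
move=> E; have [su sv] := emb_size E; split; try exact: size0nil.
case: E => e eP; apply/setP => x; rewrite inE; apply/negP => /(em_D eP)[].
by case=> -[].
Qed.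

Lemma wire_unit1 x : dwire (dunit1 pl X) x = inl ord0.
Proof. by case: x => [i|[[]|[]]] /=; case: (inverse _ _) => [[]|[]]. Qed.

Lemma emb_unit1 x : Emb (dunit1 pl X) J set0 [:: x] [:: x].
Proof.
exists (@EmbData _ _ _ _ _ _ (dunit1 pl X) J (of_void _) (of_void _)
  (fun a => match a with inl x => of_void _ x | inr x => of_void _ x end)
  (fun a => match a with inl x => of_void _ x | inr x => of_void _ x end)
  (fun i => x)).
have NE y : emN (@EmbData _ _ _ _ _ _ (dunit1 pl X) J (of_void _) (of_void _)
  (fun a => match a with inl x => of_void _ x | inr x => of_void _ x end)
  (fun a => match a with inl x => of_void _ x | inr x => of_void _ x end)
  (fun i => x)) y = x by case: y => [i|[[]|[]]].
have codom1 (f : 'I_1 -> dname J) : codom f = [:: f ord0].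
  by rewrite /codom /image_mem enum_ordSl enum_ord0.
split.
- by case=> -[].
- by move=> [i|[[]|[]]] [j|[[]|[]]]; rewrite [i]ord1 [j]ord1.
- by move=> y; rewrite inE; split=> // -[] [[]|[]].
- by case=> -[].
- by case=> -[].
- by move=> a; rewrite inE.
- by move=> a; rewrite inE.
- by case.
- by move=> y b; rewrite wire_unit1.
- by rewrite codom1.
- by rewrite codom1 NE.
- by move=> h [[]|[]].
- by move=> h [[]|[]].
Qed.

Lemma emb_unit1_inv D u v : Emb (dunit1 pl X) J D u v ->
  exists x, [/\ D = set0, u = [:: x] & v = [:: x]].
Proof.
case=> e eP; exists (emI e ord0).
have codom1 (f : 'I_1 -> dname J) : codom f = [:: f ord0].
  by rewrite /codom /image_mem enum_ordSl enum_ord0.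
split.
- apply/setP => x; rewrite inE; apply/negP => /(em_D eP)[].
  by case=> -[].
- by rewrite (em_u eP) codom1.
- rewrite (em_v eP) codom1 (_ : dunwire _ _ = inl ord0) //.
  by apply: (can_inj wireK); rewrite unwireK wire_unit1.
Qed.

Lemma emb_unitn n u : uniq u -> size u = n -> Emb (dunitn n) J set0 u u.
Proof.
elim: n u => [|n IHn] [|x u] //=; first by move=> _ _; apply: emb_unit0.
move=> /andP[xu uu] [su].
have := emb_hcat (emb_unit1 x) (IHn u uu su); rewrite setU0; apply.
- by rewrite -setI_eq0 setI0.
- by rewrite /= xu.
- by move=> a _; rewrite inE.
- by move=> a _; rewrite inE.
Qed.

Lemma emb_unitn_inv n D u v : Emb (dunitn n) J D u v -> D = set0 /\ v = u.
Proof.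
elim: n D u v => [|n IHn] D u v; first by case/emb_unit0_inv => -> -> ->.
case/(@emb_hcat_inv _ _ 1 1 n n (dunit1 pl X)) =>
  D1 [D2 [u1 [u2 [v1 [v2 [-> _ -> -> [E1 E2]]]]]]].
have [-> ->] := IHn _ _ _ E2; have [x [-> -> ->]] := emb_unit1_inv E1.
by rewrite setU0.
Qed.

End Ambient.

Section Actions.
Variables (k l k' l' : nat) (G : dgraph k' l') (J : dgraph k l).
Implicit Types (D : {set dnode J}) (u v : seq (dname J)).

Lemma wire_dlact (s : 'S_l') x : dwire (dlact G s) x = sum_map s id (dwire G x).
Proof. by case: x => [i|[e|o]] //=; case: (inverse _ _). Qed.

Lemma unwire_dlact (s : 'S_l') j :
  dunwire (dlact G s) (inl j) = dunwire G (inl (s^-1%g j)).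
Proof.
apply: (can_inj (wireK (G := underlying (dlact G s)))).
by rewrite unwireK wire_dlact unwireK /= permKV.
Qed.

Lemma wire_dract (t : 'S_k') x :
  dwire (dract G t) x = dwire G (sum_map t id x).
Proof.
case: x => [i|[e|o]] //.
have [e eE] := bij_surj (t i) (alpha_bij G).
have -> : i = alpha (dract G t) e by rewrite /= eE permK.
rewrite wire_alpha [sum_map _ _ _]/= permKV wire_alpha.
by case: e {eE}.
Qed.

Lemma unwire_dract (t : 'S_k') j :
  dunwire G (inl j) = sum_map t id (dunwire (dract G t) (inl j)).
Proof.
by apply: (can_inj (wireK (G := underlying G))); rewrite -wire_dract !unwireK.
Qed.

Lemma emb_lact (s : 'S_l') D u (f : 'I_l' -> dname J) :
  Emb G J D u (codom f) -> Emb (dlact G s) J D u (codom (f \o s^-1%g)).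
Proof.
case=> e eP.
exists (@EmbData _ _ _ _ _ _ (dlact G s) J (emV e) (emL e) (emA e) (emB e) (emI e)).
case: (eP) => *; split=> //.
- move=> x b; rewrite wire_dlact; case xb: (dwire G x) => [//|c] [<-].
  by have := em_wire eP xb; case: x {xb}.
- apply: eq_codom => j; rewrite unwire_dlact.
  by have /codom_ordP/(_ (s^-1%g j)) := em_v eP.
Qed.

Lemma emb_lact_inv (s : 'S_l') D u w : Emb (dlact G s) J D u w ->
  exists2 f : 'I_l' -> dname J, w = codom (f \o s^-1%g) & Emb G J D u (codom f).
Proof.
case=> e eP.
exists (fun j => emN e (dunwire (dlact G s) (inl (s j)))).
  by rewrite (em_v eP); apply: eq_codom => j /=; rewrite permKV.
exists (@EmbData _ _ _ _ _ _ G J (emV e) (emL e) (emA e) (emB e) (emI e)).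
case: (eP) => *; split=> //.
- move=> x b xb; have xb' : dwire (dlact G s) x = inr b by rewrite wire_dlact xb.
  by have := em_wire eP xb'; case: x {xb xb'}.
- by apply: eq_codom => j; rewrite unwire_dlact permK.
Qed.

Lemma emb_ract (t : 'S_k') D (f : 'I_k' -> dname J) v :
  Emb G J D (codom f) v -> Emb (dract G t) J D (codom (f \o t)) v.
Proof.
case=> e eP.
exists (@EmbData _ _ _ _ _ _ (dract G t) J (emV e) (emL e) (emA e) (emB e)
  (emI e \o t)).
set e' := EmbData _ _ _ _ _.
have NE x : emN e' x = emN e (sum_map t id x) by case: x.
case: (eP) => *; split=> //.
- move=> x y; rewrite !NE => /(em_injN eP).
  exact: bij_inj (sum_map_bij (Bijective (permK t) (permKV t)) (@id_bij _)) _ _.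
- by move=> x b xb; rewrite NE; apply: (em_wire eP); rewrite -wire_dract.
- apply: eq_codom => i /=.
  by have /codom_ordP/(_ (t i)) := em_u eP.
- rewrite (em_v eP); apply: eq_codom => j.
  by rewrite NE -unwire_dract.
Qed.

Lemma emb_ract_inv (t : 'S_k') D w v : Emb (dract G t) J D w v ->
  exists2 f : 'I_k' -> dname J, w = codom (f \o t) & Emb G J D (codom f) v.
Proof.
case=> e eP; exists (emI e \o t^-1%g).
  by rewrite (em_u eP); apply: eq_codom => i /=; rewrite permK.
exists (@EmbData _ _ _ _ _ _ G J (emV e) (emL e) (emA e) (emB e) (emI e \o t^-1%g)).
set e' := EmbData _ _ _ _ _.
have NE x : emN e' (sum_map t id x) = emN e x by case: x => //= i; rewrite permK.
have NE' x : emN e' x = emN e (sum_map t^-1%g id x) by case: x.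
case: (eP) => *; split=> //.
- move=> x y; rewrite !NE' => /(em_injN eP).
  exact: bij_inj (sum_map_bij (Bijective (permKV t) (permK t)) (@id_bij _)) _ _.
- move=> x b xb; rewrite NE'; apply: (em_wire eP); rewrite wire_dract.
  by rewrite (_ : sum_map t id _ = x) //; case: x {xb} => //= i; rewrite permKV.
- rewrite (em_v eP); apply: eq_codom => j.
  by rewrite (unwire_dract t) NE.
Qed.

End Actions.

(** A Yoneda argument: the identity occurrence of [G] in itself becomes an occurrence of [H] with
    the same nodes and ends, and [emb_uniq] applies. One inclusion is enough, and the arities may
    differ in form. *)
Lemma dequivY k l k' l' (G : dgraph k l) (H : dgraph k' l') :
    (forall k0 l0 (J : dgraph k0 l0) D u v, Emb G J D u v -> Emb H J D u v) ->
  dequiv G H.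
Proof. by move=> GH; apply: emb_uniq (emb_refl G) (GH _ _ _ _ _ _ (emb_refl G)). Qed.

End EmbeddingUnits.

Section DisjointUnions.
Variable T : finType.
Implicit Types A B C : {set T}.

Lemma disjointUl A B C :
  [disjoint A :|: B & C] = [disjoint A & C] && [disjoint B & C].
Proof. by rewrite -!setI_eq0 setIUl setU_eq0. Qed.

Lemma disjointUr A B C :
  [disjoint A & B :|: C] = [disjoint A & B] && [disjoint A & C].
Proof. by rewrite -!setI_eq0 setIUr setU_eq0. Qed.

End DisjointUnions.

(** * The axioms of a ProP up to isomorphism of graphs *)

Section DecoratedEquivalences.
Variables (pl : bool) (X : nat -> nat -> Type).
Implicit Types k l : nat.
Local Notation dgraph := (dgraph pl X).

Section Freshness.
Variables (k l : nat) (J : dgraph k l).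
Implicit Types (D : {set dnode J}) (u v : seq (dname J)).

Lemma freshU u D1 D2 : fresh u (D1 :|: D2) <-> fresh u D1 /\ fresh u D2.
Proof.
split=> [fr|[fr1 fr2] a au]; last by rewrite inE => /orP[/fr1|/fr2]; apply.
by split=> a au aD; apply: (fr a au); rewrite inE aD ?orbT.
Qed.

Lemma fresh_cat u v D : fresh (u ++ v) D <-> fresh u D /\ fresh v D.
Proof.
split=> [fr|[fr1 fr2] a]; last by rewrite mem_cat => /orP[/fr1|/fr2].
by split=> a au; apply: fr; rewrite mem_cat au ?orbT.
Qed.

Lemma fresh_sub u v D : {subset v <= u} -> fresh u D -> fresh v D.
Proof. by move=> vu fr a /vu; apply: fr. Qed.

Lemma emb_fresh k' l' (G : dgraph k' l') D1 D2 u v :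
  Emb G J D1 u v -> fresh u D2 -> [disjoint D1 & D2] -> fresh v D2.
Proof.
move=> /emb_frontier fr frD dis a; rewrite (fr_mem fr) => /andP[/orP[]].
  by move=> au _; apply: frD.
by move=> /= a1 _ a2; move: (disjointFr dis a1); rewrite a2.
Qed.

End Freshness.

Section Equivalences.
Variables (k l k' l' k'' l'' m n : nat).

Lemma dequiv_lact1 (G : dgraph k l) : dequiv (dlact G 1%g) G.
Proof.
apply: dequivY => k0 l0 J D u v /emb_lact_inv[f -> E].
by rewrite (_ : codom _ = codom f) //; apply: eq_codom => i /=; rewrite invg1 perm1.
Qed.

Lemma dequiv_ract1 (G : dgraph k l) : dequiv (dract G 1%g) G.
Proof.
apply: dequivY => k0 l0 J D u v /emb_ract_inv[f -> E].
by rewrite (_ : codom _ = codom f) //; apply: eq_codom => i /=; rewrite perm1.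
Qed.

Lemma dequiv_lactM (G : dgraph k l) s s' :
  dequiv (dlact G (permc s s')) (dlact (dlact G s') s).
Proof.
apply: dequivY => k0 l0 J D u v /emb_lact_inv[f -> E].
have := emb_lact s (emb_lact s' E); congr (Emb _ _ _ _ _).
by apply: eq_codom => i /=; rewrite invMg permM.
Qed.

Lemma dequiv_ractM (G : dgraph k l) t t' :
  dequiv (dract G (permc t t')) (dract (dract G t) t').
Proof.
apply: dequivY => k0 l0 J D u v /emb_ract_inv[f -> E].
have := emb_ract t' (emb_ract t E); congr (Emb _ _ _ _ _).
by apply: eq_codom => i /=; rewrite permM.
Qed.

Lemma dequiv_lract (G : dgraph k l) s t :
  dequiv (dlact (dract G t) s) (dract (dlact G s) t).
Proof.
apply: dequivY => k0 l0 J D u v /emb_lact_inv[f ->] /emb_ract_inv[g -> E].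
exact/emb_ract/emb_lact.
Qed.

Lemma dequiv_hcatA (p : dgraph k l) (q : dgraph k' l') (r : dgraph k'' l'') :
  dequiv (dhcat p (dhcat q r)) (dhcat (dhcat p q) r).
Proof.
apply: dequivY => k0 l0 J D y z E0; have fr := emb_frontier E0.
case/emb_hcat_inv: (E0) => D1 [D2 [u [u' [v [v' [DE dis yE zE [E1 E2]]]]]]].
case/emb_hcat_inv: E2 => D3 [D4 [u2 [u3 [v2 [v3 [DE' dis' uE' vE' [E2 E3]]]]]]].
have uy := fr_uniqu fr; have fy := fr_fresh fr; subst.
move: dis uy fy; rewrite disjointUr !catA cat_uniq => /andP[d13 d14].
move=> uy /freshU[f1 /freshU[f3 f4]].
case/fresh_cat: f1 => /fresh_cat[_ f12] f13.
case/fresh_cat: f3 => /fresh_cat[f31 _] f33.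
case/fresh_cat: f4 => /fresh_cat[f41 f42] _.
rewrite setUA; apply: (emb_hcat _ E3).
- by apply: emb_hcat; case/andP: uy.
- by rewrite disjointUl d14.
- by rewrite cat_uniq.
- exact/fresh_cat.
- exact/freshU.
Qed.

Lemma dequiv_hcat0p (p : dgraph k l) : dequiv (dhcat (dunit0 pl X) p) p.
Proof.
apply: dequivY => k0 l0 J D y z.
case/emb_hcat_inv => D1 [D2 [u [u' [v [v' [-> _ -> -> [E1 E2]]]]]]].
by have [-> -> ->] := emb_unit0_inv E1; rewrite set0U.
Qed.

Lemma dequiv_hcatp0 (p : dgraph k l) : dequiv (dhcat p (dunit0 pl X)) p.
Proof.
apply: dequivY => k0 l0 J D y z.
case/emb_hcat_inv => D1 [D2 [u [u' [v [v' [-> _ -> -> [E1 E2]]]]]]].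
by have [-> -> ->] := emb_unit0_inv E2; rewrite setU0 !cats0.
Qed.

Lemma dequiv_vcatA (p : dgraph m n) (q : dgraph l m) (r : dgraph k l) :
  dequiv (dvcat p (dvcat q r)) (dvcat (dvcat p q) r).
Proof.
apply: dequivY => k0 l0 J D y z.
case/emb_vcat_inv => D1 [D2 [v [-> dis /freshU[f1 f2] E0 E3]]].
case/emb_vcat_inv: E0 => D3 [D4 [w [DE dis' _ E1 E2]]]; subst D1.
move: dis f1; rewrite disjointUl => /andP[d32 d42] /freshU[f3 f4].
rewrite -setUA; apply: (emb_vcat E1 _).
- by apply: (emb_vcat E2 E3) => //; apply: (emb_fresh E1).
- by rewrite disjointUr dis'.
- exact/freshU.
Qed.

Lemma dequiv_vcat1p (p : dgraph k l) : dequiv (dvcat (dunitn pl X l) p) p.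
Proof.
apply: dequivY => k0 l0 J D y z.
case/emb_vcat_inv => D1 [D2 [v [-> _ _ E /emb_unitn_inv[-> ->]]]].
by rewrite setU0.
Qed.

Lemma dequiv_vcatp1 (p : dgraph k l) : dequiv (dvcat p (dunitn pl X k)) p.
Proof.
apply: dequivY => k0 l0 J D y z.
case/emb_vcat_inv => D1 [D2 [v [-> _ _ /emb_unitn_inv[-> ->]]]].
by rewrite set0U.
Qed.

Lemma dequiv_hvcat (p : dgraph l m) (p' : dgraph l' n) (q : dgraph k l)
    (q' : dgraph k' l') :
  dequiv (dvcat (dhcat p p') (dhcat q q')) (dhcat (dvcat p q) (dvcat p' q')).
Proof.
apply: dequivY => k0 l0 J D y z E0; have uy := fr_uniqu (emb_frontier E0).
case/emb_vcat_inv: E0 => D0 [D0' [v [-> dis fy E0 E0']]].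
case/emb_hcat_inv: E0 => D1 [D2 [u [u' [w [w' [DE dis' yE vE [E1 E2]]]]]]].
case/emb_hcat_inv: E0' => D3 [D4 [x [x' [z1 [z2 [DE' dis'' vE' -> [E3 E4]]]]]]].
subst; have [[_ sw] [sx _]] := (emb_size E1, emb_size E3).
(* The middle list is cut once by the outputs of the lower product and once by the inputs of the
   upper one. Both first halves have [l] entries, so the cuts coincide. *)
move/eqP: vE'; rewrite eqseq_cat ?sw ?sx // => /andP[/eqP wE /eqP wE'].
subst x x'; move: dis; rewrite disjointUl !disjointUr.
case/andP=> /andP[d13 d14] /andP[d23 d24].
move: fy => /fresh_cat[/freshU[/freshU[f11 f12] /freshU[f13 f14]]].
move=> /freshU[/freshU[f21 f22] /freshU[f23 f24]].
rewrite setUACA; apply: emb_hcat => //.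
- by apply: (emb_vcat E1 E3).
- by apply: (emb_vcat E2 E4).
- by rewrite disjointUl !disjointUr dis' d14 dis'' disjoint_sym d23.
- exact/freshU.
- exact/freshU.
Qed.

Lemma dequiv_lact_vcat (s : 'S_m) (p : dgraph l m) (q : dgraph k l) :
  dequiv (dlact (dvcat p q) s) (dvcat (dlact p s) q).
Proof.
apply: dequivY => k0 l0 J D y z /emb_lact_inv[f ->].
case/emb_vcat_inv => D1 [D2 [v [-> dis /freshU[_ fr] E1 E2]]].
exact: (emb_vcat E1 (emb_lact s E2) dis fr).
Qed.

Lemma dequiv_ract_vcat (t : 'S_k) (p : dgraph l m) (q : dgraph k l) :
  dequiv (dract (dvcat p q) t) (dvcat p (dract q t)).
Proof.
apply: dequivY => k0 l0 J D y z /emb_ract_inv[f ->].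
case/emb_vcat_inv => D1 [D2 [v [-> dis /freshU[_ fr] E1 E2]]].
apply: (emb_vcat (emb_ract t E1) E2 dis); apply: fresh_sub fr => x.
by case/codomP => i ->; apply: codom_f.
Qed.

Lemma dequiv_vcat_act (t : 'S_l) (p : dgraph l m) (q : dgraph k l) :
  dequiv (dvcat (dract p t) q) (dvcat p (dlact q t)).
Proof.
apply: dequivY => k0 l0 J D y z.
case/emb_vcat_inv => D1 [D2 [v [-> dis /freshU[_ fr] E1 E2]]].
case/emb_ract_inv: E2 => f vE E2; subst v.
have := emb_lact t E1; rewrite (_ : codom _ = codom f) => [E1'|].
  exact: (emb_vcat E1' E2 dis fr).
by apply: eq_codom => i /=; rewrite permKV.
Qed.

Lemma emb_hcat_codom (p : dgraph k l) (p' : dgraph k' l') k0 l0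
    (J : dgraph k0 l0) D (f : 'I_(k + k') -> dname J) (g : 'I_(l + l') -> dname J) :
  Emb (dhcat p p') J D (codom f) (codom g) ->
  exists D1 D2 (f1 : 'I_k -> dname J) (f2 : 'I_k' -> dname J) (g1 : 'I_l -> dname J)
    (g2 : 'I_l' -> dname J),
   [/\ D = D1 :|: D2, [disjoint D1 & D2], f =1 fcat f1 f2, g =1 fcat g1 g2 &
    Emb p J D1 (codom f1) (codom g1) /\ Emb p' J D2 (codom f2) (codom g2)].
Proof.
case/emb_hcat_inv => D1 [D2 [u [u' [v [v' [-> dis fE gE [E1 E2]]]]]]].
have [[su sv] [su' sv']] := (emb_size E1, emb_size E2).
move/eqP: fE; rewrite codom_split eqseq_cat ?size_codom_ord //.
case/andP=> /eqP uE /eqP uE'.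
move/eqP: gE; rewrite codom_split eqseq_cat ?size_codom_ord //.
case/andP=> /eqP vE /eqP vE'; subst u u' v v'.
have fcatE i j (h : 'I_(i + j) -> dname J) :
    h =1 fcat (h \o @lshift i j) (h \o @rshift i j).
  by move=> a; rewrite -[in LHS](splitK a) /fcat; case: (split a).
exists D1, D2, (f \o @lshift k k'), (f \o @rshift k k').
by exists (g \o @lshift l l'), (g \o @rshift l l').
Qed.

Lemma dequiv_hcat_lact (s : 'S_l) (s' : 'S_l') (p : dgraph k l) (p' : dgraph k' l') :
  dequiv (dhcat (dlact p s) (dlact p' s')) (dlact (dhcat p p') (perm_tens s s')).
Proof.
apply: dequivY => k0 l0 J D y z E0; have fr := emb_frontier E0.
have uy := fr_uniqu fr; have fy := fr_fresh fr.
case/emb_hcat_inv: E0 => D1 [D2 [u [u' [v [v' [DE dis yE -> [E1 E2]]]]]]].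
case/emb_lact_inv: E1 => f ->; case/emb_lact_inv: E2 => g -> E2 E1; subst.
case/fresh_cat: fy => /freshU[_ f1] /freshU[f2 _].
have := emb_hcat E1 E2 dis uy f1 f2; rewrite -codom_fcat.
move/(emb_lact (perm_tens s s')); congr (Emb _ _ _ _ _).
by rewrite perm_tensV (eq_codom (fcat_perm_tens _ _ _ _)) codom_fcat.
Qed.

Lemma dequiv_hcat_ract (t : 'S_k) (t' : 'S_k') (p : dgraph k l) (p' : dgraph k' l') :
  dequiv (dhcat (dract p t) (dract p' t')) (dract (dhcat p p') (perm_tens t t')).
Proof.
apply: dequivY => k0 l0 J D y z E0; have fr := emb_frontier E0.
have uy := fr_uniqu fr; have fy := fr_fresh fr.
case/emb_hcat_inv: E0 => D1 [D2 [u [u' [v [v' [DE dis yE -> [E1 E2]]]]]]].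
case/emb_ract_inv: E1 => f uE; case/emb_ract_inv: E2 => g uE' E2 E1; subst.
have pE : perm_eq (codom (f \o t) ++ codom (g \o t')) (codom f ++ codom g).
  have pE0 i (h : 'I_i -> dname J) (r : 'S_i) : perm_eq (codom (h \o r)) (codom h).
    rewrite /codom /image_mem [map (h \o r) _]map_comp; apply: perm_map.
    apply: uniq_perm; rewrite ?enum_uniq //.
      by rewrite map_inj_uniq ?enum_uniq //; apply: perm_inj.
    move=> x; rewrite mem_enum; apply/mapP; exists (r^-1%g x); rewrite ?mem_enum //.
    by rewrite permKV.
  by apply: perm_cat; apply: pE0.
have [f1 f2] : fresh (codom f) D2 /\ fresh (codom g) D1.
  have /fresh_cat[/freshU[_ ?] /freshU[? _]] //: fresh (codom f ++ codom g) (D1 :|: D2).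
  by apply: fresh_sub fy => x; rewrite (perm_mem pE).
rewrite (perm_uniq pE) in uy.
have := emb_hcat E1 E2 dis uy f1 f2; rewrite -codom_fcat.
move/(emb_ract (perm_tens t t')); congr (Emb _ _ _ _ _).
by rewrite (eq_codom (fcat_perm_tens _ _ _ _)) codom_fcat.
Qed.

Definition dcast (ek : k = k') (el : l = l') (G : dgraph k l) : dgraph k' l' :=
  ecast i (dgraph i l') ek (ecast j (dgraph k j) el G).

(** Since [Emb] accepts all arities, casts are invisible to it. *)
Lemma emb_dcast ek el (G : dgraph k l) k0 l0 (J : dgraph k0 l0) D u v :
  Emb (dcast ek el G) J D u v <-> Emb G J D u v.
Proof. by rewrite /dcast; case: _ / ek; case: _ / el. Qed.

End Equivalences.

Lemma dequiv_hcatC k l k' l' (p : dgraph k l) (p' : dgraph k' l') :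
  dequiv (dlact (dhcat p p') (perm_swap l l'))
    (dract (dcast (addnC k' k) (addnC l' l) (dhcat p' p)) (perm_swap k k')).
Proof.
apply: dequivY => k0 l0 J D y z E0; have fr := emb_frontier E0.
have uy := fr_uniqu fr; have fy := fr_fresh fr.
case/emb_lact_inv: E0 => f -> E0.
have [g yE] : exists g : 'I_(k + k') -> dname J, y = codom g.
  by have [s _] := emb_size E0; rewrite -s; apply: codom_ordW.
subst y; case/emb_hcat_codom: E0 => D1 [D2 [g1 [g2 [f1 [f2 [DE dis gE fE [E1 E2]]]]]]].
subst D; rewrite (eq_codom gE) in uy fy *.
have -> : codom (f \o (perm_swap l l')^-1%g) = codom f2 ++ codom f1.
  by rewrite -codom_swap; apply: eq_codom => i /=; rewrite fE.
have -> : codom (fcat g1 g2) =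
    codom ((fcat g1 g2 \o (perm_swap k k')^-1%g) \o perm_swap k k').
  by apply: eq_codom => i /=; rewrite permK.
rewrite codom_fcat in uy fy; case/fresh_cat: fy => /freshU[_ ?] /freshU[? _].
apply/emb_ract/emb_dcast; rewrite codom_swap setUC; apply: emb_hcat => //.
- by rewrite disjoint_sym.
- by rewrite uniq_catC.
Qed.

End DecoratedEquivalences.

(** * Graphs form a ProP *)

Section LinearMaps.
Variables (K : fieldType) (V W : lmodType K).
Implicit Types f g : V -> W.

Lemma lin0 f : linear f -> f 0 = 0.
Proof. by move=> fL; have := fL (-1) 0 0; rewrite scaler0 addr0 scaleN1r addNr. Qed.

Lemma linD f : linear f -> forall x y, f (x + y) = f x + f y.
Proof. by move=> fL x y; have := fL 1 x y; rewrite !scale1r. Qed.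

Lemma linZ f : linear f -> forall a x, f (a *: x) = a *: f x.
Proof. by move=> fL a x; have := fL a x 0; rewrite !addr0 lin0 // addr0. Qed.

Lemma linear_comp (U : lmodType K) f (h : U -> V) :
  linear f -> linear h -> linear (f \o h).
Proof. by move=> fL hL a x y /=; rewrite hL fL. Qed.

Lemma linear_id : linear (@id V). Proof. by []. Qed.

End LinearMaps.

Lemma malgUZ (K : fieldType) (T : choiceType) (a : K) (c : T) :
  << a *g c >> = a *: << c >>.
Proof. by apply/malgP => d; rewrite mcoeffZ !mcoeffU mulrnAr mulr1. Qed.

Section GraphPropAxioms.
Variables (pl : bool) (K : fieldType) (X : nat -> nat -> Type).
Local Notation Gr := (gr_prop pl K X).
Local Notation gen := (@gen pl K X _ _).

Lemma gen_span k l (x : Gr k l) : x \in span (fun x => exists G, x = gen G).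
Proof.
rewrite [x]monalgE; apply: rpred_sum => c _.
rewrite malgUZ rpredZ //.
by apply: span_gen; exists (grepr c); rewrite /Defs.gen greprK.
Qed.

(** All the axioms are multilinear, so this reduces them to isomorphisms between graphs. *)
Lemma gr_ext k l (W : lmodType K) (f g : Gr k l -> W) :
  linear f -> linear g -> (forall G, f (gen G) = g (gen G)) -> f =1 g.
Proof.
move=> fL gL fg x; move: x (gen_span x); apply: span_ind.
- by rewrite !lin0.
- by move=> x y fx fy; rewrite !linD // fx fy.
- by move=> a _ [G ->]; rewrite !linZ // fg.
Qed.

Lemma gen_dequiv k l (G H : dgraph pl X k l) : dequiv G H -> gen G = gen H.
Proof. by move=> GH; congr (mkmalgU _ _); apply/gclassP. Qed.

Lemma smod_cast_linear (M : smod K) k l k' l' (ek : k = k') (el : l = l') :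
  linear (@smod_cast K M k l k' l' ek el).
Proof. by subst k' l'. Qed.

Lemma smod_cast_gen k l k' l' (ek : k = k') (el : l = l') (G : dgraph pl X k l) :
  smod_cast (M := Gr) ek el (gen G) = gen (dcast ek el G).
Proof. by subst k' l'. Qed.

Lemma dequiv_dcast k l k' l' (ek : k = k') (el : l = l') (G : dgraph pl X k l)
    (H : dgraph pl X k' l') : dequiv G H -> dequiv (dcast ek el G) H.
Proof. by subst k' l'. Qed.

Lemma gr_lact_linear k l (s : 'S_l) : linear (@lact K Gr k l s).
Proof. exact: lext_is_linear. Qed.

Lemma gr_ract_linear k l (t : 'S_k) : linear (fun x : Gr k l => ract x t).
Proof. exact: lext_is_linear. Qed.

Lemma gr_hcatl k l k' l' (q : Gr k' l') : linear (fun p : Gr k l => hcat p q).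
Proof. exact: lext2_linl. Qed.

Lemma gr_hcatr k l k' l' (p : Gr k l) : linear (fun q : Gr k' l' => hcat p q).
Proof. exact: lext2_linr. Qed.

Lemma gr_vcatl k l m (q : Gr k l) : linear (fun p : Gr l m => vcat p q).
Proof. exact: lext2_linl. Qed.

Lemma gr_vcatr k l m (p : Gr l m) : linear (fun q : Gr k l => vcat p q).
Proof. exact: lext2_linr. Qed.

Lemma gr_unitn n : unitn Gr n = gen (dunitn pl X n).
Proof.
elim: n => // n IHn; apply: etrans (congr1 (hcat (unit1 Gr)) IHn) _.
exact: (hcat_gen K (dunit1 pl X) (dunitn pl X n)).
Qed.

Let lact_c k l (s : 'S_l) (V : lmodType K) (h : V -> Gr k l) :
  linear h -> linear (fun x => lact s (h x)).
Proof. exact/linear_comp/gr_lact_linear. Qed.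
Let ract_c k l (s : 'S_k) (V : lmodType K) (h : V -> Gr k l) :
  linear h -> linear (fun x => ract (h x) s).
Proof. exact/linear_comp/gr_ract_linear. Qed.
Let hcatl_c k l k' l' (q : Gr k' l') (V : lmodType K) (h : V -> Gr k l) :
  linear h -> linear (fun x => hcat (h x) q).
Proof. exact/linear_comp/gr_hcatl. Qed.
Let hcatr_c k l k' l' (p : Gr k l) (V : lmodType K) (h : V -> Gr k' l') :
  linear h -> linear (fun x => hcat p (h x)).
Proof. exact/linear_comp/gr_hcatr. Qed.
Let vcatl_c k l m (q : Gr k l) (V : lmodType K) (h : V -> Gr l m) :
  linear h -> linear (fun x => vcat (h x) q).
Proof. exact/linear_comp/gr_vcatl. Qed.
Let vcatr_c k l m (p : Gr l m) (V : lmodType K) (h : V -> Gr k l) :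
  linear h -> linear (fun x => vcat p (h x)).
Proof. exact/linear_comp/gr_vcatr. Qed.
Let cast_c k l k' l' (ek : k = k') (el : l = l') (V : lmodType K) (h : V -> Gr k l) :
  linear h -> linear (fun x => smod_cast ek el (h x)).
Proof. exact/linear_comp/smod_cast_linear. Qed.

(** Linearity in one variable of a term built from the operations, by recursion on the term. *)
Ltac lin_tac := match goal with
  | |- GRing.linear_for _ (fun x => x) => exact: linear_id
  | |- GRing.linear_for _ (@lact _ _ _ _ _) => exact: gr_lact_linear
  | |- GRing.linear_for _ (hcat _) => exact: gr_hcatr
  | |- GRing.linear_for _ (vcat _) => exact: gr_vcatr
  | |- GRing.linear_for _ (smod_cast _ _) => exact: smod_cast_linear
  | |- GRing.linear_for _ (fun x => lact _ (@?h x)) => refine (@lact_c _ _ _ _ h _);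
    lin_tac
  | |- GRing.linear_for _ (fun x => ract (@?h x) _) => refine (@ract_c _ _ _ _ h _);
    lin_tac
  | |- GRing.linear_for _ (fun x => hcat (@?h x) ?q) =>
    refine (@hcatl_c _ _ _ _ q _ h _); lin_tac
  | |- GRing.linear_for _ (fun x => hcat ?p (@?h x)) =>
    refine (@hcatr_c _ _ _ _ p _ h _); lin_tac
  | |- GRing.linear_for _ (fun x => vcat (@?h x) ?q) =>
    refine (@vcatl_c _ _ _ q _ h _); lin_tac
  | |- GRing.linear_for _ (fun x => vcat ?p (@?h x)) =>
    refine (@vcatr_c _ _ _ p _ h _); lin_tac
  | |- GRing.linear_for _ (fun x => smod_cast _ _ (@?h x)) =>
    refine (@cast_c _ _ _ _ _ _ _ h _); lin_tac
  end.

Ltac ext x := move: x; apply: gr_ext; [lin_tac | lin_tac | move=> x].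

Lemma gr_is_smod : is_smod Gr.
Proof.
split.
- exact: gr_lact_linear.
- exact: gr_ract_linear.
- by move=> k l x; ext x; rewrite [LHS]lact_gen; apply/gen_dequiv/dequiv_lact1.
- by move=> k l x; ext x; rewrite [LHS]ract_gen; apply/gen_dequiv/dequiv_ract1.
- move=> k l s s' x; ext x; rewrite !lact_gen.
  exact/gen_dequiv/dequiv_lactM.
- move=> k l s s' x; ext x; rewrite !ract_gen.
  exact/gen_dequiv/dequiv_ractM.
- move=> k l s t x; ext x; rewrite !(lact_gen, ract_gen).
  exact/gen_dequiv/dequiv_lract.
Qed.

Theorem gr_is_prop : is_prop Gr.
Proof.
split.
- exact: gr_is_smod.
- by move=> *; apply: gr_hcatl.
- by move=> *; apply: gr_hcatr.
- by move=> *; apply: gr_vcatl.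
- by move=> *; apply: gr_vcatr.
- move=> k l k' l' k'' l'' p q r; ext p; ext q; ext r.
  rewrite !hcat_gen smod_cast_gen; apply/gen_dequiv/dequiv_dcast.
  exact: dequiv_hcatA.
- move=> k l p; ext p; rewrite [LHS]hcat_gen.
  exact/gen_dequiv/dequiv_hcat0p.
- move=> k l p; ext p; rewrite [hcat _ _]hcat_gen smod_cast_gen.
  exact/gen_dequiv/dequiv_dcast/dequiv_hcatp0.
- move=> k l m n p q r; ext p; ext q; ext r; rewrite !vcat_gen.
  exact/gen_dequiv/dequiv_vcatA.
- move=> k l p; ext p; rewrite gr_unitn vcat_gen.
  exact/gen_dequiv/dequiv_vcat1p.
- move=> k l p; ext p; rewrite gr_unitn vcat_gen.
  exact/gen_dequiv/dequiv_vcatp1.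
- move=> k l m k' l' m' p p' q q'; ext p; ext p'; ext q; ext q'.
  rewrite !(hcat_gen, vcat_gen).
  exact/gen_dequiv/dequiv_hvcat.
- move=> k l m s p q; ext p; ext q; rewrite !(vcat_gen, lact_gen).
  exact/gen_dequiv/dequiv_lact_vcat.
- move=> k l m s p q; ext p; ext q; rewrite !(vcat_gen, ract_gen).
  exact/gen_dequiv/dequiv_ract_vcat.
- move=> k l m s p q; ext p; ext q; rewrite !(lact_gen, ract_gen) !vcat_gen.
  exact/gen_dequiv/dequiv_vcat_act.
- move=> k l k' l' s s' p p'; ext p; ext p'.
  rewrite !lact_gen !hcat_gen lact_gen.
  exact/gen_dequiv/dequiv_hcat_lact.
- move=> k l k' l' s s' p p'; ext p; ext p'.
  rewrite !ract_gen !hcat_gen ract_gen.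
  exact/gen_dequiv/dequiv_hcat_ract.
- move=> k l k' l' p p'; ext p; ext p'.
  rewrite !hcat_gen smod_cast_gen lact_gen ract_gen.
  exact/gen_dequiv/dequiv_hcatC.
Qed.

End GraphPropAxioms.

(** * Induced subgraphs *)

Section SubGraph.
Variables (pl : bool) (X : nat -> nat -> Type).
Local Notation dgraph := (dgraph pl X).
Variables (k0 l0 : nat) (J : dgraph k0 l0) (D : {set dnode J}).
Variables (k l : nat) (f : 'I_k -> dname J) (g : 'I_l -> dname J).
Hypothesis fr : frontier D (codom f) (codom g).

Definition subV : finType := {x : sV J | inl x \in D}.
Definition subL : finType := {x : sL J | inr x \in D}.
(** Edges of the induced graph are strands of [J] sorted by their two ends relative to [D]. An
    internal edge of [J] with only its source in [D] thus becomes an output edge, and one with only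
    its target in [D] an input edge. *)
Definition subE : finType := {a : dhA J | (inl (src J a) \in D) && consumed D (inr a)}.
Definition subO : finType := {a : dhA J | (inl (src J a) \in D) && ~~ consumed D
  (inr a)}.
Definition subI : finType := {i : 'I_k | consumed D (f i)}.
Definition subIO : finType := {i : 'I_k | ~~ consumed D (f i)}.
Definition sub_shape := Shape subV subE subI subO subIO subL.

Fact consumer_subproof x : consumed D x ->
  exists b, dwire J x = inr b /\ inl (tgt J b) \in D.
Proof. by rewrite /consumed; case: (dwire J x) => [//|b] bD; exists b. Qed.

Definition consumer x (h : consumed D x) := sval (cid (consumer_subproof h)).

Lemma consumer_wire x (h : consumed D x) : dwire J x = inr (consumer h).
Proof. by have [] := svalP (cid (consumer_subproof h)). Qed.

Lemma consumer_in x (h : consumed D x) : inl (tgt J (consumer h)) \in D.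
Proof. by have [] := svalP (cid (consumer_subproof h)). Qed.

Definition sub_A (e : subE + subO) : dhA J :=
  match e with inl a => val a | inr a => val a end.

Fact sub_E_consumed (a : subE) : consumed D (inr (val a)).
Proof. by case: a => a /= /andP[]. Qed.

Definition sub_B (e : subE + subI) : dhB J :=
  match e with
  | inl a => consumer (sub_E_consumed a)
  | inr i => consumer (valP i : consumed D (f (val i)))
  end.

Fact sub_A_in e : inl (src J (sub_A e)) \in D.
Proof. by case: e => -[a /= /andP[]]. Qed.

Fact sub_B_in e : inl (tgt J (sub_B e)) \in D.
Proof. by case: e => a; apply: consumer_in. Qed.

Let f_inj : injective f.
Proof. by apply/uniq_codom_ord; apply: fr_uniqu fr. Qed.

Let g_inj : injective g.
Proof. by apply/uniq_codom_ord; apply: fr_uniqv fr. Qed.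

Lemma sub_A_inj : injective sub_A.
Proof.
move=> [a|a] [b|b] /= ab; try by rewrite (val_inj ab).
  by case/andP: (valP b) => _ /negP[]; rewrite -[val b]ab; apply: sub_E_consumed.
by case/andP: (valP a) => _ /negP[]; rewrite [val a]ab; apply: sub_E_consumed.
Qed.

Lemma sub_f_fresh i a : f i = inr a -> inl (src J a) \in D -> False.
Proof. by move=> fi; apply: (fr_fresh fr); rewrite -fi codom_f. Qed.

Lemma sub_B_inj : injective sub_B.
Proof.
have wireB e : dwire J (match e with inl a => inr (val a) | inr i => f (val i) end) =
    inr (sub_B e) by case: e => a; apply: consumer_wire.
move=> x y xy; have /(can_inj wireK) := etrans (wireB x)
  (etrans (congr1 inr xy) (esym (wireB y))).
case: x y {xy} => x [y|y].
- by case=> /val_inj->.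
- by move/esym/sub_f_fresh; case; case/andP: (valP x).
- by move/sub_f_fresh; case; case/andP: (valP y).
- by move/f_inj/val_inj->.
Qed.

Lemma sub_A_onto a : inl (src J a) \in D -> exists e, sub_A e = a.
Proof.
move=> aD; case ca: (consumed D (inr a)).
  have h : (inl (src J a) \in D) && consumed D (inr a) by rewrite aD ca.
  by exists (inl (exist _ a h)).
have h : (inl (src J a) \in D) && ~~ consumed D (inr a) by rewrite aD ca.
by exists (inr (exist _ a h)).
Qed.

(** The strand that ends at [b] is listed in the inputs or made in [D], by [fr_src]; it is then in
    [subI] or in [subE]. So a vertex of [D] keeps its whole incoming side. *)
Lemma sub_B_onto b : inl (tgt J b) \in D -> exists e, sub_B e = b.
Proof.
move=> bD; have cb : consumed D (dunwire J (inr b)) by rewrite /consumed unwireK.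
have uniq_b x (h : consumed D x) : x = dunwire J (inr b) -> consumer h = b.
  by move=> xb; have := consumer_wire h; rewrite [in LHS]xb unwireK => -[].
case/orP: (fr_src fr bD) => [/codomP[i iE]|].
  have h : consumed D (f i) by rewrite -iE.
  by exists (inr (exist _ i h)); apply: uniq_b; rewrite iE.
move: cb; case uE: (dunwire J (inr b)) => [//|a] /= cb aD.
have h : (inl (src J a) \in D) && consumed D (inr a) by rewrite aD cb.
by exists (inl (exist _ a h)); apply: uniq_b; rewrite uE.
Qed.

Definition sub_src (e : sE sub_shape + sO sub_shape) : sV sub_shape :=
  exist _ (src J (sub_A e)) (sub_A_in e).
Definition sub_tgt (e : sE sub_shape + sI sub_shape) : sV sub_shape :=
  exist _ (tgt J (sub_B e)) (sub_B_in e).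
Definition sub_alpha (e : sI sub_shape + sIO sub_shape) : 'I_k :=
  match e with inl i => val i | inr i => val i end.

Definition sub_out (e : sO sub_shape + sIO sub_shape) : dname J :=
  match e with inl a => inr (val a) | inr i => f (val i) end.

Fact sub_out_in e : exists j, g j = sub_out e.
Proof.
have : sub_out e \in codom g.
  rewrite (fr_mem fr); case: e => -[x h] /=.
    by move: h => /andP[-> ->]; rewrite orbT.
  by rewrite codom_f h.
by case/codomP => j ->; exists j.
Qed.

Definition sub_beta e : 'I_l := sval (cid (sub_out_in e)).

Lemma sub_betaP e : g (sub_beta e) = sub_out e.
Proof. exact: svalP (cid (sub_out_in e)). Qed.

Fact sub_alpha_bij : bijective sub_alpha.
Proof.
apply: surj_inj_bij => [|i].
  move=> [a|a] [b|b] /= ab; try by rewrite (val_inj ab).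
    by case/negP: (valP b); rewrite -[val b]ab; apply: (valP a).
  by case/negP: (valP a); rewrite [val a]ab; apply: (valP b).
case ci: (consumed D (f i)); first by exists (inl (exist _ i ci)).
by move/negbT: ci => ci; exists (inr (exist _ i ci)).
Qed.

Fact sub_beta_bij : bijective sub_beta.
Proof.
apply: surj_inj_bij => [x y /(congr1 g)|j].
  rewrite !sub_betaP; case: x y => x [y|y] /=.
  - by case=> /val_inj->.
  - by move/esym/sub_f_fresh; case; case/andP: (valP x).
  - by move/sub_f_fresh; case; case/andP: (valP y).
  - by move/f_inj/val_inj->.
have := codom_f g j; rewrite (fr_mem fr) => /andP[/orP[/codomP[i jE]|jD] jc].
  have h : ~~ consumed D (f i) by rewrite -jE.
  by exists (inr (exist _ i h)); apply: g_inj; rewrite sub_betaP.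
case jE: (g j) jD jc => [//|a] /= aD ac.
have h : (inl (src J a) \in D) && ~~ consumed D (inr a) by rewrite aD ac.
by exists (inl (exist _ a h)); apply: g_inj; rewrite sub_betaP jE.
Qed.

Definition sub_str : graph_on sub_shape k l :=
  GraphOn sub_src sub_tgt sub_alpha_bij sub_beta_bij.

Fact card_sub_half (A B : finType) (h : A -> B) (s : B -> sV J) (P : pred A)
    (x : sV J) : injective h -> (forall b, s b = x -> exists a, h a = b) ->
  (forall a, P a = (s (h a) == x)) -> #|P| = #|[pred b | s b == x]|.
Proof.
move=> h_inj h_onto PE; rewrite -(card_image h_inj); apply: eq_card => b.
rewrite inE; apply/imageP/eqP => [[a]|bx].
  by rewrite unfold_in PE => /eqP ha ->.
by have [a ab] := h_onto b bx; exists a; rewrite ?ab // unfold_in PE ab bx.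
Qed.

Fact sub_decP (v : sV sub_shape) :
  tag (dec J (val v)) = (indeg sub_str v, outdeg sub_str v).
Proof.
rewrite decP; congr (_, _); apply/esym.
  apply: (card_sub_half sub_B_inj) => [b bx|e]; last by rewrite /= -val_eqE.
  by apply: sub_B_onto; rewrite bx; apply: valP v.
apply: (card_sub_half sub_A_inj) => [b bx|e]; last by rewrite /= -val_eqE.
by apply: sub_A_onto; rewrite bx; apply: valP v.
Qed.

Fact sub_order (A B : finType) (h : A -> B) (s : B -> sV J) (t : A -> subV)
    (r : rel B) : injective h -> (forall a, val (t a) = s (h a)) ->
    (forall v, total_order_on [pred b | s b == v] r) ->
  forall v, total_order_on [pred a | t a == v] (relpre h r).
Proof.
move=> h_inj tE ord_r v; have [r1 r2 r3 r4] := ord_r (val v).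
have tE' a : (t a == v) = (s (h a) == val v) by rewrite -tE val_eqE.
split.
- by move=> a; rewrite inE tE' => av; apply: r1.
- by move=> a b; rewrite !inE !tE' => av bv ab; apply/h_inj/r2.
- by move=> b a c; rewrite !inE !tE' => bv av cv; apply: r3.
- by move=> a b; rewrite !inE !tE' => av bv; apply: r4.
Qed.

Definition sub_planar (h : pl) : planar sub_str :=
  @Planar _ _ _ sub_str (relpre sub_B (leI (planarity J h)))
    (relpre sub_A (leO (planarity J h)))
    (@sub_order _ _ sub_B (tgt J) sub_tgt _ sub_B_inj (fun e => erefl)
      (leI_order (planarity J h)))
    (@sub_order _ _ sub_A (src J) sub_src _ sub_A_inj (fun e => erefl)
      (leO_order (planarity J h))).

Definition sub_graph : dgraph k l :=
  DGraph (@DGraphOn pl X _ _ _ sub_str (fun v => dec J (val v)) sub_decP sub_planar).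

Lemma sub_graph_emb : Emb sub_graph J D (codom f) (codom g).
Proof.
exists (@EmbData _ _ _ _ _ _ sub_graph J val val sub_A sub_B f).
set e := EmbData _ _ _ _ _.
have wireE x b : dwire sub_graph x = inr b -> dwire J (emN e x) = inr (sub_B b).
  case: x => [i|[a|a]] //; last by case=> <-; apply: consumer_wire.
  have [[j|n] <-] := bij_surj i (alpha_bij sub_graph); last by rewrite wire_alpha.
  by rewrite wire_alpha => -[<-]; apply: consumer_wire.
split=> //.
- by move=> [x|x] [y|y] //= [/val_inj->].
- move=> [x|x] [y|y] /=.
  + by move/f_inj->.
  + by move/sub_f_fresh; case; apply: sub_A_in.
  + by move/esym/sub_f_fresh; case; apply: sub_A_in.
  + by case=> /sub_A_inj->.
- move=> x; split=> [|[[y|y] <-]]; [|exact: (valP y)|exact: (valP y)].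
  by case: x => x xD; [exists (inl (exist _ x xD)) | exists (inr (exist _ x xD))].
- exact: sub_A_onto.
- exact: sub_B_onto.
- apply: eq_codom => j; have [x <-] := bij_surj j (beta_bij sub_graph).
  rewrite unwire_beta -[beta _ _]/(sub_beta x) sub_betaP.
  by case: x.
Qed.

End SubGraph.

Lemma frontier_emb (pl : bool) (X : nat -> nat -> Type) k l (J : dgraph pl X k l)
    (D : {set node (underlying J)}) (u v : seq (name (underlying J))) :
  frontier D u v -> exists C : dgraph pl X (size u) (size v), Emb C J D u v.
Proof.
have [f uE] := codom_ordW u; have [g vE] := codom_ordW v.
move: (size u) (size v) f g uE vE => m n f g -> -> fr.
by exists (sub_graph fr); apply: sub_graph_emb.
Qed.

(** * Indecomposability and strong connectivity *)

Section StrongConnectivity.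
Variables (pl : bool) (X : nat -> nat -> Type).
Local Notation dgraph := (dgraph pl X).

Section Ambient.
Variables (k l : nat) (J : dgraph k l).
Implicit Types (D : {set dnode J}) (u v w : seq (dname J)).

Definition pred_closed D D0 : Prop := D0 \subset D /\
  forall a b, dwire J (inr a) = inr b -> inl (tgt J b) \in D0 ->
    inl (src J a) \in D -> inl (src J a) \in D0.

(** Strong connectivity expressed by the absence of a proper initial part, which is the form that
    decompositions give and use; no path has to be handled. A loop has no half-edge, so a strongly
    connected set containing one is that loop alone. *)
Definition sconn D : Prop := D != set0 /\
  forall D0, pred_closed D D0 -> D0 = set0 \/ D0 = D.

Lemma madeU D1 D2 (x : dname J) : made (D1 :|: D2) x = made D1 x || made D2 x.
Proof. by case: x => //= a; rewrite inE. Qed.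

Lemma consumedU D1 D2 (x : dname J) :
  consumed (D1 :|: D2) x = consumed D1 x || consumed D2 x.
Proof. by rewrite /consumed; case: (dwire J x) => //= a; rewrite inE. Qed.

Lemma consumed_disjoint D1 D2 (x : dname J) :
  [disjoint D1 & D2] -> consumed D1 x -> consumed D2 x = false.
Proof.
by rewrite /consumed => dis; case: (dwire J x) => //= b; apply: disjointFr dis.
Qed.

Lemma subset_disjointU D D0 : D0 \subset D ->
  D = D0 :|: (D :\: D0) /\ [disjoint D0 & D :\: D0].
Proof.
move=> sub; rewrite -[in LHS](setID D D0) (setIidPr sub); split=> //.
by rewrite -setI_eq0 setIDA setIC -setIDA setDv setI0.
Qed.

Definition boundary u D : seq (dname J) :=
  [seq x <- enum (dname J) | ((x \in u) || made D x) && ~~ consumed D x].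

Lemma mem_boundary u D x :
  (x \in boundary u D) = ((x \in u) || made D x) && ~~ consumed D x.
Proof. by rewrite mem_filter mem_enum andbT. Qed.

Lemma boundary_uniq u D : uniq (boundary u D).
Proof. by rewrite filter_uniq ?enum_uniq. Qed.

(** No strand runs from the rest of [D] back to the initial part [D0], so [D] can be cut between the
    two, and the strands met by the cut are [boundary u D0]. *)
Lemma frontier_split D D0 u v : frontier D u v -> pred_closed D D0 ->
  frontier D0 u (boundary u D0) /\ frontier (D :\: D0) (boundary u D0) v.
Proof.
move=> fr [sub pc]; have [DE dis] := subset_disjointU sub.
move: fr DE dis pc; set D1 := D :\: D0 => fr DE dis pc.
have pc1 x : made D1 x -> consumed D0 x = false.
  move=> m1; apply/negP; rewrite /consumed; case wx: (dwire J x) => [//|b] bD.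
  case: x m1 wx => //= a aD wx; have := pc _ _ wx bD.
  by rewrite DE inE aD orbT => /(_ isT) a0; rewrite (disjointFr dis a0) in aD.
split; split.
- exact: fr_uniqu fr.
- exact: boundary_uniq.
- by move=> a au aD; apply: (fr_fresh fr au); apply: (subsetP sub).
- exact: mem_boundary.
- move=> b bD; have bD' : inl (tgt J b) \in D by apply: (subsetP sub).
  case/orP: (fr_src fr bD') => [->//|].
  case bE: (dunwire J (inr b)) => [//|a] /= aD; apply/orP; right.
  by apply: pc bD aD; rewrite -bE unwireK.
- exact: boundary_uniq.
- exact: fr_uniqv fr.
- move=> a; rewrite mem_boundary => /andP[/orP[au|/= a0] _] a1.
    by apply: (fr_fresh fr au); rewrite DE inE a1 orbT.
  by rewrite (disjointFr dis a0) in a1.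
- move=> x; rewrite (fr_mem fr) mem_boundary DE madeU consumedU.
  case m1: (made D1 x); last by rewrite !orbF negb_or !andbA.
  by rewrite (pc1 _ m1) !orbT.
- move=> b bD; have bD' : inl (tgt J b) \in D by rewrite DE inE bD orbT.
  move: (fr_src fr bD'); rewrite DE madeU mem_boundary.
  have -> : consumed D0 (dunwire J (inr b)) = false.
    by rewrite /consumed unwireK (disjointFl dis bD).
  by rewrite andbT orbA.
Qed.

(** Setting aside the strands that merely pass by [D] leaves an occurrence without input-output
    edges, as indecomposability demands. *)
Lemma frontier_core D w v : frontier D w v ->
  let ins := filter (consumed D) w in
  let rest := filter (predC (consumed D)) w in
  let outs := filter (made D) v in
  [/\ frontier D ins outs, perm_eq w (ins ++ rest) & perm_eq (outs ++ rest) v].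
Proof.
move=> fr ins rest outs.
have uw := fr_uniqu fr; have uv := fr_uniqv fr.
have w_made x : x \in w -> made D x = false.
  case: x => //= a aw; apply/negP; exact: fr_fresh fr a aw.
split.
- split.
  + by rewrite filter_uniq.
  + by rewrite filter_uniq.
  + apply: fresh_sub (fr_fresh fr) => x; by rewrite mem_filter => /andP[].
  + move=> x; rewrite !mem_filter (fr_mem fr).
    case mx: (made D x); first by rewrite !orbT.
    by rewrite /= orbF; case: (consumed D x) => //; rewrite andbF.
  + move=> b bD; rewrite mem_filter.
    have -> : consumed D (dunwire J (inr b)) by rewrite /consumed unwireK.
    exact: fr_src fr b bD.
- by rewrite perm_sym; apply/permPl/perm_filterC.
- apply: uniq_perm => //.
    rewrite cat_uniq !filter_uniq // andbT /=; apply/hasPn => x.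
    rewrite !mem_filter => /andP[_ xw]; by rewrite (w_made _ xw).
  move=> x; rewrite mem_cat !mem_filter (fr_mem fr) /=.
  case xw: (x \in w); first by rewrite (w_made _ xw) andbT.
  by rewrite andbF orbF andbA andbb.
Qed.

Lemma frontier_embed D u v k' l' : frontier D u v -> size u = k' -> size v = l' ->
  exists C : dgraph k' l', Emb C J D u v.
Proof. by move=> fr <- <-; apply: frontier_emb. Qed.

End Ambient.

Section EmbeddedSubgraphs.
Variables (k l k' l' : nat) (C : dgraph k' l') (J : dgraph k l).
Variables (D : {set dnode J}) (u v : seq (dname J)).

Lemma emb_sconn : Emb C J D u v -> sconn [set: dnode C] -> sconn D.
Proof.
case=> e eP [C0 Cmin]; split.
  case/set0Pn: C0 => x _; apply/set0Pn; exists (emVL e x).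
  by apply/(em_D eP); exists x.
move=> D0 [sub pc].
have [|D0E|D0E] := Cmin [set x | emVL e x \in D0].
- split; first exact: subsetT.
  move=> a b wab; rewrite !inE => bD _; have := em_wire eP wab.
  move/pc; rewrite (em_tgt eP) (em_src eP); apply=> //.
  by rewrite -(em_src eP); apply: em_memA eP a.
- left; apply/setP => x; rewrite inE; apply/negP => xD.
  have /(em_D eP)[y yE] := subsetP sub x xD.
  by have := in_set0 y; rewrite -D0E inE yE xD.
- right; apply/eqP; rewrite eqEsubset sub; apply/subsetP => x /(em_D eP)[y <-].
  by have := in_setT y; rewrite -D0E inE.
Qed.

Lemma sconn_emb : Emb C J D u v -> sconn D -> sconn [set: dnode C].
Proof.
case=> e eP [D0 Dmin]; split.
  case/set0Pn: D0 => x /(em_D eP)[y _]; apply/set0Pn; by exists y.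
move=> C0 [_ pc]; have VLin x : (emVL e x \in emVL e @: C0) = (x \in C0).
  by rewrite mem_imset //; apply: (em_injV eP).
have [|CE|CE] := Dmin (emVL e @: C0).
- split; first by apply/subsetP => _ /imsetP[x _ ->]; apply/(em_D eP); exists x.
  move=> a b wab bC aD; have [a' aE] := em_A eP aD; subst a.
  have [b' bE] : exists b', emB e b' = b.
    by apply: (em_B eP); case/imsetP: bC => y _ ->; apply/(em_D eP); exists y.
  subst b; move: bC; rewrite (em_src eP) (em_tgt eP).
  rewrite -[inl _]/(emVL e (inl (tgt C b'))) -[inl (emV e (src _ _))]/(emVL e
    (inl (src C a'))).
  rewrite !VLin => bC; apply: pc bC (in_setT _).
  have := em_unwire eP b'; rewrite -wab wireK -[inr (emA e a')]/(emN e (inr a')).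
  by move/(em_injN eP) <-; rewrite unwireK.
- by left; apply/setP => x; rewrite -VLin CE !inE.
- right; apply/setP => x; rewrite -VLin CE inE; apply/(em_D eP); by exists x.
Qed.

Lemma emb_noIO : Emb C J D u v ->
  #|sIO C| = 0%N <-> (forall x, x \in u -> consumed D x).
Proof.
case=> e eP; split=> [IO0 x|uc].
  rewrite (em_u eP) => /codomP[i ->].
  rewrite -[emI e i]/(emN e (inl i)) (emb_consumed _ eP).
  have [[j|n] <-] := bij_surj i (alpha_bij (underlying C)); rewrite wire_alpha //.
  by have := fintype0 n; rewrite IO0 => /(_ erefl).
apply: eq_card0 => n; apply/negP => _.
have := uc _ (em_memu eP (alpha (underlying C) (inr n))).
by rewrite -[emI e _]/(emN e (inl _)) (emb_consumed _ eP) wire_alpha.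
Qed.

End EmbeddedSubgraphs.

Section Indecomposability.
Variables (k l : nat) (C : dgraph k l).

(** A predecessor-closed [D0] cuts [C] into a vertical composite, one factor of which has no vertex.
    Loops are absent unless [C] is a single loop, which has only one node; so [D0] is empty or
    everything. *)
Lemma indecomposable_sconn : indecomposable (underlying C) -> sconn [set: dnode C].
Proof.
case=> V1 _ L1 decV _.
have node1 : single_loop (underlying C) ->
    exists x : dnode C, forall y : dnode C, y = x.
  case=> V0 _ _ _ [_ /eqP L1']; have /card_gt0P[x _] : (0 < #|sL C|)%N by rewrite
    (eqP L1').
  exists (inr x) => -[v|y]; first by have := fintype0 v; rewrite V0 => /(_ erefl).
  by have /fintype_le1P/(_ x y)-> : (#|sL C| <= 1)%N by rewrite (eqP L1').
split.
  apply/set0Pn; case: V1 => [/eqP|/node1[x _]]; last by exists x.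
  by rewrite -lt0n => /card_gt0P[v _]; exists (inl v).
move=> D0 pc; case: L1 => [L0|/node1[x xE]]; last first.
  have [->|/set0Pn[y]] := eqVneq D0 set0; first by left.
  rewrite (xE y) => xD; right; apply/setP => z.
  by rewrite (xE z) xD inE.
have frC := emb_frontier (emb_refl C).
have [fr0 fr1] := frontier_split frC pc.
have [_ dis] := subset_disjointU (subsetT D0).
have [DE _] := subset_disjointU (subsetT D0).
have [G'' E''] := frontier_embed fr0 (size_codom_ord _) erefl.
have [G' E'] := frontier_embed fr1 erefl (size_codom_ord _).
have E : Emb (dvcat G' G'') C setT (dinputs C) (doutputs C).
  by rewrite DE; apply: (emb_vcat E'' E' dis) => a /codomP[].
have := decV _ _ _ (dequiv_gequiv (emb_uniq (emb_refl C) E)).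
have emptyL (x : sL C) : False by have := fintype0 x; rewrite L0 => /(_ erefl).
case=> V0; [right | left]; apply/setP => -[v|x]; try by case: (emptyL x).
- rewrite [RHS]in_setT; apply/negPn/negP => vD; case: E' => e eP.
  have /(em_D eP)[[y|y] //= _] : inl v \in setT :\: D0 by rewrite inE vD inE.
    by have := fintype0 y; rewrite V0 => /(_ erefl).
- rewrite inE; apply/negP => vD; case: E'' => e eP.
  have /(em_D eP)[[y|y] //= _] := vD.
  by have := fintype0 y; rewrite V0 => /(_ erefl).
Qed.

(** Edges of a composite never go from the upper factor to the lower one, and edges of a product
    stay inside a factor. Either way the nodes of one factor form a predecessor-closed set, and one
    of the factors is empty. *)
Lemma sconn_indecomposable :
  sconn [set: dnode C] -> #|sIO C| = 0%N -> indecomposable (underlying C).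
Proof.
move=> [/set0Pn[x0 _] Cmin] IO0.
have split0 (P : pred (dnode C)) :
    (forall e, P (inl (tgt C (inl e))) -> P (inl (src C (inl e)))) ->
    (forall x, ~~ P x) \/ (forall x, P x).
  move=> Pe; have [|DE|DE] := Cmin [set x | P x].
  - split; first exact: subsetT.
    move=> a b; case: a => [e|o] //= [<-]; rewrite !inE => pe _; exact: Pe.
  - by left=> x; have := in_set0 x; rewrite -DE inE => ->.
  - by right=> x; have := in_setT x; rewrite -DE inE.
have noV (T : finType) : (T -> False) -> #|T| = 0%N.
  by move=> T0; apply: eq_card0 => x; case: (T0 x).
(* A loop by itself is predecessor-closed, hence it is the only node, and without vertices there are
   no edges other than input-output ones. *)
have loopP : (exists x : sL C, True) -> single_loop (underlying C).
  move=> [x _]; have [|/(_ (inr x))|xE] := split0 (pred1 (inr x)).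
  - by [].
  - by move/negP; case; apply/eqP.
  have V0 : sV C -> False by move=> v; have := xE (inl v).
  split; first exact: noV.
  - by apply: noV => e; apply: V0; apply: (src C (inl e)).
  - by apply: noV => e; apply: V0; apply: (tgt C (inr e)).
  - by apply: noV => e; apply: V0; apply: (src C (inr e)).
  split=> //; apply/eqP; rewrite (@eq_card _ _ (pred1 x)) ?card1 // => y.
  by have /eqP[->] := xE (inr y); rewrite unfold_in /=; apply/esym/eqP.
have V_or : #|sV C| <> 0%N \/ single_loop (underlying C).
  case: x0 => [v|x]; last by right; apply: loopP; exists x.
  left=> V0; by have := fintype0 v; rewrite V0 => /(_ erefl).
split=> //.
- have [L0|] := eqVneq #|sL C| 0%N; first by left.
  by rewrite -lt0n => /card_gt0P[x _]; right; apply: loopP; exists x.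
- move=> m G' G'' [f].
  pose P (x : dnode C) : bool :=
    match sum_map (isoV f) (isoL f) x with
    | inl (inl _) | inr (inl _) => true | _ => false end.
  have [e|P0|P1] := split0 P.
  + have := iso_src f (inl e); have := iso_tgt f (inl e).
    rewrite /P /=; case: (isoE f e) => [[e1|e1]|p] /= -> -> //.
  + right; apply: noV => v; have [x xE] := bij_surj (inl v) (isoV_bij f).
    by have := P0 (inl x); rewrite /P /= xE.
  + left; apply: noV => v; have [x xE] := bij_surj (inr v) (isoV_bij f).
    by have := P1 (inl x); rewrite /P /= xE.
- move=> k1 l1 k2 l2 G' G'' s t [f].
  pose P (x : dnode C) : bool :=
    match sum_map (isoV f) (isoL f) x with
    | inl (inl _) | inr (inl _) => true | _ => false end.
  have [e|P0|P1] := split0 P.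
  + have := iso_src f (inl e); have := iso_tgt f (inl e).
    rewrite /P /=; case: (isoE f e) => e1 /= -> -> //.
  + left; apply: noV => v; have [x xE] := bij_surj (inl v) (isoV_bij f).
    by have := P0 (inl x); rewrite /P /= xE.
  + right; apply: noV => v; have [x xE] := bij_surj (inr v) (isoV_bij f).
    by have := P1 (inl x); rewrite /P /= xE.
Qed.

End Indecomposability.

End StrongConnectivity.

(** * Runs *)

Section Runs.
Variables (pl : bool) (X : nat -> nat -> Type) (K : fieldType) (P : prop_data K).
Variable f : forall k l, dgraph pl X k l -> P k l.
Local Notation dgraph := (dgraph pl X).

(** In a step the component [C] consumes [i] and produces [o] while the strands [r] are idle. The
    permutations around it let each step list its strands in any order, so nothing in a run depends
    on a chosen order of strands or of components. *)
Inductive Run k l (J : dgraph k l) :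
    {set dnode J} -> seq (dname J) -> seq (dname J) -> arrow P -> Prop :=
| Run_perm u v : uniq u -> perm_eq u v -> Run set0 u v (lperm P u v)
| Run_step D D' u w v k' l' (C : dgraph k' l') i o r a :
    Run D u w a -> perm_eq w (i ++ r) -> perm_eq (o ++ r) v ->
    Emb C J D' i o -> indecomposable (underlying C) ->
    [disjoint D & D'] -> fresh u D' ->
  Run (D :|: D') u v (acomp (lperm P (o ++ r) v)
    (acomp (atens (arr (f C)) (aid P (size r))) (acomp (lperm P w (i ++ r)) a))).

Lemma emb_ahom k l k' l' (C : dgraph k' l') (J : dgraph k l) D i o :
  Emb C J D i o -> ahom i o (arr (f C)).
Proof. by move/emb_size => [si so]; split; rewrite ?si ?so. Qed.

Lemma step_ahom k l k' l' (C : dgraph k' l') (J : dgraph k l) D i o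
    (r : seq (dname J)) :
  Emb C J D i o -> ahom (i ++ r) (o ++ r) (atens (arr (f C)) (aid P (size r))).
Proof. by move/emb_ahom => h; apply: ahom_tens h (ahom_id _ _). Qed.

Lemma run_ahom k l (J : dgraph k l) D u v a : @Run k l J D u v a -> ahom u v a.
Proof.
elim=> [u' v' _ uv|D1 D' u' w v' k' l' C i o r b _ bh wE vE EC _ _ _].
  exact: ahom_lperm.
apply: ahom_comp (ahom_lperm _ vE); apply: ahom_comp (step_ahom r EC).
exact: ahom_comp bh (ahom_lperm _ wE).
Qed.

Lemma run_inv k l (J : dgraph k l) D u v a : @Run k l J D u v a ->
  [/\ D = set0, uniq u, perm_eq u v & a = lperm P u v] \/
  exists D0 D1 w k' l' (C : dgraph k' l') i o r b,
    [/\ D = D0 :|: D1, Run D0 u w b, perm_eq w (i ++ r), perm_eq (o ++ r) v &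
    [/\ Emb C J D1 i o, indecomposable (underlying C), [disjoint D0 & D1], fresh u D1 &
      a = acomp (lperm P (o ++ r) v) (acomp (atens (arr (f C)) (aid P (size r)))
            (acomp (lperm P w (i ++ r)) b))]].
Proof.
case=> [u' v' uu uv|D1 D' u' w v' k' l' C i o r b rb wE vE EC iC dis fr].
  by left.
by right; exists D1, D', w, k', l', C, i, o, r, b.
Qed.

End Runs.

(** * Runs evaluated in the ProP of graphs *)

Section GraphArrows.
Variables (pl : bool) (X : nat -> nat -> Type) (K : fieldType).
Local Notation dgraph := (dgraph pl X).
Local Notation Gr := (gr_prop pl K X).
Variables (k l : nat) (J : dgraph k l).
Implicit Types (D : {set dnode J}) (u v w : seq (dname J)).

Definition emb_arrow D u v (a : arrow Gr) : Prop :=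
  exists k' l' (G : dgraph k' l'), a = arr (gen K G : Gr k' l') /\ Emb G J D u v.

Lemma emb_arrow_comp D1 D2 u v w a b :
    emb_arrow D1 u v a -> emb_arrow D2 v w b -> [disjoint D1 & D2] -> fresh u D2 ->
  emb_arrow (D1 :|: D2) u w (acomp b a).
Proof.
case=> k1 [l1 [G1 [-> E1]]] [k2 [l2 [G2 [-> E2]]]] dis fr.
have [[_ s1] [s2 _]] := (emb_size E1, emb_size E2).
have e : k2 = l1 by rewrite -s1 s2.
clear s1 s2; subst k2; exists k1, l2, (dvcat G2 G1); split;
  last exact: (emb_vcat E1 E2 dis fr).
by rewrite acomp_arr vcat_gen.
Qed.

Lemma emb_arrow_tens D1 D2 u v u' v' a b :
    emb_arrow D1 u v a -> emb_arrow D2 u' v' b -> [disjoint D1 & D2] ->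
    uniq (u ++ u') -> fresh u D2 -> fresh u' D1 ->
  emb_arrow (D1 :|: D2) (u ++ u') (v ++ v') (atens a b).
Proof.
case=> k1 [l1 [G1 [-> E1]]] [k2 [l2 [G2 [-> E2]]]] dis uu fr fr'.
exists (k1 + k2)%N, (l1 + l2)%N, (dhcat G1 G2); split.
  by rewrite -hcat_gen.
exact: emb_hcat.
Qed.

Lemma fresh_set0 u : fresh u set0.
Proof. by move=> a _; rewrite inE. Qed.

Lemma emb_arrow_id u : uniq u -> emb_arrow set0 u u (aid Gr (size u)).
Proof.
move=> uu; exists (size u), (size u), (dunitn pl X (size u)); split.
  by rewrite /aid gr_unitn.
exact: emb_unitn.
Qed.

Lemma emb_arrow_perm u v : uniq u -> perm_eq u v ->
  emb_arrow set0 u v (lperm Gr u v).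
Proof.
move=> uu uv; have [n [g [s [g_inj uE vE]]]] := codom_ord_perm uu uv.
exists n, n, (dlact (dunitn pl X n) s); rewrite uE vE; split.
  by rewrite lpermE // /aperm gr_unitn lact_gen.
by apply/emb_lact/emb_unitn; [apply/uniq_codom_ord | rewrite size_codom_ord].
Qed.

(** With the graphs themselves as values, a run computes the graph that occurs on the nodes it has
    visited. *)
Lemma run_emb D u v a : Run (P := Gr) (@gen pl K X) D u v a -> emb_arrow D u v a.
Proof.
elim=> [u' v' uu uv|D1 D' u' w v' k' l' C i o r b rb IH wE vE EC _ dis fr].
  exact: emb_arrow_perm.
have [k1 [l1 [G1 [_ E1]]]] := IH; have fr1 := emb_frontier E1.
have uir : uniq (i ++ r) by rewrite -(perm_uniq wE); apply: fr_uniqv fr1.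
have frw : fresh w D' by apply: emb_fresh E1 fr dis.
have fri : fresh r D'.
  by apply: fresh_sub frw => x xr; rewrite (perm_mem wE) mem_cat xr orbT.
have EC' : emb_arrow D' i o (arr (gen K C : Gr k' l')) by exists k', l', C.
have Er : emb_arrow (D' :|: set0) (i ++ r) (o ++ r)
    (atens (arr (gen K C : Gr k' l')) (aid Gr (size r))).
  apply: emb_arrow_tens => //.
  - by apply: emb_arrow_id; move: uir; rewrite cat_uniq => /and3P[].
  - by rewrite -setI_eq0 setI0.
  - exact: fresh_set0.
have Ew : emb_arrow (D1 :|: set0) u' (i ++ r) (acomp (lperm Gr w (i ++ r)) b).
  apply: (emb_arrow_comp IH).
  - by apply: emb_arrow_perm => //; apply: fr_uniqv fr1.
  - by rewrite -setI_eq0 setI0.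
  - exact: fresh_set0.
rewrite !setU0 in Er Ew.
have Eo : emb_arrow (D1 :|: D') u' (o ++ r) _ := emb_arrow_comp Ew Er dis fr.
have uor : uniq (o ++ r).
  by have [? [? [? [_ /emb_frontier/fr_uniqv]]]] := Eo.
rewrite -[D1 :|: D']setU0; apply: (emb_arrow_comp Eo).
- exact: emb_arrow_perm.
- by rewrite -setI_eq0 setI0.
- exact: fresh_set0.
Qed.

(** Only the last index of [Run] depends on [P], so the same steps can be evaluated in [Gr]. The
    frontier conditions for runs in [P] follow from this. *)
Lemma run_gr (P : prop_data K) (f : forall k l, dgraph k l -> P k l) D u v a :
  Run f D u v a -> exists b, Run (P := Gr) (@gen pl K X) D u v b.
Proof.
elim=> [u' v' uu uv|D1 D' u' w v' k' l' C i o r b rb [c IH] wE vE EC iC dis fr].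
  by exists (lperm Gr u' v'); apply: Run_perm.
by eexists; apply: Run_step IH wE vE EC iC dis fr.
Qed.

Lemma run_embed (P : prop_data K) (f : forall k l, dgraph k l -> P k l) D u v a :
  Run f D u v a -> exists k' l' (G : dgraph k' l'), Emb G J D u v.
Proof.
move=> /run_gr[b /run_emb[k' [l' [G [_ E]]]]].
by exists k', l', G.
Qed.

Lemma run_frontier (P : prop_data K) (f : forall k l, dgraph k l -> P k l) D u v a :
  Run f D u v a -> frontier D u v.
Proof. by move/run_embed=> [k' [l' [G /emb_frontier]]]. Qed.

End GraphArrows.

(** * Existence of runs *)

Section RunTotal.
Variables (pl : bool) (X : nat -> nat -> Type) (K : fieldType) (P : prop_data K).
Variable f : forall k l, dgraph pl X k l -> P k l.
Local Notation dgraph := (dgraph pl X).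
Variables (k l : nat) (J : dgraph k l).
Implicit Types (D : {set dnode J}) (u v w : seq (dname J)).

(** Take a proper initial part of maximal size. An initial part of the complement could be added to
    it, so by maximality the complement has none but the trivial ones: it is a component that can
    come last. *)
Lemma pred_closed_max D : D != set0 ->
  exists D0, [/\ pred_closed D D0, D0 != D & sconn (D :\: D0)].
Proof.
move=> Dn0; pose Q D0 := `[< pred_closed D D0 /\ D0 <> D >].
have Q0 : Q set0.
  apply/asboolP; split; last by move=> e; rewrite -e eqxx in Dn0.
  by split; [apply: sub0set | move=> a b _; rewrite inE].
case: (@arg_maxnP _ set0 Q (fun D0 => #|D0|) Q0) => D0 /asboolP[pc D0D] Dmax.
exists D0; split=> //; first exact/eqP.
have [sub pcl] := pc; have [DE dis] := subset_disjointU sub.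
split.
  by rewrite setD_eq0; apply/negP => sub'; apply/D0D/eqP; rewrite eqEsubset sub.
move=> D1 [sub1 pc1]; have [->|D1n0] := eqVneq D1 set0; [by left | right].
have [DE'|] := eqVneq (D0 :|: D1) D.
  rewrite -{1}DE' setDUl setDv set0U; apply/esym/setDidPl.
  by rewrite disjoint_sym; apply: disjointWr sub1 dis.
move=> /eqP nDE; have Q1 : Q (D0 :|: D1).
  apply/asboolP; split=> //; split.
    by rewrite subUset sub; apply: subset_trans sub1 (subsetDl _ _).
  move=> a b wab; rewrite !inE => bD aD; case: (boolP (inl (src J a) \in D0)) => //= a0.
  case/orP: bD => [b0|b1].
    by have := pcl _ _ wab b0 aD; rewrite (negPf a0).
  by apply: pc1 wab b1 _; rewrite inE a0.
have := Dmax _ Q1; rewrite cardsU.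
have -> : D0 :&: D1 = set0.
  by apply/eqP; rewrite setI_eq0; apply: disjointWr sub1 dis.
rewrite cards0 subn0 /= -[X in (_ <= X)%N]addn0 leq_add2l leqn0 cards_eq0.
by rewrite (negPf D1n0).
Qed.

Lemma frontier_step D w v : frontier D w v -> sconn D ->
  exists k' l' (C : dgraph k' l') i o r,
    [/\ perm_eq w (i ++ r), perm_eq (o ++ r) v, Emb C J D i o &
        indecomposable (underlying C)].
Proof.
move=> fr sc; have [frC wE vE] := frontier_core fr.
have [C E] := frontier_emb frC.
exists _, _, C, (filter (consumed D) w), (filter (made D) v),
  (filter (predC (consumed D)) w); split=> //.
apply: sconn_indecomposable; first exact: sconn_emb E sc.
by apply/(emb_noIO E) => x; rewrite mem_filter => /andP[].
Qed.

(** A last component is removed and the rest treated by induction on the number of nodes, the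
    boundary serving as the intermediate list. *)
Lemma run_total D u v : frontier D u v -> exists a, Run f D u v a.
Proof.
have [n] := ubnP #|D|; elim: n D v => // n IHn D v; rewrite ltnS => Dn fr.
have [D0|Dn0] := eqVneq D set0.
  subst D; exists (lperm P u v); apply: Run_perm; first exact: fr_uniqu fr.
  apply: uniq_perm; [exact: fr_uniqu fr | exact: fr_uniqv fr | move=> x].
  rewrite (fr_mem fr) (_ : consumed set0 x = false) ?andbT.
    by rewrite (_ : made set0 x = false) ?orbF //; case: x => //= a; rewrite inE.
  by rewrite /consumed; case: (wire _ _) => // b; rewrite inE.
have [D0 [pc D0D sc]] := pred_closed_max Dn0.
have [sub _] := pc; have [DE dis] := subset_disjointU sub.
have [fr0 fr1] := frontier_split fr pc.
have [|a ra] := IHn D0 (boundary u D0) _ fr0.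
  by apply: leq_trans Dn; apply: proper_card; rewrite properEneq D0D.
have [k' [l' [C [i [o [r [wE vE EC iC]]]]]]] := frontier_step fr1 sc.
eexists; rewrite {1}DE; apply: Run_step ra wE vE EC iC dis _.
by move=> x xu xD; apply: (fr_fresh fr xu); rewrite DE inE xD orbT.
Qed.

End RunTotal.

(** * Transport, composition and product of runs *)

Section RunCalculus.
Variables (pl : bool) (X : nat -> nat -> Type) (K : fieldType) (P : prop_data K).
Hypothesis PP : is_prop P.
Variable f : forall k l, dgraph pl X k l -> P k l.
Local Notation dgraph := (dgraph pl X).

(** The arrow is unchanged, because [lperm] sees only positions in lists, and an occurrence in [G]
    is one in [J]. *)
Lemma run_local k l k' l' (G : dgraph k' l') (J : dgraph k l) (e : emb_data G J)
    D u v D' u' v' a : is_emb e D u v -> Run f D' u' v' a ->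
  Run f (emVL e @: D') (map (emN e) u') (map (emN e) v') a.
Proof.
move=> eP; have iN := em_injN eP.
have lpE x y : uniq x -> perm_eq x y ->
    lperm P (map (emN e) x) (map (emN e) y) = lperm P x y.
  by move=> ux xy; apply: lperm_map => // ? ? _ _; apply: iN.
(* The frontier is kept through the induction: it says that the lists have no repetition, as
   renaming requires. *)
move=> R; elim: R (run_frontier R) => [x y ux xy _|].
  by rewrite imset0 -lpE //; apply: Run_perm; rewrite ?map_inj_uniq ?perm_map.
move=> D1 D2 x w y k1 l1 C i o r b rb IH wE vE EC iC dis fr frT.
have uw : uniq w by apply: fr_uniqv (run_frontier rb).
have uo : uniq (o ++ r) by rewrite (perm_uniq vE); apply: fr_uniqv frT.
rewrite imsetU -(lpE (o ++ r) y) // -(lpE w) // !map_cat -(size_map (emN e) r).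
apply: Run_step.
- exact: IH (run_frontier rb).
- by rewrite -map_cat; apply: perm_map.
- by rewrite -map_cat; apply: perm_map.
- exact: emb_trans eP EC.
- exact: iC.
- rewrite -setI_eq0 -imsetI; last by move=> ? ? _ _; exact: (em_injV eP).
  by rewrite (eqP (_ : D1 :&: D2 == set0)) ?imset0 ?setI_eq0.
- move=> c /mapP[z zx cE] /imsetP[t tD tE].
  have [|c' cE'] := em_A eP (a := c).
    by apply/(em_D eP); exists t.
  have zE : z = inr c' by apply: iN; rewrite -cE /= cE'.
  apply: (fr c'); first by rewrite -zE.
  by rewrite -(mem_imset _ _ (em_injV eP)) /emVL /= -(em_src eP) cE' tE imset_f.
Qed.

Lemma run_post k l (J : dgraph k l) (D : {set dnode J}) u v v' a :
  Run f D u v a -> perm_eq v v' -> Run f D u v' (acomp (lperm P v v') a).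
Proof.
move=> R; move: (run_frontier R); case: R v' => [{}u {}v uu uv|].
  move=> v' _ vv'; rewrite lperm_comp //; apply: Run_perm => //.
  exact: perm_trans vv'.
move=> {}D D' {}u w {}v k' l' C i o r b rb wE vE EC iC dis fr v' frT vv'.
have uo : uniq (o ++ r) by rewrite (perm_uniq vE); apply: fr_uniqv frT.
have h : ahom u (o ++ r) _ := ahom_comp (ahom_comp (run_ahom rb) (ahom_lperm P wE))
  (step_ahom f r EC).
rewrite (acompAh PP h (ahom_lperm P vE) (ahom_lperm P vv')) lperm_comp //.
by apply: Run_step rb wE _ EC iC dis fr; apply: perm_trans vv'.
Qed.

Lemma run_pre k l (J : dgraph k l) (D : {set dnode J}) u' u v a :
  Run f D u v a -> perm_eq u' u -> Run f D u' v (acomp a (lperm P u' u)).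
Proof.
move=> R; elim: R u' => [{}u {}v uu uv|] u' => [uu'|].
  by rewrite lperm_comp //; [apply: Run_perm;
    rewrite ?(perm_uniq uu') ?(perm_trans uu') | rewrite (perm_uniq uu')].
move=> D' {}u w {}v k' l' C i o r b rb IH wE vE EC iC dis fr u0 uu.
have h1 := ahom_lperm P uu; have h2 := run_ahom rb; have h3 := ahom_lperm P wE.
have h4 := step_ahom f r EC; have h5 := ahom_lperm P vE.
rewrite -(acompAh PP h1 (ahom_comp (ahom_comp h2 h3) h4) h5).
rewrite -(acompAh PP h1 (ahom_comp h2 h3) h4) -(acompAh PP h1 h2 h3).
apply: Run_step => //; first exact: IH.
by apply: fresh_sub fr => x; rewrite (perm_mem uu).
Qed.

Lemma run_comp k l (J : dgraph k l) (D1 D2 : {set dnode J}) u v w a b :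
    Run f D1 u v a -> Run f D2 v w b -> [disjoint D1 & D2] -> fresh u D2 ->
  Run f (D1 :|: D2) u w (acomp b a).
Proof.
move=> Ra Rb; elim: Rb a Ra => {v w b} [v w uv vw|] a.
  by move=> Ra _ _; rewrite setU0; apply: run_post.
move=> D' v w x k' l' C i o r b rb IH wE xE EC iC dis fr c rc.
rewrite disjointUr => /andP[d1 d2] /freshU[f1 f2].
have h1 := run_ahom rc; have h2 := run_ahom rb; have h3 := ahom_lperm P wE.
have h4 := step_ahom f r EC; have h5 := ahom_lperm P xE.
rewrite -(acompAh PP h1 (ahom_comp (ahom_comp h2 h3) h4) h5).
rewrite -(acompAh PP h1 (ahom_comp h2 h3) h4) -(acompAh PP h1 h2 h3) setUA.
apply: Run_step => //; first exact: IH.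
by rewrite disjointUl d2.
Qed.

(** The strands [s] join the idle strands of every step. *)
Lemma run_tensr k l (J : dgraph k l) (D : {set dnode J}) u v a s :
    Run f D u v a -> uniq (u ++ s) -> fresh s D ->
  Run f D (u ++ s) (v ++ s) (atens a (aid P (size s))).
Proof.
move=> R; elim: R => {D u v a} [u v uu uv|] us.
  move=> _; rewrite -lperm_catl //.
  by apply: Run_perm; rewrite ?perm_cat2r.
move=> D' u w x k' l' C i o r b rb IH wE xE EC iC dis fr uus /freshU[f1 f2].
have R1 := IH uus f1; have fr1 := run_frontier R1.
have h2 := run_ahom rb; have h3 := ahom_lperm P wE.
have h4 := step_ahom f r EC; have h5 := ahom_lperm P xE.
have ids := ahom_id P s.
have uir : uniq (w ++ s) := fr_uniqv fr1.
have R2 : Run f (us :|: D') (u ++ s) (o ++ r ++ s)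
  (acomp (lperm P (o ++ r ++ s) (o ++ r ++ s))
    (acomp (atens (arr (f C)) (aid P (size (r ++ s))))
      (acomp (lperm P (w ++ s) (i ++ r ++ s)) (atens b (aid P (size s)))))).
  apply: Run_step R1 _ _ EC iC dis _ => //.
  - by rewrite catA perm_cat2r.
  - exact/fresh_cat.
have uo := fr_uniqv (run_frontier R2).
have := run_post R2 (v' := x ++ s); rewrite [in perm_eq _ _]catA perm_cat2r => /(_ xE).
congr Run; rewrite lperm_id // !catA; rewrite catA in uo.
have hs : ahom (w ++ s) ((i ++ r) ++ s) (atens (lperm P w (i ++ r)) (aid P (size s)))
  := ahom_tens h3 ids.
have hC : ahom ((i ++ r) ++ s) ((o ++ r) ++ s)
  (atens (atens (arr (f C)) (aid P (size r))) (aid P (size s))) := ahom_tens h4 ids.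
have hb := ahom_tens h2 ids.
rewrite [size (r ++ s)]size_cat aidD // atensA // !lperm_catl //.
rewrite (acomp1lh PP (ahom_comp (ahom_comp hb hs) hC)).
rewrite (atens_comph PP h2 h3 ids ids) (acomp1lh PP ids).
rewrite (atens_comph PP (ahom_comp h2 h3) h4 ids ids) (acomp1lh PP ids).
by rewrite (atens_comph PP (ahom_comp (ahom_comp h2 h3) h4) h5 ids ids)
  (acomp1lh PP ids).
Qed.

(** Obtained from [run_tensr] by conjugation with the symmetry. *)
Lemma run_tensl k l (J : dgraph k l) (D : {set dnode J}) u v a s :
    Run f D u v a -> uniq (s ++ u) -> fresh s D ->
  Run f D (s ++ u) (s ++ v) (atens (aid P (size s)) a).
Proof.
move=> R us fr; have us' : uniq (u ++ s) by rewrite uniq_catC.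
have pC (x y : seq (dname J)) : perm_eq (x ++ y) (y ++ x) by rewrite perm_catC.
have R1 := run_tensr R us' fr; have fr1 := run_frontier R1.
have := run_pre (run_post R1 (pC v s)) (pC s u); congr Run.
have [h1 h2] := run_ahom R.
rewrite (lperm_swap PP us' (fr_uniqv fr1) h1 h2) //.
have hT := ahom_tens (ahom_id P s) (run_ahom R).
rewrite -(acompAh PP (ahom_lperm P (pC s u)) (ahom_lperm P (pC u s)) hT).
rewrite lperm_comp // lperm_id //; exact: (acomp1rh PP hT).
Qed.

(** By interchange the product is [a] beside idle strands followed by [b] beside idle strands, a
    composite of runs. *)
Lemma run_tens k l (J : dgraph k l) (D1 D2 : {set dnode J}) u v u' v' a b :
    Run f D1 u v a -> Run f D2 u' v' b -> [disjoint D1 & D2] ->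
    uniq (u ++ u') -> fresh u D2 -> fresh u' D1 ->
  Run f (D1 :|: D2) (u ++ u') (v ++ v') (atens a b).
Proof.
move=> Ra Rb dis uu fr fr'; have R1 := run_tensr Ra uu fr'.
have frv : fresh v D2.
  by have [? [? [G E]]] := run_embed Ra; apply: emb_fresh E fr dis.
have R2 := run_tensl Rb (fr_uniqv (run_frontier R1)) frv.
have := run_comp R1 R2 dis; rewrite (atens_comph PP (run_ahom Ra) (ahom_id P v)
  (ahom_id P u') (run_ahom Rb)).
rewrite (acomp1lh PP (run_ahom Ra)) (acomp1rh PP (run_ahom Rb)); apply.
by apply/fresh_cat; split=> //; apply: (fr_fresh (run_frontier Rb)).
Qed.

End RunCalculus.

(** * Independence of the order of the components *)

Section Functional.
Variables (pl : bool) (X : nat -> nat -> Type) (K : fieldType) (P : prop_data K).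
Hypothesis PP : is_prop P.
Variable f : forall k l, dgraph pl X k l -> P k l.
Local Notation dgraph := (dgraph pl X).

Hypothesis f_dequiv : forall k l (G H : dgraph k l),
  indecomposable (underlying G) -> dequiv G H -> f G = f H.
Hypothesis f_lact : forall k l (G : dgraph k l) s,
  indecomposable (underlying G) -> f (dlact G s) = lact s (f G).
Hypothesis f_ract : forall k l (G : dgraph k l) t,
  indecomposable (underlying G) -> f (dract G t) = ract (f G) t.

(** Occurrences on the same nodes whose ends differ in order only are related by the two actions up
    to isomorphism; equivariance of [f] does the rest. *)
Lemma f_emb k l (J : dgraph k l) D k1 l1 (C1 : dgraph k1 l1) i1 o1
    k2 l2 (C2 : dgraph k2 l2) i2 o2 :
    Emb C1 J D i1 o1 -> Emb C2 J D i2 o2 -> indecomposable (underlying C1) ->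
    perm_eq i1 i2 -> perm_eq o1 o2 ->
  arr (f C2) = acomp (lperm P o1 o2) (acomp (arr (f C1)) (lperm P i2 i1)).
Proof.
move=> E1 E2 iC ii oo; have fr1 := emb_frontier E1; have fr2 := emb_frontier E2.
have ii' : perm_eq i2 i1 by rewrite perm_sym.
have [n [g [s [g_inj gE gE']]]] := codom_ord_perm (fr_uniqu fr2) ii'.
have [m [h [t [h_inj hE hE']]]] := codom_ord_perm (fr_uniqv fr1) oo.
have [s1 t1] := emb_size E1; have [s2 t2] := emb_size E2.
have k1n : k1 = n by rewrite -s1 gE' size_codom_ord.
have k2n : k2 = n by rewrite -s2 gE size_codom_ord.
have l1m : l1 = m by rewrite -t1 hE size_codom_ord.
have l2m : l2 = m by rewrite -t2 hE' size_codom_ord.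
clear s1 t1 s2 t2; subst k1 k2 l1 l2 i1 i2 o1 o2.
rewrite !lpermE // -ract_arr // -lact_arr //.
congr arr; rewrite -f_ract // -f_lact; last exact:
  (indecomposable_gract (G := underlying C1)).
apply/esym/f_dequiv.
  by apply: (indecomposable_glact (G := gract (underlying C1) s));
    apply: indecomposable_gract.
apply: emb_uniq E2; have /(emb_lact t) := emb_ract s E1; congr (Emb _ _ _ _ _).
by apply: eq_codom => j /=; rewrite permK.
Qed.

Section Ambient.
Variables (k l : nat) (J : dgraph k l).
Implicit Types (D : {set dnode J}) (u v w : seq (dname J)).

Lemma frontier_perm D u v v' : frontier D u v -> frontier D u v' -> perm_eq v v'.
Proof.
move=> fr fr'; apply: uniq_perm; [exact: fr_uniqv fr | exact: fr_uniqv fr' |].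
by move=> x; rewrite (fr_mem fr) (fr_mem fr').
Qed.

(* The wires that a component consumes and produces depend on its nodes only. *)
Lemma indecomposable_ends D k' l' (C : dgraph k' l') i o :
    Emb C J D i o -> indecomposable (underlying C) ->
  (forall x, x \in i = consumed D x && ~~ made D x) /\
  (forall x, x \in o = made D x && ~~ consumed D x).
Proof.
move=> E iC; have fr := emb_frontier E; have [_ IO0 _ _ _] := iC.
have ci := proj1 (emb_noIO E) IO0.
have mi x : x \in i -> made D x = false.
  by case: x => //= a ai; apply/negP; apply: (fr_fresh fr ai).
split=> x; last first.
  rewrite (fr_mem fr); case xi: (x \in i) => //=.
  by rewrite (ci _ xi) andbF.
apply/idP/andP => [xi|[]]; first by rewrite ci // mi.
rewrite {1}/consumed; case wx: (wire _ x) => [//|b] bD /negPf mx.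
have := fr_src fr bD; rewrite (_ : unwire _ _ = x) ?mx ?orbF //.
by rewrite -wx wireK.
Qed.

Lemma ends_perm D k1 l1 (C1 : dgraph k1 l1) i1 o1 k2 l2 (C2 : dgraph k2 l2) i2 o2 :
    Emb C1 J D i1 o1 -> Emb C2 J D i2 o2 -> indecomposable (underlying C1) ->
    indecomposable (underlying C2) -> perm_eq i1 i2 /\ perm_eq o1 o2.
Proof.
move=> E1 E2 iC1 iC2; have fr1 := emb_frontier E1; have fr2 := emb_frontier E2.
have [i1E o1E] := indecomposable_ends E1 iC1.
have [i2E o2E] := indecomposable_ends E2 iC2.
split; apply: uniq_perm; rewrite ?(fr_uniqu fr1) ?(fr_uniqu fr2) ?(fr_uniqv fr1)
  ?(fr_uniqv fr2) // => x.
  by rewrite i1E i2E.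
by rewrite o1E o2E.
Qed.

(** What a run has treated so far is an initial part: a strand that ends there was listed in [u] or
    made there, and freshness of [u] excludes the first for strands made in the union. *)
Lemma frontier_pred_closed D0 D1 u v w : frontier D0 u w ->
    frontier (D0 :|: D1) u v -> pred_closed (D0 :|: D1) D0.
Proof.
move=> fr fr'; split; first exact: subsetUl.
move=> a b wab bD aD; have uE : unwire (underlying J) (inr b) = inr a by rewrite -wab
  wireK.
have := fr_src fr bD; rewrite uE => /orP[|//] au.
by case: (fr_fresh fr' au aD).
Qed.

Lemma pred_closedI D D1 D2 : pred_closed D D1 -> pred_closed D D2 ->
  pred_closed D (D1 :&: D2).
Proof.
move=> [s1 p1] [s2 p2]; split; first exact: subset_trans (subsetIl _ _) s1.
move=> a b wab; rewrite !inE => /andP[b1 b2] aD.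
by rewrite (p1 _ _ wab b1 aD) (p2 _ _ wab b2 aD).
Qed.

(** [E1] meets the initial part [Eb] in a predecessor-closed subset of itself, that is, in nothing
    or in all of [E1]. *)
Lemma sconn_last (S E1 Eb E2 : {set dnode J}) : pred_closed S Eb -> E1 \subset S ->
    S = Eb :|: E2 -> [disjoint Eb & E2] -> sconn E1 ->
  [disjoint E1 & E2] \/ E1 \subset E2.
Proof.
move=> [_ pc] sub SE dis [_ Emin]; have [|E0|E0] := Emin (E1 :&: Eb).
- split; first exact: subsetIl.
  move=> a b wab; rewrite !inE => /andP[b1 b2] a1; rewrite a1.
  by apply: pc wab b2 _; apply: (subsetP sub).
- right; apply/subsetP => x x1; have := subsetP sub x x1.
  rewrite SE inE => /orP[xb|//].
  by have := in_set0 x; rewrite -E0 inE x1 xb.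
- by left; apply: disjointWl dis; rewrite -E0 subsetIr.
Qed.

Lemma last_components (S Da D1 Db D2 : {set dnode J}) :
    S = Da :|: D1 -> S = Db :|: D2 -> [disjoint Da & D1] -> [disjoint Db & D2] ->
    pred_closed S Da -> pred_closed S Db -> sconn D1 -> sconn D2 ->
  D1 = D2 \/ [disjoint D1 & D2].
Proof.
move=> SE SE' dis1 dis2 pca pcb sc1 sc2.
have s1 : D1 \subset S by rewrite SE subsetUr.
have s2 : D2 \subset S by rewrite SE' subsetUr.
have [|s12] := sconn_last pcb s1 SE' dis2 sc1; first by right.
have [|s21] := sconn_last pca s2 SE dis1 sc2; first by rewrite disjoint_sym; right.
by left; apply/eqP; rewrite eqEsubset s12.
Qed.

Lemma setU_cancel Da Db D1 : Da :|: D1 = Db :|: D1 -> [disjoint Da & D1] ->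
  [disjoint Db & D1] -> Da = Db.
Proof.
move=> e da db; have sD (A : {set dnode J}) : [disjoint A & D1] -> (A :|: D1) :\: D1
  = A.
  by move=> d; rewrite setDUl setDv setU0; apply/setDidPl.
by rewrite -(sD Da da) e sD.
Qed.

Lemma perm_cat_filter (w s : seq (dname J)) : uniq w -> uniq s -> {subset s <= w} ->
  perm_eq w (s ++ filter (fun x => x \notin s) w).
Proof.
move=> uw us sw; apply: uniq_perm => //.
  rewrite cat_uniq us filter_uniq // andbT; apply/hasPn => x.
  by rewrite mem_filter => /andP[].
move=> x; rewrite mem_cat mem_filter.
by case xs: (x \in s) => //=; rewrite sw.
Qed.

End Ambient.

Section Step.
Variables (k l : nat) (J : dgraph k l).
Implicit Types (D : {set dnode J}) (u v w : seq (dname J)).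

(** The output list of a run is determined only up to order, so values are compared up to the
    corresponding permutation. *)
Definition functional_at D : Prop := forall u v v' a a',
  Run f D u v a -> Run f D u v' a' -> a' = acomp (lperm P v v') a.

(** Both runs end with a component on [D1]. Its two occurrences differ by the order of their ends,
    which [f_emb] and [block_conj] turn into permutations of the whole lists. *)
Lemma functional_same D D1 u w w' v v' k1 l1 (C1 : dgraph k1 l1) i1 o1 r1 a
    k2 l2 (C2 : dgraph k2 l2) i2 o2 r2 b :
    functional_at D -> Run f D u w a -> Run f D u w' b ->
    perm_eq w (i1 ++ r1) -> perm_eq (o1 ++ r1) v -> perm_eq w' (i2 ++ r2) ->
    perm_eq (o2 ++ r2) v' -> uniq v ->
    Emb C1 J D1 i1 o1 -> Emb C2 J D1 i2 o2 -> indecomposable (underlying C1) ->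
    indecomposable (underlying C2) ->
  acomp (lperm P (o2 ++ r2) v') (acomp (atens (arr (f C2)) (aid P (size r2)))
    (acomp (lperm P w' (i2 ++ r2)) b)) =
  acomp (lperm P v v') (acomp (lperm P (o1 ++ r1) v)
    (acomp (atens (arr (f C1)) (aid P (size r1)))
      (acomp (lperm P w (i1 ++ r1)) a))).
Proof.
move=> fD Ra Rb w1 v1 w2 v2 uv E1 E2 iC1 iC2.
have [ii oo] := ends_perm E1 E2 iC1 iC2.
have fra := run_frontier Ra; have frb := run_frontier Rb.
have ww := frontier_perm fra frb.
have w12 : perm_eq (i1 ++ r1) (i2 ++ r2).
  by rewrite perm_sym in w1; apply: perm_trans w1 (perm_trans ww w2).
have rr : perm_eq r1 r2.
  rewrite -(perm_cat2l i1); apply: (perm_trans w12); rewrite perm_cat2r.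
  by rewrite perm_sym.
have ii' : perm_eq i2 i1 by rewrite perm_sym.
have rr' : perm_eq r2 r1 by rewrite perm_sym.
have ww' : perm_eq w' w by rewrite perm_sym.
have oor : perm_eq (o1 ++ r1) (o2 ++ r2) by apply: perm_cat.
have iir : perm_eq (i2 ++ r2) (i1 ++ r1) by apply: perm_cat.
have uw2 : uniq w' := fr_uniqv frb.
have ui2 : uniq (i2 ++ r2) by rewrite -(perm_uniq w2).
have uo1 : uniq (o1 ++ r1) by rewrite (perm_uniq v1).
have vv : perm_eq v v'.
  by rewrite perm_sym in v1; apply: perm_trans v1 (perm_trans oor v2).
rewrite (fD _ _ _ _ _ Ra Rb) (f_emb E1 E2 iC1 ii oo).
rewrite (block_conj PP (emb_ahom f E1) ui2 uo1 ii' oo rr').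
have ha := run_ahom Ra; have h1 := ahom_lperm P ww; have h2 := ahom_lperm P w2.
have h3 := ahom_lperm P iir; have h4 := step_ahom f r1 E1; have h5 := ahom_lperm P oor.
have h6 := ahom_lperm P v2; have h7 := ahom_lperm P w1; have h8 := ahom_lperm P v1.
have h9 := ahom_lperm P vv.
rewrite (acompAh PP ha h1 h2) lperm_comp //; last exact: fr_uniqv fra.
have h12 : ahom w (i2 ++ r2) (lperm P w (i2 ++ r2)).
  by apply: ahom_lperm; apply: perm_trans w2.
rewrite -(acompAh PP (ahom_comp ha h12) (ahom_comp h3 h4) h5).
rewrite -(acompAh PP (ahom_comp ha h12) h3 h4) (acompAh PP ha h12 h3).
rewrite lperm_comp //; [|exact: fr_uniqv fra|exact: perm_trans w2].
have hx := ahom_comp (ahom_comp ha h7) h4.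
by rewrite (acompAh PP hx h5 h6) (acompAh PP hx h8 h9) !lperm_comp.
Qed.

(** By functionality on [U :|: D2], the beginning of a run that ends with [C1] can be replaced by a
    run over [U] followed by [C2]; then [C2] and [C1] merge into a layer in parallel. Used twice,
    with the roles exchanged. *)
Lemma functional_half U D1 D2 u w0 w v k1 l1 (C1 : dgraph k1 l1) i1 o1 r1
    k2 l2 (C2 : dgraph k2 l2) i2 o2 r a c :
    functional_at (U :|: D2) -> Run f U u w0 c -> perm_eq w0 (i1 ++ i2 ++ r) ->
    Emb C2 J D2 i2 o2 -> indecomposable (underlying C2) -> [disjoint U & D2] ->
    fresh u D2 -> Run f (U :|: D2) u w a -> perm_eq w (i1 ++ r1) ->
    perm_eq (o1 ++ r1) v -> Emb C1 J D1 i1 o1 -> uniq v ->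
  perm_eq (o1 ++ o2 ++ r) v /\
  acomp (lperm P (o1 ++ r1) v) (acomp (atens (arr (f C1)) (aid P (size r1)))
    (acomp (lperm P w (i1 ++ r1)) a)) =
  acomp (lperm P (o1 ++ o2 ++ r) v)
    (acomp (atens (arr (f C1)) (atens (arr (f C2)) (aid P (size r))))
      (acomp (lperm P w0 (i1 ++ i2 ++ r)) c)).
Proof.
move=> fD Rc w0E E2 iC2 dis fr Ra wE vE E1 uv.
have pCA (x y z : seq (dname J)) : perm_eq (x ++ y ++ z) (y ++ x ++ z) by rewrite
  perm_catCA.
have w0E' : perm_eq w0 (i2 ++ i1 ++ r) by apply: perm_trans w0E (pCA _ _ _).
have R2 := Run_step (f := f) Rc w0E' (perm_refl _) E2 iC2 dis fr.
have uo2 := fr_uniqv (run_frontier R2).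
have o2w := frontier_perm (run_frontier R2) (run_frontier Ra).
have r1E : perm_eq (o2 ++ r) r1.
  by rewrite -(perm_cat2l i1); apply: (perm_trans (pCA i1 o2 r));
    apply: (perm_trans o2w).
have oE : perm_eq (o1 ++ o2 ++ r) (o1 ++ r1) by rewrite perm_cat2l.
have ov : perm_eq (o1 ++ o2 ++ r) v := perm_trans oE vE.
have uo : uniq (o1 ++ o2 ++ r) by rewrite (perm_uniq ov).
split=> //; rewrite (fD _ _ _ _ _ R2 Ra) lperm_id //.
have hc := run_ahom Rc; have h1 := ahom_lperm P w0E'.
have h2 := step_ahom f (i1 ++ r) E2; have h3 := ahom_lperm P o2w.
have h4 := ahom_lperm P wE; have h5 := step_ahom f r1 E1.
have hx := ahom_comp hc h1; have hy := ahom_comp hx h2.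
rewrite (acomp1lh PP hy) (acompAh PP hy h3 h4) lperm_comp //.
have h6 := ahom_lperm P (perm_trans o2w wE).
rewrite (acompAh PP hc h1 h2) (acompAh PP hc (ahom_comp h1 h2) h6).
rewrite (acompAh PP hc (ahom_comp (ahom_comp h1 h2) h6) h5).
rewrite (block_seq PP (emb_ahom f E1) (emb_ahom f E2) w0E r1E) //; last first.
  exact: fr_uniqv (run_frontier Rc).
have h7 := ahom_lperm P w0E.
have h8 : ahom (i1 ++ i2 ++ r) (o1 ++ o2 ++ r)
    (atens (arr (f C1)) (atens (arr (f C2)) (aid P (size r)))).
  exact: ahom_tens (emb_ahom f E1) (ahom_tens (emb_ahom f E2) (ahom_id P r)).
have h9 := ahom_lperm P oE; have h10 := ahom_lperm P vE.
rewrite -(acompAh PP hc (ahom_comp h7 h8) h9) -(acompAh PP hc h7 h8).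
have hz := ahom_comp (ahom_comp hc h7) h8.
by rewrite (acompAh PP hz h9 h10) lperm_comp.
Qed.

(** An input of [C] that is not in [u] was made in [Db], since it is available in [w], and also in
    [Da], which contains [D2] and is predecessor-closed. So it is already present once [U] has been
    treated. *)
Lemma component_inputs S U Da Db D2 u w w0 i o r k2 l2 (C : dgraph k2 l2) :
    pred_closed S Da -> frontier Db u w -> perm_eq w (i ++ r) ->
    Emb C J D2 i o -> indecomposable (underlying C) -> D2 \subset Da -> Db \subset S ->
    U = Da :&: Db -> frontier U u w0 ->
  {subset i <= w0}.
Proof.
move=> [_ pca] frw wE E iC sub subb UE fr0 x xi;
  have [iE _] := indecomposable_ends E iC.
have xw : x \in w by rewrite (perm_mem wE) mem_cat xi.
move: xw; rewrite (fr_mem frw) (fr_mem fr0) => /andP[uD nc].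
have -> : consumed U x = false.
  apply: contraNF nc; rewrite /consumed UE; case: (wire _ x) => //= b.
  by rewrite inE => /andP[].
rewrite andbT; case/orP: uD => [->//|]; move: xi; rewrite iE => /andP[c2 _].
case: x c2 {nc} => //= a; rewrite /consumed; case wa: (wire _ _) => [//|b] bD aD.
rewrite UE inE aD andbT (pca a b) ?orbT //.
  exact: subsetP sub _ bD.
exact: subsetP subb _ aD.
Qed.

End Step.

Theorem run_functional k l (J : dgraph k l) (D : {set dnode J}) : functional_at D.
Proof.
have [n] := ubnP #|D|; elim: n D => // n IHn D; rewrite ltnS => Dn u v v' a a' R R'.
have fr := run_frontier R; have fr' := run_frontier R'.
have uv := fr_uniqv fr; have uv' := fr_uniqv fr'.
have vv := frontier_perm fr fr'.
(* The induction descends because a strongly connected component is nonempty. *)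
have nonempty Da D1 : D = Da :|: D1 -> [disjoint Da & D1] -> sconn D1 -> (#|Da| < n)%N.
  move=> DE dis [D1n0 _]; apply: leq_trans Dn; rewrite DE cardsU.
  rewrite (eqP (_ : Da :&: D1 == set0)) ?setI_eq0 // cards0 subn0.
  by rewrite -[X in (X < _)%N]addn0 ltn_add2l card_gt0.
have scE k' l' (C : dgraph k' l') D1 i o : Emb C J D1 i o ->
    indecomposable (underlying C) -> sconn D1.
  by move=> E iC; apply: emb_sconn E (indecomposable_sconn iC).
case: (run_inv R) => [[D0 uu uv1 ->]|].
  case: (run_inv R') => [[_ _ uv2 ->]|].
    by rewrite lperm_comp.
  case=> Db [D2 [w' [k2 [l2 [C2 [i2 [o2 [r2 [b [DE' _ _ _ [E2 iC2 _ _ _]]]]]]]]]]].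
  have [/set0Pn[x xD]] := scE _ _ _ _ _ _ E2 iC2.
  by have := in_set0 x; rewrite -D0 DE' inE xD orbT.
case=> Da [D1 [w [k1 [l1 [C1 [i1 [o1 [r1 [b [DE Ra w1 v1 [E1 iC1 dis1 f1 ->]]]]]]]]]]].
case: (run_inv R') => [[D0 _ _ _]|].
  have [/set0Pn[x xD]] := scE _ _ _ _ _ _ E1 iC1.
  by have := in_set0 x; rewrite -D0 DE inE xD orbT.
case=> Db [D2 [w' [k2 [l2 [C2 [i2 [o2 [r2 [b'
  [DE' Rb w2 v2 [E2 iC2 dis2 f2 ->]]]]]]]]]]].
have sc1 := scE _ _ _ _ _ _ E1 iC1; have sc2 := scE _ _ _ _ _ _ E2 iC2.
have fra := run_frontier Ra; have frb := run_frontier Rb.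
have pca : pred_closed D Da by rewrite DE; apply: (frontier_pred_closed fra);
  rewrite -DE; exact: fr.
have pcb : pred_closed D Db by rewrite DE'; apply: (frontier_pred_closed frb);
  rewrite -DE'; exact: fr.
case: (last_components DE DE' dis1 dis2 pca pcb sc1 sc2) => [D12|dis].
  subst D2; have Dab : Da = Db by apply: setU_cancel dis1 dis2; rewrite -DE.
  subst Db; apply: (functional_same _ Ra Rb w1 v1 w2 v2 uv E1 E2 iC1 iC2).
  exact/IHn/(nonempty _ _ DE dis1 sc1).
(* The last components are disjoint. Each can then be removed from the other run's beginning,
   leaving the same part [U] in both. *)
pose U := Da :&: Db; have pcU : pred_closed D U := pred_closedI pca pcb.
have [frU _] := frontier_split fr pcU; have [c Rc] := run_total f frU.
move: frU Rc; set w0 := boundary u U => frU Rc.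
have [sDa _] := pca; have [sDb _] := pcb.
have D2a : D2 \subset Da.
  apply/subsetP => x x2; have : x \in D by rewrite DE' inE x2 orbT.
  by rewrite DE inE => /orP[//|x1]; rewrite (disjointFr dis x1) in x2.
have D1b : D1 \subset Db.
  apply/subsetP => x x1; have : x \in D by rewrite DE inE x1 orbT.
  by rewrite DE' inE => /orP[//|x2]; rewrite (disjointFr dis x1) in x2.
have UE2 : Da = U :|: D2.
  apply/setP => x; rewrite !inE; apply/idP/orP => [xa|[/andP[]//|]].
    have := subsetP sDa x xa; rewrite DE' inE => /orP[xb|]; last by right.
    by left; rewrite xa.
  exact: subsetP D2a x.
have UE1 : Db = U :|: D1.
  apply/setP => x; rewrite !inE; apply/idP/orP => [xb|[/andP[]//|]].
    have := subsetP sDb x xb; rewrite DE inE => /orP[xa|]; last by right.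
    by left; rewrite xa.
  exact: subsetP D1b x.
have i2w0 : {subset i2 <= w0}.
  exact: (component_inputs pca frb w2 E2 iC2 D2a sDb erefl frU).
have i1w0 : {subset i1 <= w0}.
  exact: (component_inputs pcb fra w1 E1 iC1 D1b sDa (setIC _ _) frU).
have ui : uniq (i1 ++ i2).
  rewrite cat_uniq (fr_uniqu (emb_frontier E1)) (fr_uniqu (emb_frontier E2)) andbT.
  apply/hasPn => x; have [i1E _] := indecomposable_ends E1 iC1.
  have [i2E _] := indecomposable_ends E2 iC2; rewrite /= i1E i2E => /andP[c2 _].
  apply/negP => /andP[c1 _].
  by rewrite (consumed_disjoint dis c1) in c2.
(* [r] collects the strands at the boundary of [U] that neither last component consumes. *)
have := perm_cat_filter (boundary_uniq u U) ui; set r := filter _ _.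
rewrite -/w0 => /(_ _)-w0E; have {}w0E : perm_eq w0 (i1 ++ i2 ++ r).
  by rewrite catA; apply: w0E => x; rewrite mem_cat => /orP[/i1w0|/i2w0].
have w0E' : perm_eq w0 (i2 ++ i1 ++ r).
  by apply: (perm_trans w0E); rewrite perm_catCA.
have dU1 : [disjoint U & D1] by apply: disjointWl dis1; apply: subsetIl.
have dU2 : [disjoint U & D2] by apply: disjointWl dis2; apply: subsetIr.
have fa : functional_at (U :|: D2) by rewrite -UE2;
  apply/IHn/(nonempty _ _ DE dis1 sc1).
have fb : functional_at (U :|: D1) by rewrite -UE1;
  apply/IHn/(nonempty _ _ DE' dis2 sc2).
rewrite UE2 in Ra; rewrite UE1 in Rb.
have [ov ->] := functional_half fa Rc w0E E2 iC2 dU2 f2 Ra w1 v1 E1 uv.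
have [ov' ->] := functional_half fb Rc w0E' E1 iC1 dU1 f1 Rb w2 v2 E2 uv'.
have pCA (x y z : seq (dname J)) : perm_eq (x ++ y ++ z) (y ++ x ++ z) by rewrite
  perm_catCA.
have uo : uniq (o1 ++ o2 ++ r) by rewrite (perm_uniq ov).
have uo' : uniq (o2 ++ o1 ++ r) by rewrite (perm_uniq ov').
have uw0 : uniq w0 := fr_uniqv frU.
have ui12 : uniq (i1 ++ i2 ++ r) by rewrite -(perm_uniq w0E).
have hc := run_ahom Rc; have h1 := ahom_lperm P w0E.
have hi := ahom_lperm P (pCA i1 i2 r); have ho := ahom_lperm P (pCA o1 o2 r).
have h2 := ahom_tens (emb_ahom f E1) (ahom_tens (emb_ahom f E2) (ahom_id P r)).
have h2' := ahom_tens (emb_ahom f E2) (ahom_tens (emb_ahom f E1) (ahom_id P r)).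
have h3 := ahom_lperm P ov; have h3' := ahom_lperm P ov'; have h4 := ahom_lperm P vv.
have hx := ahom_comp hc h1.
(* Both values now end with a parallel layer and differ in the order of [C1] and [C2]; naturality of
   the symmetry exchanges them. *)
rewrite -(@lperm_comp _ _ _ PP w0 (i1 ++ i2 ++ r) (i2 ++ i1 ++ r)) //.
rewrite -(acompAh PP hc h1 hi) (acompAh PP hx hi h2').
rewrite -(block_swap PP (emb_ahom f E1) (emb_ahom f E2) ui12 uo).
rewrite -(acompAh PP hx h2 ho).
have hy := ahom_comp hx h2.
by rewrite (acompAh PP hy ho h3') (acompAh PP hy h3 h4) !lperm_comp.
Qed.

End Functional.

(** * The morphism induced on graphs *)

Section SubStructures.
Variable K : fieldType.

Lemma spanned_ind (V : lmodType K) (A : V -> Prop) (Q : spanned A -> Prop) :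
    Q 0 -> (forall x y, Q x -> Q y -> Q (x + y)) ->
    (forall a x, A (val x) -> Q (a *: x)) -> forall x, Q x.
Proof.
move=> Q0 QD QZ.
(* [span_ind] concerns elements of [V], so [Q] is first transported there through preimages. *)
have QQ x : x \in span A -> exists2 y : spanned A, Q y & val y = x.
  move: x; apply: span_ind.
  - by exists 0.
  - by move=> _ _ [x Qx <-] [y Qy <-]; exists (x + y) => //; apply: QD.
  - move=> a x Ax; exists (a *: Spanned (span_gen Ax)) => //.
    exact: QZ.
by move=> x; have [y Qy /val_inj <-] := QQ _ (valP x).
Qed.

Section SubModule.
Variables (M : smod K) (A : forall k l, M k l -> Prop) (stA : act_stable A).
Local Notation N := (sub_smod stA).

Lemma val_linear k l : linear (val : N k l -> M k l).
Proof. by []. Qed.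

Lemma sub_incl_morph : smod_morph (M := N) (N := M) (fun k l => val).
Proof. by split=> // k l; apply: val_linear. Qed.

Lemma sub_is_smod : is_smod M -> is_smod N.
Proof.
case=> h1 h2 h3 h4 h5 h6 h7; split.
- by move=> k l s a x y; apply: val_inj; rewrite /= h1.
- by move=> k l t a x y; apply: val_inj; exact: (h2 k l t a (val x) (val y)).
- by move=> k l x; apply: val_inj; rewrite /= h3.
- by move=> k l x; apply: val_inj; rewrite /= h4.
- by move=> k l s s' x; apply: val_inj; rewrite /= h5.
- by move=> k l s s' x; apply: val_inj; rewrite /= h6.
- by move=> k l s s' x; apply: val_inj; rewrite /= h7.
Qed.

Lemma val_smod_cast k l k' l' (ek : k = k') (el : l = l') (x : N k l) :
  val (smod_cast ek el x) = smod_cast ek el (val x).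
Proof. by subst k' l'. Qed.

End SubModule.
Section SubProp.
Variables (P : prop_data K) (A : forall k l, P k l -> Prop) (stA : prop_stable A).
Local Notation N := (sub_prop stA).

Lemma val_unitn n : val (unitn N n) = unitn P n.
Proof. by elim: n => //= n ->. Qed.

Lemma sub_is_prop : is_prop P -> is_prop N.
Proof.
case=> sm h1 h2 h3 h4 hA h0p hp0 vA v1p vp1 hv lv rv va hl hr hC; split.
- exact: sub_is_smod.
- by move=> k l k' l' q a x y; apply: val_inj;
    exact: (h1 k l k' l' (val q) a (val x) (val y)).
- by move=> k l k' l' q a x y; apply: val_inj;
    exact: (h2 k l k' l' (val q) a (val x) (val y)).
- by move=> k l m q a x y; apply: val_inj; exact: (h3 k l m (val q) a (val x) (val y)).
- by move=> k l m q a x y; apply: val_inj; exact: (h4 k l m (val q) a (val x) (val y)).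
- by move=> *; apply: val_inj; rewrite val_smod_cast; apply: hA.
- by move=> *; apply: val_inj; apply: h0p.
- by move=> *; apply: val_inj; rewrite val_smod_cast; apply: hp0.
- by move=> *; apply: val_inj; apply: vA.
- by move=> k l p; apply: val_inj; rewrite -[RHS]v1p -val_unitn.
- by move=> k l p; apply: val_inj; rewrite -[RHS]vp1 -val_unitn.
- by move=> *; apply: val_inj; apply: hv.
- by move=> *; apply: val_inj; apply: lv.
- by move=> *; apply: val_inj; apply: rv.
- by move=> *; apply: val_inj; apply: va.
- by move=> *; apply: val_inj; apply: hl.
- by move=> *; apply: val_inj; apply: hr.
- move=> *; apply: val_inj; rewrite /= hC; congr (ract _ _).
  by apply/esym; apply: val_smod_cast.
Qed.

End SubProp.
End SubStructures.

(** * Evaluation of graphs *)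

Section Evaluation.
Variables (pl : bool) (X : nat -> nat -> Type) (K : fieldType) (P : prop_data K).
Hypothesis PP : is_prop P.
Variable f : forall k l, dgraph pl X k l -> P k l.
Local Notation dgraph := (dgraph pl X).
Local Notation Gr := (gr_prop pl K X).

Hypothesis f_dequiv : forall k l (G H : dgraph k l),
  indecomposable (underlying G) -> dequiv G H -> f G = f H.
Hypothesis f_lact : forall k l (G : dgraph k l) s,
  indecomposable (underlying G) -> f (dlact G s) = lact s (f G).
Hypothesis f_ract : forall k l (G : dgraph k l) t,
  indecomposable (underlying G) -> f (dract G t) = ract (f G) t.

Fact eval_subproof k l (G : dgraph k l) :
  exists p : P k l, Run f setT (dinputs G) (doutputs G) (arr p).
Proof.
have [a Ra] := run_total f (emb_frontier (emb_refl G)).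
have [h1 h2] := run_ahom Ra; rewrite !size_codom_ord in h1 h2.
by have [p ap] := arrP h1 h2; exists p; rewrite -ap.
Qed.

Definition eval k l (G : dgraph k l) : P k l := sval (cid (eval_subproof G)).

Lemma eval_run k l (G : dgraph k l) :
  Run f setT (dinputs G) (doutputs G) (arr (eval G)).
Proof. exact: svalP (cid (eval_subproof G)). Qed.

Lemma eval_emb k l k' l' (G : dgraph k' l') (J : dgraph k l) D u v :
  Emb G J D u v -> Run f D u v (arr (eval G)).
Proof.
case=> e eP; have := run_local eP (eval_run G).
by rewrite (emb_setT eP) (emb_inputs eP) (emb_outputs eP).
Qed.

(** To identify [eval G] it suffices to exhibit one run with the right ends over one occurrence of
    [G], in any ambient graph. Compatibility with each operation is an instance. *)
Lemma eval_uniq k l k' l' (G : dgraph k' l') (J : dgraph k l) D u v p :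
  Emb G J D u v -> Run f D u v (arr p) -> p = eval G.
Proof.
move=> /eval_emb R R'; have uv := fr_uniqv (run_frontier R).
apply: arr_inj; rewrite (run_functional PP f_dequiv f_lact f_ract R R') lperm_id //.
by rewrite (acomp1lh PP (run_ahom R)).
Qed.

Lemma eval_dequiv k l (G H : dgraph k l) : dequiv G H -> eval G = eval H.
Proof. by move/emb_dequiv/eval_emb/(eval_uniq (emb_refl H)). Qed.

Lemma eval_ind k l (G : dgraph k l) : indecomposable (underlying G) -> eval G = f G.
Proof.
move=> iG; apply/esym/(eval_uniq (emb_refl G)).
have fr := emb_frontier (emb_refl G); have ui := fr_uniqu fr; have uo := fr_uniqv fr.
have R0 := Run_perm f ui (perm_refl _).
(* The run with a single step: [G] itself is the component and no strand is idle. *)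
have := Run_step (r := [::]) R0 _ _ (emb_refl G) iG.
rewrite !cats0 set0U => /(_ _ (perm_refl _) (perm_refl _)); rewrite !lperm_id //.
have h := emb_ahom f (emb_refl G); rewrite atens0r //.
rewrite (acomp1lh PP (ahom_id _ (dinputs G))) (acomp1rh PP h) (acomp1lh PP h); apply.
  by rewrite -setI_eq0 set0I.
exact: fr_fresh fr.
Qed.

Lemma eval_vcat k l m (G' : dgraph l m) (G : dgraph k l) :
  eval (dvcat G' G) = vcat (eval G') (eval G).
Proof.
apply/esym/(eval_uniq (emb_refl _)).
have [D1 [D2 [v [-> dis /freshU[_ fr] E1 E2]]]] := emb_vcat_inv (emb_refl (dvcat G' G)).
by rewrite -acomp_arr; apply: run_comp (eval_emb E1) (eval_emb E2) dis fr.
Qed.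

Lemma eval_hcat k l k' l' (G : dgraph k l) (G' : dgraph k' l') :
  eval (dhcat G G') = hcat (eval G) (eval G').
Proof.
apply/esym/(eval_uniq (emb_refl _)); have fr := emb_frontier (emb_refl (dhcat G G')).
have := emb_hcat_inv (emb_refl (dhcat G G')).
case=> D1 [D2 [u [u' [v [v' [DE dis iE oE [E1 E2]]]]]]].
have ui := fr_uniqu fr; have fi := fr_fresh fr; rewrite iE in ui fi.
rewrite DE in fi; case/fresh_cat: fi => /freshU[_ f1] /freshU[f2 _].
rewrite DE iE oE; exact: (run_tens PP (eval_emb E1) (eval_emb E2) dis ui f1 f2).
Qed.

Lemma eval_lact k l (G : dgraph k l) s : eval (dlact G s) = lact s (eval G).
Proof.
apply/esym/(eval_uniq (emb_refl _)).
have [g -> E] := emb_lact_inv (emb_refl (dlact G s)).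
have g_inj : injective g by apply/uniq_codom_ord; apply: fr_uniqv (emb_frontier E).
rewrite lact_arr // -(lpermE P s g_inj); apply: run_post (eval_emb E) _ => //.
apply: frontier_perm (emb_frontier E) _.
have fr' := emb_frontier (emb_lact s E).
exact: fr'.
Qed.

Lemma eval_ract k l (G : dgraph k l) t : eval (dract G t) = ract (eval G) t.
Proof.
apply/esym/(eval_uniq (emb_refl _)).
have [g iE E] := emb_ract_inv (emb_refl (dract G t)); rewrite iE.
have g_inj : injective g by apply/uniq_codom_ord; apply: fr_uniqu (emb_frontier E).
have gt_inj : injective (g \o t) by apply: inj_comp => //; apply: perm_inj.
have gE : codom g = codom ((g \o t) \o t^-1%g).
  by apply: eq_codom => i /=; rewrite permKV.
rewrite ract_arr // -(lpermE P t gt_inj) -gE; apply: (run_pre PP (eval_emb E)).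
apply: uniq_perm; [exact/uniq_codom_ord | exact/uniq_codom_ord | move=> x].
apply/codomP/codomP => -[i ->]; first by exists (t i).
by exists (t^-1%g i); rewrite /= permKV.
Qed.

Lemma eval_unit0 : eval (dunit0 pl X) = unit0 P.
Proof.
apply/esym/(eval_uniq (emb_refl _)).
have [-> -> ->] := emb_unit0_inv (emb_refl (dunit0 pl X)).
have := Run_perm f (J := dunit0 pl X) (u := [::]) isT (perm_refl _).
by rewrite lperm_id.
Qed.

Lemma eval_unit1 : eval (dunit1 pl X) = unit1 P.
Proof.
apply/esym/(eval_uniq (emb_refl _)).
have [x [-> -> ->]] := emb_unit1_inv (emb_refl (dunit1 pl X)).
have := Run_perm f (J := dunit1 pl X) (u := [:: x]) isT (perm_refl _).
by rewrite lperm_id // -[aid P _]/(atens (arr (unit1 P)) (aid P 0)) atens0r.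
Qed.

Definition extension k l : Gr k l -> P k l := lext (fun c => eval (grepr c)).

Lemma extension_gen k l (G : dgraph k l) : extension (gen K G) = eval G.
Proof. by rewrite /extension lextU; apply/eval_dequiv/gclassK. Qed.

Lemma extension_linear k l : linear (@extension k l).
Proof. exact: lext_is_linear. Qed.

Lemma extension_morph : prop_morph (P := Gr) extension.
Proof.
have ps := prop_is_smod PP.
split.
- split.
  + exact: extension_linear.
  + move=> k l s; apply: gr_ext => [||G].
    * exact: linear_comp (@extension_linear k l) (gr_lact_linear s).
    * exact: linear_comp (lact_linear ps s) (@extension_linear k l).
    by rewrite lact_gen !extension_gen eval_lact.
  + move=> k l t; apply: gr_ext => [||G].
    * exact: linear_comp (@extension_linear k l) (gr_ract_linear t).
    * exact: linear_comp (ract_linear ps t) (@extension_linear k l).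
    by rewrite ract_gen !extension_gen eval_ract.
- move=> k l k' l' p p'; move: p; apply: gr_ext => [||G].
  + exact: linear_comp (@extension_linear _ _) (gr_hcatl p').
  + exact: linear_comp (hcat_linearl PP _) (@extension_linear _ _).
  move: p'; apply: gr_ext => [||G'].
  + exact: linear_comp (@extension_linear _ _) (gr_hcatr _).
  + exact: linear_comp (hcat_linearr PP _) (@extension_linear _ _).
  by rewrite hcat_gen !extension_gen eval_hcat.
- move=> k l m p p'; move: p; apply: gr_ext => [||G].
  + exact: linear_comp (@extension_linear _ _) (gr_vcatl p').
  + exact: linear_comp (vcat_linearl PP _) (@extension_linear _ _).
  move: p'; apply: gr_ext => [||G'].
  + exact: linear_comp (@extension_linear _ _) (gr_vcatr _).
  + exact: linear_comp (vcat_linearr PP _) (@extension_linear _ _).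
  by rewrite vcat_gen !extension_gen eval_vcat.
- exact: etrans (extension_gen (dunit0 pl X)) eval_unit0.
- exact: etrans (extension_gen (dunit1 pl X)) eval_unit1.
Qed.

End Evaluation.

(** * Generation by indecomposable graphs *)

Section Generation.
Variables (pl : bool) (X : nat -> nat -> Type) (K : fieldType).
Local Notation dgraph := (dgraph pl X).
Local Notation Gr := (gr_prop pl K X).

(** Induction along a run evaluated in [Gr], whose value is the class of [G] by [emb_uniq]. Each
    piece [C] keeps its occurrence in [G], so that properties inherited by subgraphs, such as
    acyclicity, remain available. *)
Lemma gen_ind (R : forall k l, Gr k l -> Prop) k l (G : dgraph k l) :
    (forall k l k' l' (p : Gr k l) (q : Gr k' l'), R _ _ p -> R _ _ q -> R _ _
      (hcat p q)) ->
    (forall k l m (p : Gr l m) (q : Gr k l), R _ _ p -> R _ _ q -> R _ _ (vcat p q)) ->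
    (forall k l s (p : Gr k l), R _ _ p -> R _ _ (lact s p)) ->
    R _ _ (unit0 Gr) -> R _ _ (unit1 Gr) ->
    (forall k' l' (C : dgraph k' l'), indecomposable (underlying C) ->
       (exists D u v, Emb C G D u v) -> R _ _ (gen K C : Gr k' l')) ->
  R _ _ (gen K G : Gr k l).
Proof.
move=> Rh Rv Rl R0 R1 RC.
pose RA (a : arrow Gr) := R _ _ (tagged a).
have RAc a b : acod a = adom b -> RA a -> RA b -> RA (acomp b a).
  case/arr_pair => k1 [l1 [m1 [p [q [-> ->]]]]] Ra Rb.
  by rewrite acomp_arr; apply: Rv.
have Ru n : R _ _ (unitn Gr n) by elim: n => [|n IHn];
  [exact: R0 | exact: (Rh _ _ _ _ _ _ R1 IHn)].
have RAp n (s : 'S_n) : RA (aperm Gr s) by apply: Rl.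
have [b Rb] := run_total (P := Gr) (@gen pl K X) (emb_frontier (emb_refl G)).
have [k' [l' [G' [bE E]]]] := run_emb Rb.
have [k'E l'E] := emb_size E; rewrite !size_codom_ord in k'E l'E.
subst k' l'; rewrite (gen_dequiv K (emb_uniq (emb_refl G) E)).
suff : RA b by rewrite bE.
elim: Rb => [u v _ _|D D' u w v k' l' C i o r a ra Ra wE vE EC iC _ _].
  exact: RAp.
have h1 := run_ahom ra; have h2 := ahom_lperm Gr wE; have h4 := ahom_lperm Gr vE.
have h3 := step_ahom (P := Gr) (@gen pl K X) r EC.
have glue u1 u2 u3 (x y : arrow Gr) : ahom u1 u2 x -> ahom u2 u3 y -> RA x -> RA y ->
  RA (acomp y x).
  by move=> [_ e] [e' _]; apply: RAc; rewrite e e'.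
apply: (glue _ _ _ _ _ _ (ahom_comp (ahom_comp h1 h2) h3) h4); last exact: RAp.
apply: (glue _ _ _ _ _ _ (ahom_comp h1 h2) h3); last first.
  by apply: Rh => //; apply: RC => //; exists D', i, o.
by apply: (glue _ _ _ _ _ _ h1 h2) => //; apply: RAp.
Qed.

(** By [em_wire] internal edges go to internal edges, hence cycles to cycles, and loops are
    embedded. *)
Lemma emb_upward k l k' l' (C : dgraph k' l') (G : dgraph k l) D u v :
  Emb C G D u v -> upward (underlying G) -> upward (underlying C).
Proof.
case=> e eP [acG L0]; split; last first.
  have L_inj : injective (emL e).
    move=> x y xy; have /(em_injV eP)[] // : emVL e (inr x) = emVL e (inr y).
    by rewrite /emVL /= xy.
  by apply/eqP; rewrite -leqn0 -L0; apply: leq_card L_inj.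
have edge (a : sE C) : exists a', emA e (inl a) = inl a' /\ emB e (inl a) = inl a'.
  have /= := em_wire eP (x := inr (inl a)) erefl.
  by case: (emA e (inl a)) => //= a' [<-]; exists a'.
pose m a := sval (cid (edge a)); have mE a := svalP (cid (edge a)).
move=> c c0; have mc0 : map m c != [::] by case: c c0.
apply: contra (acG _ mc0); rewrite cycle_map; apply: sub_cycle => a b /= /eqP ab.
have [aA aB] := mE a; have [bA bB] := mE b.
apply/eqP; rewrite -/(m a) -/(m b) in aA aB bA bB *.
by rewrite -aB -bA (em_tgt eP) (em_src eP) ab.
Qed.

End Generation.

(** * Freeness *)

Lemma smod_morph_comp (K : fieldType) (L M N : smod K)
    (g : forall k l, M k l -> N k l) (f : forall k l, L k l -> M k l) :
  smod_morph g -> smod_morph f -> smod_morph (fun k l x => g k l (f k l x)).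
Proof.
case=> g1 g2 g3 [f1 f2 f3]; split=> [k l|k l s x|k l t x].
- exact: linear_comp (g1 k l) (f1 k l).
- by rewrite f2 g2.
- by rewrite f3 g3.
Qed.

Section PartialMorphism.
Variables (K : fieldType) (M N P : smod K).
Hypotheses (sN : is_smod N) (sP : is_smod P).
Variable j : forall k l, M k l -> N k l.
Hypothesis j_morph : smod_morph j.
Hypothesis j_inj : forall k l, injective (@j k l).
Variable phi : forall k l, M k l -> P k l.
Hypothesis phi_morph : smod_morph phi.

(* [phi] extended by 0 outside the image of [j]. *)
Definition partial k l (x : N k l) : P k l :=
  match pselect (exists y, j y = x) with
  | left e => phi (sval (cid e))
  | right _ => 0
  end.

Lemma partialE k l (y : M k l) : partial (j y) = phi y.
Proof.
rewrite /partial; case: pselect => [e|[]]; last by exists y.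
by congr phi; apply: j_inj; apply: svalP (cid e).
Qed.

Lemma partial0 k l (x : N k l) : ~ (exists y, j y = x) -> partial x = 0.
Proof. by rewrite /partial; case: pselect. Qed.

(** Permutations act invertibly, so the complement of the image of [j] is stable as well and the
    extension by zero stays equivariant. *)
Lemma partial_lact k l s (x : N k l) : partial (lact s x) = lact s (partial x).
Proof.
have [[y <-]|nx] := pselect (exists y, j y = x).
  by rewrite -(smod_morphL j_morph) !partialE (smod_morphL phi_morph).
rewrite (partial0 nx) (lin0 (lact_linear sP s)) partial0 // => -[y yE].
apply: nx; exists (lact s^-1%g y); rewrite (smod_morphL j_morph) yE -(lactM sN).
by rewrite /permc mulgV (lact1 sN).
Qed.

Lemma partial_ract k l t (x : N k l) : partial (ract x t) = ract (partial x) t.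
Proof.
have [[y <-]|nx] := pselect (exists y, j y = x).
  by rewrite -(smod_morphR j_morph) !partialE (smod_morphR phi_morph).
rewrite (partial0 nx) (lin0 (ract_linear sP t)) partial0 // => -[y yE].
apply: nx; exists (ract y t^-1%g); rewrite (smod_morphR j_morph) yE -(ractM sN).
by rewrite /permc mulVg (ract1 sN).
Qed.

End PartialMorphism.

Section Freeness.
Variables (pl : bool) (K : fieldType) (X : nat -> nat -> Type).
Local Notation Gr := (gr_prop pl K X).
Local Notation gen := (@gen pl K X _ _).

(** Serves both freeness statements. In the acyclic case [phi] has values on acyclic components
    only; extended by zero it still gives a morphism on all graphs, which is then restricted. *)
Lemma prop_extension (M : smod K) (j : forall k l, M k l -> Gr k l) (P : prop_data K)
    (phi : forall k l, M k l -> P k l) :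
    is_prop P -> smod_morph j -> (forall k l, injective (@j k l)) ->
    smod_morph phi ->
    (forall k l (Q : M k l -> Prop), Q 0 -> (forall x y, Q x -> Q y -> Q (x + y)) ->
       (forall a x G, indecomposable (underlying G) -> j k l x = gen G -> Q (a *: x)) ->
     forall x, Q x) ->
  exists Phi : forall k l, Gr k l -> P k l, prop_morph Phi /\
    forall k l (x : M k l), Phi k l (j k l x) = phi k l x.
Proof.
move=> PP jm ji phim Mind; pose f k l (G : dgraph pl X k l) := partial j phi
  (gen G : Gr k l).
have sG := prop_is_smod (gr_is_prop pl K X); have sP := prop_is_smod PP.
have f1 k l (G H : dgraph pl X k l) : indecomposable (underlying G) -> dequiv G H ->
  f _ _ G = f _ _ H.
  by move=> _ GH; rewrite /f (gen_dequiv K GH).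
have f2 k l (G : dgraph pl X k l) s : indecomposable (underlying G) ->
    f _ _ (dlact G s) = lact s (f _ _ G).
  by move=> _; rewrite /f -lact_gen partial_lact.
have f3 k l (G : dgraph pl X k l) t : indecomposable (underlying G) ->
    f _ _ (dract G t) = ract (f _ _ G) t.
  by move=> _; rewrite /f -ract_gen partial_ract.
have Pm := extension_morph PP f1 f2 f3.
exists (extension f); split; first exact: Pm.
have phiL k l := smod_morph_linear phim (k := k) (l := l).
have jL k l := smod_morph_linear jm (k := k) (l := l).
have PL k l := smod_morph_linear (prop_morph_smod Pm) (k := k) (l := l).
move=> k l; apply: Mind => [|x y xE yE|a x G iG jx].
- by rewrite (lin0 (jL _ _)) (lin0 (PL _ _)) (lin0 (phiL _ _)).
- by rewrite (linD (jL _ _)) (linD (PL _ _)) (linD (phiL _ _)) xE yE.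
- rewrite (linZ (jL _ _)) (linZ (PL _ _)) (linZ (phiL _ _)) jx.
  by rewrite extension_gen // eval_ind // /f -jx partialE.
Qed.

Theorem gr_free : free_prop (Q := Gr) (M := gr_ind pl K X) (@gr_ind_incl pl K X).
Proof.
split=> [|P PP phi phim]; first exact: gr_is_prop.
have [||||Phi [Pm PE]] := @prop_extension (gr_ind pl K X) (@gr_ind_incl pl K X) P phi
  PP.
- exact: sub_incl_morph.
- by move=> k l; apply: val_inj.
- exact: phim.
- move=> k l Q Q0 QD QZ; apply: spanned_ind => // a x [G [iG xE]].
  exact: QZ iG xE.
have PL k l := smod_morph_linear (prop_morph_smod Pm) (k := k) (l := l).
exists Phi; split=> [|Psi [Sm SE]]; first by split.
have SL k l := smod_morph_linear (prop_morph_smod Sm) (k := k) (l := l).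
apply: functional_extensionality_dep => k; apply: functional_extensionality_dep => l.
apply: funext; apply: gr_ext => // G.
apply: (gen_ind (R := fun k l x => Phi k l x = Psi k l x)).
- by move=> *; rewrite !prop_morph_hcat //; congr hcat.
- by move=> *; rewrite !prop_morph_vcat //; congr vcat.
- move=> k' l' s p e; rewrite (smod_morphL (prop_morph_smod Pm)).
  by rewrite (smod_morphL (prop_morph_smod Sm)) e.
- by rewrite !prop_morph0.
- by rewrite !prop_morph1.
- move=> k' l' C iC _; have Cs : gen C \in span (@ind_gens pl K X k' l').
    by apply: span_gen; exists C.
  by rewrite -[gen C]/(gr_ind_incl (Spanned Cs)) SE PE.
Qed.

Local Notation Up := (gr_up pl K X).
Local Notation UpInd := (gr_up_ind pl K X).

Definition up_incl k l (x : Up k l) : Gr k l := val x.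

Lemma up_incl_morph : smod_morph up_incl.
Proof. exact: sub_incl_morph. Qed.

Lemma up_span_ind k l (Q : Up k l -> Prop) :
    Q 0 -> (forall x y, Q x -> Q y -> Q (x + y)) ->
    (forall a x G, upward (underlying G) -> up_incl x = gen G -> Q (a *: x)) ->
  forall x, Q x.
Proof.
by move=> Q0 QD QZ; apply: spanned_ind => // a x [G [uG xE]]; apply: QZ uG xE.
Qed.

Definition up_ind_incl k l (x : UpInd k l) : Gr k l := up_incl (gr_up_ind_incl x).

Lemma up_ind_incl_morph : smod_morph up_ind_incl.
Proof. exact: smod_morph_comp up_incl_morph (sub_incl_morph (up_ind_stable pl K X)).
  Qed.

Lemma up_ind_incl_inj k l : injective (@up_ind_incl k l).
Proof. by move=> x y /val_inj/val_inj. Qed.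

Theorem gr_up_free : free_prop (Q := Up) (M := UpInd) (@gr_up_ind_incl pl K X).
Proof.
split=> [|P PP phi phim]; first exact/sub_is_prop/gr_is_prop.
have [|Phi [Pm PE]] := prop_extension PP up_ind_incl_morph up_ind_incl_inj phim.
  move=> k l Q Q0 QD QZ; apply: spanned_ind => // a x [G [iG xE]].
  exact: QZ iG xE.
have PL k l := smod_morph_linear (prop_morph_smod Pm) (k := k) (l := l).
have UL k l := smod_morph_linear up_incl_morph (k := k) (l := l).
exists (fun k l x => Phi k l (up_incl x)); split; first split=> //.
- split.
  + exact: (smod_morph_comp (prop_morph_smod Pm) up_incl_morph).
  + by move=> k l k' l' x y; exact: (prop_morph_hcat Pm (up_incl x) (up_incl y)).
  + by move=> k l m x y; exact: (prop_morph_vcat Pm (up_incl x) (up_incl y)).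
  + exact: prop_morph0 Pm.
  + exact: prop_morph1 Pm.
move=> Psi [Sm SE]; have SL k l := smod_morph_linear (prop_morph_smod Sm) (k := k)
  (l := l).
apply: functional_extensionality_dep => k; apply: functional_extensionality_dep => l.
apply: funext; apply: up_span_ind => [|x y Px Py|a x G uG xE].
- by rewrite (lin0 (UL _ _)) (lin0 (SL _ _)) (lin0 (PL _ _)).
- by rewrite (linD (UL _ _)) (linD (SL _ _)) (linD (PL _ _)) Px Py.
suff [y yE ye] : exists2 y : Up k l, up_incl y = gen G & Phi k l (up_incl y) = Psi k
  l y.
  have <- : y = x by apply: val_inj; rewrite [RHS]xE.
  by rewrite (linZ (UL _ _)) (linZ (SL _ _)) (linZ (PL _ _)) ye.
(* [Psi] is defined on [Up] only, so the induction carries a lift to [Up] of each intermediate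
   element. *)
apply: (gen_ind (R := fun k l x => exists2 y : Up k l, up_incl y = x & Phi k l
  (up_incl y) = Psi k l y)).
- move=> k1 l1 k2 l2 p q [y <- ye] [z <- ze]; exists (hcat y z) => //.
  by rewrite (prop_morph_hcat Sm) -ye -ze; exact:
    (prop_morph_hcat Pm (up_incl y) (up_incl z)).
- move=> k1 l1 m p q [y <- ye] [z <- ze]; exists (vcat y z) => //.
  by rewrite (prop_morph_vcat Sm) -ye -ze; exact:
    (prop_morph_vcat Pm (up_incl y) (up_incl z)).
- move=> k1 l1 s p [y <- ye]; exists (lact s y) => //.
  by rewrite (smod_morphL (prop_morph_smod Sm)) -ye;
    exact: (smod_morphL (prop_morph_smod Pm) s (up_incl y)).
- by exists (unit0 Up) => //; rewrite (prop_morph0 Sm); exact: (prop_morph0 Pm).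
- by exists (unit1 Up) => //; rewrite (prop_morph1 Sm); exact: (prop_morph1 Pm).
- move=> k' l' C iC [D [u [v E]]]; have uC := emb_upward E uG.
  have Cs : gen C \in span (@up_gens pl K X k' l') by apply: span_gen; exists C.
  have Cs' : Spanned Cs \in span (@up_ind_gens pl K X k' l') by apply: span_gen;
    exists C.
  exists (Spanned Cs) => //; apply: etrans (esym (SE _ _ (Spanned Cs'))).
  exact: (PE _ _ (Spanned Cs')).
Qed.

End Freeness.

(** * Corollas *)

Lemma Tagged_inj (I : eqType) (T : I -> Type) i (x y : T i) :
  Tagged T x = Tagged T y -> x = y.
Proof. by move/(congr1 (tagged_as (Tagged T x))); rewrite !tagged_asE. Qed.

Section Rank.
Variables (T : finType) (r : rel T).
Hypothesis r_order : total_order_on predT r.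

Let rr i : r i i. Proof. by case: r_order => h _ _ _; apply: h. Qed.
Let ra i j : r i j -> r j i -> i = j.
Proof. by case: r_order => _ h _ _ ij ji; apply: h; rewrite ?ij. Qed.
Let rt i j l : r i j -> r j l -> r i l.
Proof. by case: r_order => _ _ h _; apply: h. Qed.
Let rc i j : r i j || r j i.
Proof. by case: r_order => _ _ _ h; apply: h. Qed.

Lemma rank_bij k : #|T| = k ->
  exists2 rho : T -> 'I_k, bijective rho & forall i j, r i j = (rho i <= rho j)%N.
Proof.
(* [c] counts [i] itself and starts at 1; the rank is its predecessor. *)
move=> Tk; pose c i := #|[set l | r l i]|.
have c_gt0 i : (0 < c i)%N by apply/card_gt0P; exists i; rewrite inE.
have cE i j : r i j = (c i <= c j)%N.
  have sub x y : r x y -> [set l | r l x] \subset [set l | r l y].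
    by move=> xy; apply/subsetP => l; rewrite !inE => lx; apply: rt xy.
  apply/idP/idP => [/sub/subset_leq_card//|cij].
  case/orP: (rc i j) => // ji.
  have /eqP E : [set l | r l j] == [set l | r l i] by rewrite eqEcard sub.
  by have := rr i; rewrite -[r i i](in_set (r^~ i)) -E inE.
have c_lt i : ((c i).-1 < k)%N by rewrite prednK // -Tk max_card.
pose rho i := Ordinal (c_lt i).
have rhoE i j : r i j = (rho i <= rho j)%N.
  by rewrite cE /= -[in LHS](prednK (c_gt0 i)) -[in LHS](prednK (c_gt0 j)).
exists rho => //; apply: inj_card_bij; last by rewrite card_ord Tk.
by move=> i j ij; apply: ra; rewrite rhoE ij.
Qed.

End Rank.

Lemma card_ord_lt k (i : 'I_k) : #|[pred l : 'I_k | (l < i)%N]| = i.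
Proof.
rewrite -sum1_card (eq_bigl (fun l : 'I_k => (l < i)%N)) //.
rewrite (big_ord_narrow (ltnW (ltn_ord i))) /=.
by rewrite sum_nat_const card_ord muln1.
Qed.

(** An index equals the number of smaller ones, and [h] preserves this number. *)
Lemma monotone_id k (h : 'I_k -> 'I_k) : bijective h ->
  (forall i j : 'I_k, (i <= j)%N = (h i <= h j)%N) -> h =1 id.
Proof.
move=> h_bij hm i; apply: val_inj; rewrite /= -[LHS]card_ord_lt -[RHS]card_ord_lt.
by apply/esym/(card_bij h_bij) => l; rewrite /= !ltnNge hm.
Qed.

Section Corolla.
Variables (pl : bool) (X : nat -> nat -> Type) (k l : nat).

Definition corolla_shape : shape :=
  Shape unit void 'I_k 'I_l void void.

Definition corolla_index n (e : 'I_n + void) : 'I_n :=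
  match e with inl i => i | inr x => of_void _ x end.

Fact corolla_index_bij n : bijective (@corolla_index n).
Proof. by exists inl => // -[i|[]]. Qed.

Definition corolla_str : graph_on corolla_shape k l :=
  @GraphOn corolla_shape k l (fun=> tt) (fun=> tt)
    _ _ (corolla_index_bij k) (corolla_index_bij l).

Definition corolla_le n (x y : void + 'I_n) : bool :=
  match x, y with inr i, inr j => (i <= j)%N | _, _ => true end.

Fact corolla_order n (v : unit) : total_order_on [pred e : void + 'I_n | tt == v]
  (@corolla_le n).
Proof.
split=> [[[]|i] _|[[]|i] [[]|j] _ _|[[]|j] [[]|i] [[]|m] _ _ _|[[]|i] [[]|j] _ _] //=.
- by move=> ij; congr inr; apply: val_inj; apply: anti_leq.
- exact: leq_trans.
- exact: leq_total.
Qed.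

Variable x : X k l.

Fact corolla_decP (v : unit) :
  tag (Tagged (fun kl => X kl.1 kl.2) (x : (fun kl => X kl.1 kl.2) (k, l))) =
  (indeg corolla_str v, outdeg corolla_str v).
Proof.
by case: v; rewrite /indeg /outdeg /=; congr (_, _);
  rewrite (@card_inr _ _ _ predT) ?card_ord // => -[].
Qed.

Definition corolla : dgraph pl X k l :=
  DGraph (@DGraphOn pl X _ _ _ corolla_str
    (fun=> Tagged (fun kl => X kl.1 kl.2) (x : (fun kl => X kl.1 kl.2) (k, l)))
    corolla_decP
    (fun=> @Planar _ _ _ corolla_str (@corolla_le k) (@corolla_le l)
       (@corolla_order k) (@corolla_order l))).

Lemma corolla_upward : upward (underlying corolla).
Proof. by apply: upward_novertex => -[]. Qed.

Lemma corolla_indecomposable : indecomposable (underlying corolla).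
Proof.
apply: sconn_indecomposable; last by rewrite eq_card0 // => -[].
have one : forall y : node (underlying corolla), y = inl tt by case=> -[].
split; first by apply/set0Pn; exists (inl tt).
move=> D0 _; case tD: (inl tt \in D0); [right | left]; apply/setP => y;
  by rewrite (one y) tD inE.
Qed.

Definition twisted s t : dgraph pl X k l := dlact (dract corolla t) s.

Lemma twisted_upward s t : upward (underlying (twisted s t)).
Proof. exact: corolla_upward. Qed.

Lemma twisted_indecomposable s t : indecomposable (underlying (twisted s t)).
Proof.
apply: (@indecomposable_glact _ _ (gract (underlying corolla) t) s).
exact: indecomposable_gract corolla_indecomposable.
Qed.

End Corolla.

(** * Indecomposable graphs without cycles *)

Section IndecomposableUpward.
Variables (pl : bool) (X : nat -> nat -> Type) (k l : nat) (G : dgraph pl X k l).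
Hypotheses (iG : indecomposable (underlying G)) (uG : upward (underlying G)).

Lemma ind_up_shape :
  [/\ exists v : sV G, forall w, w = v, sE G -> False, sIO G -> False & sL G -> False].
Proof.
have [acG L0] := uG; have [V1 IO0 _ _ _] := iG.
have noL (x : sL G) : False by have := fintype0 x; rewrite L0 => /(_ erefl).
have noIO (x : sIO G) : False by have := fintype0 x; rewrite IO0 => /(_ erefl).
have [_ Gmin] := indecomposable_sconn iG.
pose q e e' := tgt G (inl e) == src G (inl e').
(* The sources of the edges from which [e0] can be reached form a nonempty predecessor-closed set,
   hence contain every node, in particular the target of [e0]: this closes a cycle. *)
have noE (e0 : sE G) : False.
  have [|D0|D1] := Gmin [set x | [exists e, (x == inl (src G (inl e))) && connect q e
    e0]].
  - split; first exact: subsetT.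
    move=> a b; case: a => [a|a] //= [<-]; rewrite !inE =>
      /existsP[e /andP[/eqP[te] ce]] _.
    apply/existsP; exists a; rewrite eqxx; apply: connect_trans ce.
    by apply: connect1; rewrite /q te.
  - have := in_set0 (inl (src G (inl e0)) : node (underlying G)).
    by rewrite -D0 inE => /existsP[]; exists e0; rewrite eqxx connect0.
  - have := in_setT (inl (tgt G (inl e0)) : node (underlying G)).
    rewrite -D1 inE => /existsP[e /andP[/eqP[te] /connectP[p pe e0E]]].
    have /negP[] := acG (e :: p) isT.
    by rewrite /= rcons_path pe /= -e0E te eqxx.
split=> //; have [v _] : exists v : sV G, true.
  case: V1 => [/eqP|[_ _ _ _ [_ L1]]]; last by rewrite L0 in L1.
  by rewrite -lt0n => /card_gt0P[v _]; exists v.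
exists v => w; have [|D0|D1] := Gmin [set inl v].
- split; first exact: subsetT.
  by move=> a b; case: a => [e|o] //=; case: (noE e).
- by have := in_set0 (inl v : node (underlying G)); rewrite -D0 !inE eqxx.
- have := in_setT (inl w : node (underlying G)); rewrite -D1 inE => /eqP[].
  by [].
Qed.

Lemma bij_void (A B : Type) (a : A -> False) (b : B -> False)
  (h : A -> B) : bijective h.
Proof. by exists (fun y => False_rect _ (b y)) => y; [case: (a y) | case: (b y)]. Qed.

Lemma sum_void_bij (A B C : Type) (h : A + B -> C) :
  (B -> False) -> bijective h -> bijective (h \o inl).
Proof.
move=> B0 h_bij; apply: bij_comp h_bij _.
by exists (fun y => match y with inl a => a | inr b => False_rect _ (B0 b) end) =>
  // -[a|b] //;
  case: (B0 b).
Qed.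

(** The planar case ranks by the order at the vertex; otherwise no order has to be respected and any
    enumeration will do. *)
Lemma planar_rank (T T' : finType) n (le : pl -> rel (T' + T)) :
    #|T| = n -> (forall h, total_order_on predT (le h)) ->
  exists2 rho : T -> 'I_n, bijective rho &
    forall h i j, le h (inr i) (inr j) = (rho i <= rho j)%N.
Proof.
move=> Tn leP; have [h|nh] := pselect pl.
  have [|rho rho_bij rhoE] := @rank_bij _ (fun i j : T => le h (inr i) (inr j)) _ n Tn.
    have [h1 h2 h3 h4] := leP h; split.
    + by move=> i _; apply: h1.
    + by move=> i j _ _ ij; have [] : inr i = inr j :> T' + T by apply: h2.
    + by move=> j i l' _ _ _; apply: h3.
    + by move=> i j _ _; apply: h4.
  by exists rho => // h'; rewrite (bool_irrelevance h' h).
subst n; exists enum_rank; first exact: enum_rank_bij.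
by move=> h; case: nh.
Qed.

Lemma ind_up_twisted : exists s (x : X k l) t, dequiv G (twisted pl x s t).
Proof.
have [[v vE] noE noIO noL] := ind_up_shape.
have aI_bij := sum_void_bij noIO (alpha_bij (underlying G)).
have bO_bij := sum_void_bij noIO (beta_bij (underlying G)).
have [cI cO] : #|sI G| = k /\ #|sO G| = l.
  by rewrite -[RHS]card_ord -[X in _ /\ _ = X]card_ord; split; apply: bij_eq_card;
    eassumption.
have all_order (A : finType) (t : A -> sV G) (r : rel A) :
    (forall w, total_order_on [pred e | t e == w] r) -> total_order_on predT r.
  move=> /(_ v)[h1 h2 h3 h4]; have tv a : t a == v by rewrite [t a]vE.
  by split; [move=> a _; apply: h1 | move=> a b _ _; apply: h2 |
    move=> b a c _ _ _; apply: h3 | move=> a b _ _; apply: h4]; rewrite inE tv.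
have [rI rI_bij rIE] := planar_rank cI (fun h =>
  all_order _ _ _ (leI_order (planarity G h))).
have [rO rO_bij rOE] := planar_rank cO (fun h =>
  all_order _ _ _ (leO_order (planarity G h))).
(* [t] sends an input index to the rank of its edge at the vertex, and [s] sends the rank of an
   output edge to its index; they measure how far [G] is from the standard corolla. *)
have t_inj : injective (rI \o inverse aI_bij).
  exact: bij_inj (bij_comp rI_bij (inverse_bij aI_bij)).
have s_inj : injective ((beta (underlying G) \o inl) \o inverse rO_bij).
  exact: bij_inj (bij_comp bO_bij (inverse_bij rO_bij)).
have decv : tag (dec G v) = (k, l).
  have card0 (A B : finType) (P : pred (A + B)) n : (A -> False) ->
    (forall b, P (inr b)) ->
      #|B| = n -> #|P| = n.
    move=> A0 PB <-; rewrite (@card_inr _ _ _ predT) // => a; by case: (A0 a).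
  rewrite decP; congr (_, _); apply: card0 => // e; rewrite inE; apply/eqP; exact: vE.
have [x xE] : exists x : X k l, dec G v = Tagged (fun kl => X kl.1 kl.2)
  (x : (fun kl => X kl.1 kl.2) (k, l)).
  by case: (dec G v) decv => -[k' l'] x' /= [e1 e2]; subst k' l'; exists x'.
exists (perm s_inj), x, (perm t_inj).
have iV : bijective (fun _ : sV G => tt) by exists (fun=> v) => // -[].
unshelve eexists.
  refine (@GIso _ _ _ _ (underlying G) (underlying
    (twisted pl x (perm s_inj) (perm t_inj)))
    (fun=> tt) (fun e => False_rect _ (noE e)) rI rO (fun e => False_rect _ (noIO e))
    (fun e => False_rect _ (noL e)) iV _ rI_bij rO_bij _ _ _ _ _ _) => //.
  - by apply: bij_void => // -[].
  - by apply: bij_void => // -[].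
  - by apply: bij_void => // -[].
  - case=> [i|n]; last by case: (noIO n).
    rewrite /=; congr nat_of_ord; apply: (@perm_inj _ (perm t_inj)).
    by rewrite permKV permE /= -[alpha _ _]/((alpha (underlying G) \o inl) i) inverseK.
  - case=> [i|n]; last by case: (noIO n).
    by rewrite /= permE /= inverseK.
split=> [w|h]; first by rewrite (vE w) xE.
split=> e e' _.
  case: e e' => [e|i] [e'|j]; try by [case: (noE e)|case: (noE e')].
  by rewrite rIE.
case: e e' => [e|i] [e'|j]; try by [case: (noE e)|case: (noE e')].
by rewrite rOE.
Qed.

End IndecomposableUpward.

Section Twisted.
Variables (X : nat -> nat -> Type) (k l : nat).

(** Without orders at the vertex, relabelling the output edges by [s] absorbs the permutation. *)
Lemma corolla_lact (x : X k l) s : dequiv (dlact (corolla false x) s) (corolla false x).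
Proof.
unshelve eexists.
  refine (@GIso _ _ _ _ (underlying (dlact (corolla false x) s))
    (underlying (corolla false x))
    id id id s id id (@id_bij _) (@id_bij _) (@id_bij _)
      (Bijective (permK s) (permKV s))
    (@id_bij _) (@id_bij _) _ _ _ _) => //.
  - by case.
  - by case.
by split.
Qed.

Lemma corolla_ract (x : X k l) t : dequiv (dract (corolla false x) t) (corolla false x).
Proof.
unshelve eexists.
  refine (@GIso _ _ _ _ (underlying (dract (corolla false x) t))
    (underlying (corolla false x))
    id id (t^-1)%g id id id (@id_bij _) (@id_bij _) (Bijective (permKV t) (permK t))
      (@id_bij _)
    (@id_bij _) (@id_bij _) _ _ _ _) => //.
  - by case.
  - by case.
by split.
Qed.

Lemma corolla_inj (x y : X k l) :
  dequiv (corolla false x) (corolla false y) -> x = y.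
Proof. by case=> f [/(_ tt) fd _]; apply/esym; exact: Tagged_inj fd. Qed.

(** A planar isomorphism is monotone on the edges at the vertex, hence the identity there, and [s]
    and [t] can be read off the indices. *)
Lemma twisted_inj (x y : X k l) s t s' t' :
  dequiv (twisted true x s t) (twisted true y s' t') -> [/\ s = s', x = y & t = t'].
Proof.
case=> f [/(_ tt) fd /(_ isT)[fI fO]].
have idI : isoI f =1 id.
  apply: monotone_id (isoI_bij f) _ => i j.
  exact: (fI (inr i) (inr j)).
have idO : isoO f =1 id.
  apply: monotone_id (isoO_bij f) _ => i j.
  exact: (fO (inr i) (inr j)).
split.
- apply/permP => i; apply: val_inj; have := iso_beta f (inl i).
  by rewrite /= idO.
- by apply/esym; exact: Tagged_inj fd.
- apply: invg_inj; apply/permP => i; apply: val_inj; have := iso_alpha f (inl i).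
  by rewrite /= idI.
Qed.

End Twisted.

Section InverseMorphism.
Variables (K : fieldType) (M N : smod K) (F : forall k l, M k l -> N k l).
Hypothesis F_morph : smod_morph F.
Hypothesis F_bij : forall k l, bijective (@F k l).

Lemma smod_iso_inverse : smod_iso N M.
Proof.
have F_inj k l := bij_inj (F_bij k l).
have K1 k l : cancel (inverse (F_bij k l)) (@F k l) := Kinverse (F_bij k l).
exists (fun k l => inverse (F_bij k l)); split; last by move=> k l; apply: inverse_bij.
split=> [k l a x y|k l s x|k l t x]; apply: (F_inj k l).
- by rewrite (smod_morph_linear F_morph) !K1.
- by rewrite (smod_morphL F_morph) !K1.
- by rewrite (smod_morphR F_morph) !K1.
Qed.

End InverseMorphism.

Section FreeModules.
Variables (K : fieldType) (T : choiceType).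

Lemma malg_span (x : {malg K[T]}) : x \in span (fun x => exists c, x = << c >>).
Proof.
rewrite [x]monalgE; apply: rpred_sum => c _; rewrite malgUZ rpredZ //.
by apply: span_gen; exists c.
Qed.

Lemma malg_ext (W : lmodType K) (f g : {malg K[T]} -> W) :
  linear f -> linear g -> (forall c, f << c >> = g << c >>) -> f =1 g.
Proof.
move=> fL gL fg x; move: x (malg_span x); apply: span_ind.
- by rewrite !lin0.
- by move=> x y fx fy; rewrite !linD // fx fy.
- by move=> a _ [c ->]; rewrite !linZ // fg.
Qed.

End FreeModules.

(** * The module of indecomposable acyclic graphs *)

Section CorollaModule.
Variables (pl : bool) (K : fieldType) (X : nat -> nat -> Type).
Local Notation Gr := (gr_prop pl K X).
Local Notation UpInd := (gr_up_ind pl K X).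
Local Notation gen := (@gen pl K X _ _).
Local Notation incl := (@up_ind_incl pl K X _ _).

(** Isomorphism classes are a basis: a class in the support of a combination of graphs satisfying
    [C] is the class of one of them. *)
Lemma graph_gens_gen (C : forall k l, graph k l -> Prop) k l (G : dgraph pl X k l) :
    (forall G H : graph k l, gequiv G H -> C k l G -> C k l H) ->
    (gen G : Gr k l) \in span (@graph_gens pl K X C k l) ->
  C k l (underlying G).
Proof.
move=> C_equiv GC.
suff Q x : x \in span (@graph_gens pl K X C k l) -> forall c, x@_c != 0 ->
    exists2 H : dgraph pl X k l, C k l (underlying H) & gclass H = c.
  have [|H CH /gclassP HG] := Q _ GC (gclass G); first by rewrite mcoeffUU oner_neq0.
  exact: C_equiv (dequiv_gequiv HG) CH.
move: x; apply: span_ind => [c|x y Qx Qy c|a _ [H [CH ->]] c].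
- by rewrite mcoeff0 eqxx.
- rewrite mcoeffD; have [-> |/Qx//] := eqVneq x@_c 0.
  by rewrite add0r => /Qy.
- rewrite mcoeffZ mcoeffU; case: (gclass H =P c) => [<- _|_]; first by exists H.
  by rewrite mulr0n mulr0 eqxx.
Qed.

(** [B] labels the isomorphism classes of indecomposable acyclic graphs: elements of [X k l] in the
    ordinary case, triples of an output permutation, a decoration and an input permutation in the
    planar case. *)
Variables (B : nat -> nat -> choiceType) (cor : forall k l, B k l -> dgraph pl X k l).
Hypothesis cor_ind : forall k l (b : B k l), indecomposable (underlying (cor b)).
Hypothesis cor_up : forall k l (b : B k l), upward (underlying (cor b)).
Hypothesis cor_inj : forall k l (b b' : B k l), dequiv (cor b) (cor b') -> b = b'.
Hypothesis cor_onto : forall k l (G : dgraph pl X k l),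
  indecomposable (underlying G) -> upward (underlying G) -> exists b : B k l, dequiv
    G (cor b).
Variables (bl : forall k l, 'S_l -> B k l -> B k l)
  (br : forall k l, B k l -> 'S_k -> B k l).
Hypothesis cor_lact : forall k l s (b : B k l), dequiv (dlact (cor b) s) (cor (bl s b)).
Hypothesis cor_ract : forall k l t (b : B k l), dequiv (dract (cor b) t) (cor (br b t)).
Variables (L : forall k l, 'S_l -> {malg K[B k l]} -> {malg K[B k l]}).
Variables (R : forall k l, {malg K[B k l]} -> 'S_k -> {malg K[B k l]}).
Hypothesis L_linear : forall k l (s : 'S_l), linear (@L k l s).
Hypothesis R_linear : forall k l (t : 'S_k), linear (fun x => @R k l x t).
Hypothesis LU : forall k l s (b : B k l), L s << b >> = << bl s b >>.
Hypothesis RU : forall k l t (b : B k l), R << b >> t = << br b t >>.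

Fact cor_up_span k l (b : B k l) : (gen (cor b) : Gr k l) \in span
  (@up_gens pl K X k l).
Proof. by apply: span_gen; exists (cor b). Qed.

Fact cor_ind_span k l (b : B k l) :
  Spanned (cor_up_span b) \in span (@up_ind_gens pl K X k l).
Proof. by apply: span_gen; exists (cor b). Qed.

Definition cor_elt k l (b : B k l) : UpInd k l := Spanned (cor_ind_span b).

Lemma incl_cor_elt k l (b : B k l) : incl (cor_elt b) = gen (cor b).
Proof. by []. Qed.

Definition cor_map k l : {malg K[B k l]} -> UpInd k l := lext (@cor_elt k l).

Lemma cor_mapU k l (b : B k l) : cor_map << b >> = cor_elt b.
Proof. exact: lextU. Qed.

Lemma cor_map_linear k l : linear (@cor_map k l).
Proof. exact: lext_is_linear. Qed.

Let incl_linear k l := smod_morph_linear (@up_ind_incl_morph pl K X) (k := k) (l := l).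

(** Coordinates on the corollas, zero on all other classes. Being defined on the whole of [Gr], it
    gives a left inverse of [cor_map] by plain linear extension. *)
Definition cor_coord k l : Gr k l -> {malg K[B k l]} :=
  lext (fun c => match pselect (exists b : B k l, gclass (cor b) = c) with
                 | left e => << sval (cid e) >>
                 | right _ => 0
                 end).

Lemma cor_coordE k l (b : B k l) : cor_coord (gen (cor b)) = << b >>.
Proof.
rewrite /cor_coord lextU; case: pselect => [e|[]]; last by exists b.
by have /gclassP/cor_inj-> := svalP (cid e).
Qed.

Lemma cor_map_bij k l : bijective (@cor_map k l).
Proof.
apply: surj_inj_bij.
  apply: (can_inj (g := fun y => cor_coord (incl y))) => x.
  apply: (malg_ext (f := fun x => cor_coord (incl (cor_map x))) (g := id)) x => // [|b].
    exact: linear_comp (@lext_is_linear _ _ _ _)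
      (linear_comp (@incl_linear k l) (@cor_map_linear k l)).
  by rewrite cor_mapU incl_cor_elt cor_coordE.
apply: spanned_ind => [|x y [x' <-] [y' <-]|a x [G [iG xE]]].
- by exists 0; rewrite (lin0 (@cor_map_linear k l)).
- by exists (x' + y'); rewrite (linD (@cor_map_linear k l)).
(* A generator of the submodule is known to be the class of an indecomposable graph lying in the
   acyclic span; that the graph itself is acyclic has to be recovered from the basis. *)
have uG : upward (underlying G).
  apply: (@graph_gens_gen (@upward)) => [H H'|]; first exact: upward_gequiv.
  by rewrite -xE; apply: valP.
have [b Gb] := cor_onto iG uG; exists (a *: << b >>).
rewrite (linZ (@cor_map_linear k l)) cor_mapU; congr (_ *: _).
apply: (@up_ind_incl_inj pl K X); rewrite incl_cor_elt -(gen_dequiv K Gb).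
by rewrite -xE.
Qed.

(** The morphism is easy to define out of the module with basis [B], so it is built in that
    direction and then inverted. *)
Lemma corolla_smod_iso : smod_iso UpInd (SMod L R).
Proof.
apply: (@smod_iso_inverse _ (SMod L R) UpInd cor_map _ cor_map_bij).
have [_ iL iR] := @up_ind_incl_morph pl K X.
have inj k l := @up_ind_incl_inj pl K X k l.
have [uL uR] : (forall k l s, linear (@lact K UpInd k l s)) /\
    (forall k l t, linear (fun x : UpInd k l => ract x t)).
  have [h1 h2 _ _ _ _ _] := prop_is_smod (gr_is_prop pl K X).
  split=> k l s a x y; apply: inj.
    by rewrite iL !incl_linear h1 !iL.
  by rewrite iR !incl_linear (h2 k l s a (incl x) (incl y)) !iR.
split=> [k l|k l s x|k l t x].
- exact: cor_map_linear.
- apply: (malg_ext (f := fun x => cor_map (L s x))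
    (g := fun x => lact s (cor_map x))) x => [||b].
  + exact: linear_comp (@cor_map_linear k l) (@L_linear k l s).
  + exact: linear_comp (uL k l s) (@cor_map_linear k l).
  rewrite LU !cor_mapU; apply: inj; rewrite iL !incl_cor_elt lact_gen.
  exact/esym/gen_dequiv/cor_lact.
- apply: (malg_ext (f := fun x => cor_map (R x t))
    (g := fun x => ract (cor_map x) t)) x => [||b].
  + exact: linear_comp (@cor_map_linear k l) (@R_linear k l t).
  + exact: linear_comp (uR k l t) (@cor_map_linear k l).
  rewrite RU !cor_mapU; apply: inj; rewrite iR !incl_cor_elt ract_gen.
  exact/esym/gen_dequiv/cor_ract.
Qed.

End CorollaModule.

Lemma gr_up_ind_trivial (K : fieldType) (X : nat -> nat -> Type) :
  smod_iso (Gr_up_ind K X) (trivial_smod K X).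
Proof.
apply: (@corolla_smod_iso false K X (fun k l => {classic X k l})
  (fun k l x => corolla false x) _ _ _ _ (fun k l s x => x) (fun k l x t => x)) => //.
- by move=> k l x; apply: corolla_indecomposable.
- by move=> k l x; apply: corolla_upward.
- by move=> k l x y; apply: corolla_inj.
- move=> k l G iG uG; have [s [x [t E]]] := ind_up_twisted iG uG; exists x.
  apply: dequiv_trans E _; apply: dequiv_trans (dlact_equiv s (corolla_ract x t)) _.
  exact: corolla_lact.
- by move=> k l s x; apply: corolla_lact.
- by move=> k l t x; apply: corolla_ract.
Qed.

Lemma pgr_up_ind_free (K : fieldType) (X : nat -> nat -> Type) :
  smod_iso (PGr_up_ind K X) (free_smod K X).
Proof.
apply: (@corolla_smod_iso true K X (fun k l => {classic 'S_l * X k l * 'S_k})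
  (fun k l b => twisted true b.1.2 b.1.1 b.2) _ _ _ _
  (fun k l s b => (permc s b.1.1, b.1.2, b.2)) (fun k l b t => (b.1, permc b.2 t))).
- by move=> k l b; apply: twisted_indecomposable.
- by move=> k l b; apply: twisted_upward.
- by move=> k l [[s x] t] [[s' x'] t'] e; have [/= -> -> ->] := @twisted_inj X k l x
    x' s t s' t' e.
- move=> k l G iG uG; have [s [x [t E]]] := ind_up_twisted iG uG.
  by exists (s, x, t).
- move=> k l s [[s' x] t] /=; apply: dequiv_sym; exact: dequiv_lactM.
- move=> k l t [[s x] t'] /=; rewrite /twisted.
  apply: dequiv_trans (dequiv_sym (dequiv_lract _ _ _)) _.
  by apply: dlact_equiv; apply: dequiv_sym; apply: dequiv_ractM.
- by move=> k l s; apply: lext_is_linear.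
- by move=> k l t; apply: lext_is_linear.
- by move=> k l s b; rewrite lextU.
- by move=> k l t b; rewrite lextU.
Qed.

Theorem theorem4p4 (K : fieldType) (X : nat -> nat -> Type) :
  (free_prop (Q := Gr K X) (M := Gr_ind K X) (@gr_ind_incl false K X) /\
   free_prop (Q := Gr_up K X) (M := Gr_up_ind K X) (@gr_up_ind_incl false K X) /\
   smod_iso (Gr_up_ind K X) (trivial_smod K X)) /\
  (free_prop (Q := PGr K X) (M := PGr_ind K X) (@gr_ind_incl true K X) /\
   free_prop (Q := PGr_up K X) (M := PGr_up_ind K X) (@gr_up_ind_incl true K X) /\
   smod_iso (PGr_up_ind K X) (free_smod K X)).
Proof.
split; split; [exact: gr_free | split | exact: gr_free | split].
- exact: gr_up_free.
- exact: gr_up_ind_trivial.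
- exact: gr_up_free.
- exact: pgr_up_ind_free.
Qed.
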